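(* Let $g\ge 1$ and let $w\in\mathbb{Q}^n\cap(0,1]^n$ for some $n$ such that $2g-2+n\ge 3$. Then $\operatorname{Aut}(\Delta_{g,w})\cong\operatorname{Aut}(K_w)$, where $\operatorname{Aut}(K_w)$ acts on $\Delta_{g,w}$ by permuting the markings. That is, $\sigma\mapsto\big([\mathbf{G},\tau]\mapsto[\sigma\cdot\mathbf{G},\tau]\big)$ is a group isomorphism $\operatorname{Aut}(K_w)\to\operatorname{Aut}(\Delta_{g,w})$.
   Context: For $S\subseteq\{1,\dots,n\}$ put $w(S)=\sum_{i\in S}w_i$. $K_w$ is the abstract simplicial complex with vertex set $\{1,\dots,n\}$ in which $S$ is a face iff $w(S)\le 1$; $\operatorname{Aut}(K_w)\le S_n$ is the group of permutations $\sigma$ of $\{1,\dots,n\}$ with $S\in K_w\iff\sigma(S)\in K_w$. Graphs. A $w$-stable graph of genus $g$ is a triple $\mathbf{G}=(G,h,m)$ where $G$ is a finite connected graph (loops and multiple edges allowed), $h:V(G)\to\mathbb{Z}_{\ge0}$ and $m:\{1,\dots,n\}\to V(G)$ are functions, with $b^1(G)+\sum_{v}h(v)=g$, where $b^1(G)=|E(G)|-|V(G)|+1$, and $2h(v)-2+\operatorname{val}(v)+w(m^{-1}(v))>0$ for every vertex $v$; $\operatorname{val}(v)$ is the number of half-edges at $v$ (a loop contributes 2). Isomorphisms are graph isomorphisms compatible with $h$ and $m$. Contracting a non-loop edge merges its endpoints, adding their $h$-values and uniting their markings; contracting a loop deletes it and increases $h$ of its vertex by 1. Contractions of $w$-stable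 graphs are $w$-stable. For $\sigma\in S_n$ put $\sigma\cdot\mathbf{G}=(G,h,m\circ\sigma^{-1})$ (same edges as $\mathbf G$); for $\sigma\in\operatorname{Aut}(K_w)$ this preserves $w$-stability. Edge-labelled graphs. For $p\ge0$ let $[p]=\{0,\dots,p\}$. An edge-labelled graph is a pair $(\mathbf{G},\tau)$ with $\tau:E(\mathbf{G})\to[p]$ a bijection; isomorphisms of pairs must respect the labels; $[\mathbf{G},\tau]$ denotes the isomorphism class. Symmetric $\Delta$-complexes. Let $\mathrm{I}$ be the category with objects $[p]$, $p\ge 0$, and morphisms all injections. A symmetric $\Delta$-complex is a functor $\mathrm{I}^{\mathrm{op}}\to\mathsf{Set}$; a morphism is a natural transformation. $\Delta_{g,w}$ is the symmetric $\Delta$-complex with $\Delta_{g,w}[p]$ the set of classes $[\mathbf{G},\tau]$ of edge-labelled $w$-stable graphs of genus $g$ with $p+1$ edges; for an injection $\iota:[p]\to[q]$, $\iota^*[\mathbf{G},\tau]$ is obtained by contracting all edges whose label is not in the image of $\iota$ and labelling each remaining edge $e$ by $\iota^{-1}(\tau(e))$. $\operatorname{Aut}(\Delta_{g,w})$ is its group of natural automorphisms. *)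

(* Defs.v *)
From HB Require Import structures.
From mathcomp Require Import all_boot all_order all_fingroup all_algebra.
From mathcomp Require Import boolp.
From mathcomp Require Import zify ring lra.

Set Implicit Arguments.
Unset Strict Implicit.
Unset Printing Implicit Defensive.

Import Order.TTheory GRing.Theory Num.Theory.
Local Open Scope ring_scope.

(* The markings 1, ..., n are indexed by 'I_n, and the label set [p] is        *)
(* 'I_p.+1.                                                                    *)

Definition weight n (w : 'I_n -> rat) (S : {set 'I_n}) : rat := \sum_(i in S) w i.

Definition Kw n (w : 'I_n -> rat) : {set {set 'I_n}} := [set S | weight w S <= 1].

Definition Aut_Kw_set n (w : 'I_n -> rat) : {set 'S_n} :=
  [set s : 'S_n | [forall S : {set 'I_n}, (S \in Kw w) == (s @: S \in Kw w)]].

Lemma Aut_Kw_group_set n (w : 'I_n -> rat) : group_set (Aut_Kw_set w).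
Proof.
apply/group_setP; split.
  rewrite inE; apply/forallP => S; rewrite (_ : _ @: S = S) //.
  by rewrite -[RHS]imset_id; apply: eq_imset => i; rewrite perm1.
move=> s t; rewrite !inE => /forallP hs /forallP ht; apply/forallP => S.
rewrite (eqP (hs S)) (eqP (ht (s @: S))) -imset_comp.
by rewrite (_ : _ @: S = (s * t)%g @: S) //; apply: eq_imset => i; rewrite permM.
Qed.

Canonical Aut_Kw n (w : 'I_n -> rat) : {group 'S_n} := Group (Aut_Kw_group_set w).

(* A finite graph with loops and multiple edges: [ends e] is the set of        *)
(* endpoints of e, a singleton exactly when e is a loop.                       *)
Record mgraph (n : nat) := MGraph {
  vert : finType;
  edge : finType;
  ends : edge -> {set vert};
  ends_card : forall e, (0 < #|ends e| <= 2)%N;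
  hgen : vert -> nat;
  mark : 'I_n -> vert }.

Arguments ends {n G} e : rename.
Arguments ends_card {n G} e : rename.
Arguments hgen {n G} v : rename.
Arguments mark {n} G i : rename.

Definition is_loop n (G : mgraph n) (e : edge G) : bool := #|ends e| == 1%N.

Definition valence n (G : mgraph n) (v : vert G) : nat :=
  \sum_(e : edge G | v \in ends e) (if is_loop e then 2 else 1).

Definition adj n (G : mgraph n) : rel (vert G) :=
  fun u v => [exists e : edge G, (u \in ends e) && (v \in ends e)].

Definition connected n (G : mgraph n) : bool :=
  (0 < #|vert G|)%N && [forall u : vert G, forall v, connect (adj (G := G)) u v].

Definition b1 n (G : mgraph n) : int := #|edge G|%:Z - #|vert G|%:Z + 1.

Definition genus n (G : mgraph n) : int := b1 G + \sum_(v : vert G) (hgen v)%:Z.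

Record stable (g n : nat) (w : 'I_n -> rat) (G : mgraph n) : Prop := Stable {
  stable_connected : connected G;
  stable_genus : genus G = g%:Z;
  stable_vert : forall v : vert G,
    0 < 2 * (hgen v)%:R - 2 + (valence v)%:R + weight w [set i | mark G i == v] }.

Definition is_iso n (G H : mgraph n) (fV : vert G -> vert H)
    (fE : edge G -> edge H) : Prop :=
  [/\ bijective fV, bijective fE,
      forall e, ends (fE e) = fV @: ends e,
      forall v, hgen (fV v) = hgen v
    & forall i, mark H i = fV (mark G i)].

(* Contraction of a single edge e. The vertices of G / e are the blocks of the *)
(* partition of vert G whose only possibly non-trivial block is [ends e]; when *)
(* e is a loop all blocks are singletons.                                      *)
Section Contraction.
Variables (n : nat) (G : mgraph n) (e : edge G).

Definition block (v : vert G) : {set vert G} :=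
  if v \in ends e then ends e else [set v].

Definition cvert : finType := {B : {set vert G} | B \in [set block v | v : vert G]}.
Definition cedge : finType := {f : edge G | f != e}.

Definition cproj (v : vert G) : cvert :=
  exist _ (block v) (imset_f block (isT : v \in predT)).

Definition cends (f : cedge) : {set cvert} := cproj @: ends (val f).

Lemma cends_card f : (0 < #|cends f| <= 2)%N.
Proof.
have /andP[h0 h2] := ends_card (val f).
rewrite (leq_trans (leq_imset_card _ _) h2) andbT.
by case/card_gt0P: h0 => v hv; apply/card_gt0P; exists (cproj v); apply: imset_f.
Qed.

Definition chgen (B : cvert) : nat :=
  (\sum_(v in val B) hgen v + (is_loop e && (val B == ends e)))%N.

Definition contract : mgraph n :=
  MGraph cends_card chgen (fun i => cproj (mark G i)).

End Contraction.

(* A graph whose edges carry labels in L.                                      *)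
Record lgraph (n : nat) (L : Type) := LGraph {
  lgr :> mgraph n;
  lab : edge lgr -> L }.

Arguments lab {n L x} e : rename.

Definition liso n L (x y : lgraph n L) : Prop :=
  exists (fV : vert x -> vert y) (fE : edge x -> edge y),
    is_iso fV fE /\ forall e, lab (fE e) = lab e.

Definition relabel n L L' (r : L -> L') (x : lgraph n L) : lgraph n L' :=
  @LGraph n L' x (fun e => r (lab e)).

(* Labels are pairwise distinct in all uses, so at most one edge is labelled l. *)
Definition contract_label n (L : eqType) (l : L) (x : lgraph n L) : lgraph n L :=
  if [pick e : edge x | lab e == l] is Some e
  then @LGraph n L (contract e) (fun f => lab (val f))
  else x.

Definition contract_labels n (L : eqType) (s : seq L) (x : lgraph n L) : lgraph n L :=
  foldr (@contract_label n L) x s.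

Definition perm_graph n (s : 'S_n) (G : mgraph n) : mgraph n :=
  MGraph (@ends_card n G) (@hgen n G) (fun i => mark G ((s^-1)%g i)).

Record egraph (g n : nat) (w : 'I_n -> rat) (p : nat) := EGraph {
  egr :> lgraph n 'I_p.+1;
  egr_stable : stable g w egr;
  egr_bij : bijective (@lab n _ egr) }.

Record Ihom (p q : nat) := IHom {
  Ifun :> 'I_p.+1 -> 'I_q.+1;
  Ifun_inj : injective Ifun }.

Definition Iid p : Ihom p p := IHom (@inj_id 'I_p.+1).
Definition Icomp p q r (i : Ihom q r) (j : Ihom p q) : Ihom p r :=
  IHom (inj_comp (@Ifun_inj _ _ i) (@Ifun_inj _ _ j)).

(* The inverse of i on its image; ord0 is a junk value off the image.          *)
Definition Iinv p q (i : Ihom p q) (l : 'I_q.+1) : 'I_p.+1 :=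
  odflt ord0 [pick k | i k == l].

Definition pull_lgraph n p q (i : Ihom p q) (x : lgraph n 'I_q.+1) : lgraph n 'I_p.+1 :=
  relabel (Iinv i)
    (contract_labels [seq l <- enum 'I_q.+1 | l \notin codom i] x).

Section ContractionMorphism.
Variable n : nat.

Definition adjC (G H : mgraph n) (ep : edge H -> edge G) : rel (vert G) :=
  fun u v => [exists e, [&& e \notin codom ep, u \in ends e & v \in ends e]].

(* (pi, ep) exhibits H as the result of contracting all the edges of G outside *)
(* the image of ep, in any order.                                              *)
Record is_contr (G H : mgraph n) (pi : vert G -> vert H)
    (ep : edge H -> edge G) : Prop := IsContr {
  c_inj : injective ep;
  c_surj : forall y, exists x, pi x == y;
  c_ends : forall e, ends e = pi @: ends (ep e);
  c_mark : forall i, mark H i = pi (mark G i);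
  c_conn : forall u v, pi u = pi v <-> connect (adjC ep) u v;
  c_h : forall y, (hgen y + \sum_(x | pi x == y) 1 = \sum_(x | pi x == y) hgen x
      + \sum_(e | (e \notin codom ep) && (pi @: ends e == [set y])) 1 + 1)%N }.

Lemma ends_ex (G : mgraph n) (e : edge G) : exists v, v \in ends e.
Proof. by have /andP[/card_gt0P] := ends_card e. Qed.

Lemma contr_sing (G H : mgraph n) (pi : vert G -> vert H) ep (e : edge G) :
  is_contr pi ep -> e \notin codom ep ->
  exists y, pi @: ends e = [set y].
Proof.
move=> hc he; have [v hv] := ends_ex e; exists (pi v).
apply/setP => y; rewrite inE; apply/imsetP/eqP => [[u hu ->]|->]; last by exists v.
apply/(c_conn hc)/connect1/existsP; exists e; by rewrite he hu hv.
Qed.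

Lemma contr_sum_sing (G H : mgraph n) (pi : vert G -> vert H) ep (P : pred (vert H)) :
  is_contr pi ep ->
  (\sum_(y | P y) \sum_(e | (e \notin codom ep) && (pi @: ends e == [set y])) 1
   = \sum_(e | (e \notin codom ep) && [exists y, P y && (pi @: ends e == [set y])]) 1)%N.
Proof.
move=> hc.
rewrite (exchange_big_dep (fun e => e \notin codom ep)) /=; last by move=> y e _ /andP[].
rewrite [RHS]big_mkcondr /=; apply: eq_bigr => e he.
have [y0 ->] := contr_sing hc he.
case: existsP => [[y /andP[Py /eqP/set1_inj ey]]|hN].
  rewrite (bigD1 y) /=; last by rewrite he Py ey eqxx.
  rewrite big1 // => z /andP[/and3P[_ _ /eqP/set1_inj ez]]; subst; by rewrite eqxx.
rewrite big1 // => z /and3P[Pz _ hz]; case: hN; exists z; by rewrite Pz.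
Qed.

Lemma contr_trans_arith (h r sh t f sg e : nat) :
  (h + r = sh + t + 1 -> sh + f = sg + e + r -> h + f = sg + (e + t) + 1)%N.
Proof. lia. Qed.

Lemma contr_trans (G H J : mgraph n) (pi : vert G -> vert H) ep
    (rho : vert H -> vert J) de :
  is_contr pi ep -> is_contr rho de -> is_contr (rho \o pi) (ep \o de).
Proof.
move=> h1 h2; split.
- exact: inj_comp (c_inj h1) (c_inj h2).
- move=> z; have [y /eqP <-] := c_surj h2 z; have [x /eqP <-] := c_surj h1 y.
  by exists x => /=.
- by move=> e; rewrite (c_ends h2) (c_ends h1) -imset_comp.
- by move=> i; rewrite (c_mark h2) (c_mark h1).
- move=> u v; split=> /= [|].
    move/(c_conn h2) => /connectP[q].
    elim: q u => [|a q IH] u /=.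
      move=> _ /esym/(c_conn h1) huv.
      apply: connect_sub huv => x y /existsP[e /and3P[he hx hy]].
      apply/connect1/existsP; exists e; rewrite hx hy !andbT.
      by apply: contra he => /codomP[f ->]; apply: codom_f.
    case/andP=> /existsP[f /and3P[hf]].
    rewrite (c_ends h1) => /imsetP[u' hu' eu] /imsetP[a' ha' ea] hp hl.
    subst a; apply: connect_trans (IH a' hp hl).
    apply: (@connect_trans _ _ u').
      move/(c_conn h1): eu => huv.
      apply: connect_sub huv => x y /existsP[e /and3P[he hx hy]].
      apply/connect1/existsP; exists e; rewrite hx hy !andbT.
      by apply: contra he => /codomP[f' ->]; apply: codom_f.
    apply/connect1/existsP; exists (ep f); rewrite hu' ha' !andbT.
    apply: contra hf => /codomP[k /= /(c_inj h1) ->]; exact: codom_f.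
  case/connectP => q; elim: q u => [|a q IH] u /=; first by move=> _ ->.
  case/andP=> /existsP[e /and3P[he hu ha]] hp hl; rewrite -(IH _ hp hl).
  case: (boolP (e \in codom ep)) => [/codomP[f ef]|he'].
    subst e; apply/(c_conn h2)/connect1/existsP; exists f.
    rewrite !(c_ends h1) !imset_f // !andbT.
    by apply: contra he => /codomP[k ->]; apply: (codom_f (ep \o de)).
  congr (rho _); apply/(c_conn h1)/connect1/existsP; exists e; by rewrite he' hu ha.
- move=> z.
  have e1 : (\sum_(y | rho y == z) (hgen y + \sum_(x | pi x == y) 1)
     = \sum_(y | rho y == z) (\sum_(x | pi x == y) hgen x
      + \sum_(e | (e \notin codom ep) && (pi @: ends e == [set y])) 1 + 1))%N.
    by apply: eq_bigr => y _; apply: (c_h h1).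
  have e2 := c_h h2 z.
  rewrite !big_split /= (contr_sum_sing _ h1) in e1.
  have part (F : vert G -> nat) :
      (\sum_(y | rho y == z) \sum_(x | pi x == y) F x
       = \sum_(x | rho (pi x) == z) F x)%N.
    rewrite [RHS](partition_big pi (fun y => rho y == z)) //=.
    apply: eq_bigr => y /eqP <-; apply: eq_bigl => x.
    by case: eqP => [->|]; rewrite ?eqxx ?andbF.
  rewrite !part in e1.
  have e3 : (\sum_(e | (e \notin codom (ep \o de))
        && ((rho \o pi) @: ends e == [set z])) 1
     = \sum_(e | (e \notin codom ep)
        && [exists y, (rho y == z) && (pi @: ends e == [set y])]) 1
     + \sum_(f | (f \notin codom de) && (rho @: ends f == [set z])) 1)%N.
    rewrite (bigID (fun e => e \in codom ep)) /= addnC; congr (_ + _)%N.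
      apply: eq_bigl => e; rewrite andbC; case: (boolP (e \in codom ep)) => //= he.
      have -> : (e \notin codom (ep \o de)).
        by apply: contra he => /codomP[f ->]; apply: codom_f.
      have [y0 hy0] := contr_sing h1 he.
      rewrite imset_comp hy0 imset_set1 /=.
      apply/eqP/existsP => [/set1_inj <-|[y /andP[/eqP <- /eqP/set1_inj ->]] //].
      by exists y0; rewrite !eqxx.
    rewrite -(big_imset (h := ep) (fun=> 1%N) (A := mem
       [pred f | (f \notin codom de) && (rho @: ends f == [set z])])) /=; last first.
      by move=> ? ? _ _ /(c_inj h1).
    apply: eq_bigl => e; apply/andP/imsetP => [[/andP[h3 h4] /codomP[f ef]]|].
      exists f => //; rewrite unfold_in /=; subst e; rewrite (c_ends h1) -imset_comp h4 andbT.
      by apply: contra h3 => /codomP[k ->]; apply: (codom_f (ep \o de)).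
    case=> f; rewrite unfold_in /= => /andP[h3 h4] ->; rewrite imset_comp -(c_ends h1) h4.
    rewrite andbT codom_f; split=> //; apply: contra h3.
    by case/codomP => k /(c_inj h1) ->; apply: codom_f.
  rewrite e3 /=; exact: contr_trans_arith e2 e1.
Qed.

Lemma contr_unique (G H H' : mgraph n) (pi : vert G -> vert H) ep
    (pi' : vert G -> vert H') ep' :
  is_contr pi ep -> is_contr pi' ep' -> codom ep =i codom ep' ->
  exists (fV : vert H -> vert H') (fE : edge H -> edge H'),
    is_iso fV fE /\ forall e, ep' (fE e) = ep e.
Proof.
move=> h1 h2 hcod.
have adjE : adjC ep =2 adjC ep' by move=> u v; apply: eq_existsb => e; rewrite hcod.
have piE u v : pi u = pi v <-> pi' u = pi' v.
  by split=> [/(c_conn h1)|/(c_conn h2)] hh; [apply/(c_conn h2)|apply/(c_conn h1)];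
    rewrite ?(eq_connect adjE) // -(eq_connect adjE).
pose fV y := pi' (xchoose (c_surj h1 y)).
pose fV' y := pi (xchoose (c_surj h2 y)).
have fVE x : fV (pi x) = pi' x.
  by apply/piE; apply/eqP; apply: (xchooseP (c_surj h1 (pi x))).
have fVE' x : fV' (pi' x) = pi x.
  by apply/piE; apply/eqP; apply: (xchooseP (c_surj h2 (pi' x))).
have inE1 e : ep e \in codom ep' by rewrite -hcod codom_f.
have inE2 e : ep' e \in codom ep by rewrite hcod codom_f.
pose fE e := iinv (inE1 e); pose fE' e := iinv (inE2 e).
have fEE e : ep' (fE e) = ep e by rewrite f_iinv.
have fEE' e : ep (fE' e) = ep' e by rewrite f_iinv.
have fVpi : fV \o pi =1 pi' by move=> x; apply: fVE.
exists fV, fE; split=> //; split.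
- exists fV' => y.
    by have [x /eqP <-] := c_surj h1 y; rewrite fVE fVE'.
  by have [x /eqP <-] := c_surj h2 y; rewrite fVE' fVE.
- exists fE' => e; first by apply: (c_inj h1); rewrite fEE' fEE.
  by apply: (c_inj h2); rewrite fEE fEE'.
- by move=> e; rewrite (c_ends h2) (c_ends h1) fEE -imset_comp; apply: eq_imset.
- move=> y; have [x0 /eqP ex0] := c_surj h1 y.
  have fib x : (pi' x == fV y) = (pi x == y).
    by rewrite -ex0 fVE; apply/eqP/eqP => /piE.
  have img e : (pi' @: ends e == [set fV y]) = (pi @: ends e == [set y]).
    have -> : pi' @: ends e = fV @: (pi @: ends e).
      by rewrite -imset_comp; apply: eq_imset => x; rewrite /= fVE.
    rewrite -imset_set1 (inj_eq (imset_inj _)) // => a b.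
    have [x /eqP <-] := c_surj h1 a; have [x' /eqP <-] := c_surj h1 b.
    by rewrite !fVE => /piE.
  have := c_h h1 y; have := c_h h2 (fV y).
  rewrite !(eq_bigl _ _ fib).
  rewrite [X in (_ + X + 1)%N](eq_bigl (fun e => (e \notin codom ep)
     && (pi @: ends e == [set y]))); last by move=> e; rewrite img hcod.
  by move=> <- /addIn ->.
- by move=> i; rewrite (c_mark h1) fVE (c_mark h2).
Qed.

Lemma connect_false (T : finType) (r : rel T) u v :
  (forall a b, r a b = false) -> connect r u v -> u = v.
Proof. by move=> hr /connectP[[|a q] /= hp ->] //; move: hp; rewrite hr. Qed.

Lemma iso_contr (G H : mgraph n) (fV : vert G -> vert H) fE fE' :
  is_iso fV fE -> cancel fE fE' -> cancel fE' fE -> is_contr fV fE'.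
Proof.
case=> [[fV' K1 K2] _ he hh hm] K3 K4.
have cod e : e \in codom fE' by rewrite -(K3 e) codom_f.
split=> //.
- exact: can_inj K4.
- by move=> y; exists (fV' y); rewrite K2.
- by move=> e; rewrite -he K4.
- move=> u v; split=> [/(can_inj K1) -> //|/connect_false -> // a b].
  by apply/existsP => -[e]; rewrite cod.
- move=> y; rewrite [X in (_ + X + 1)%N]big1 => [|e]; last by rewrite cod.
  have eqy x : (fV x == y) = (x == fV' y) by rewrite (can2_eq K1 K2).
  rewrite !(eq_bigl _ _ eqy) !big_pred1_eq -{1}(K2 y) hh; lia.
Qed.

Lemma contr_id (G : mgraph n) : is_contr (@id (vert G)) (@id (edge G)).
Proof.
apply: (@iso_contr _ _ id id id) => //; split=> //; try by exists id.
by move=> e; rewrite imset_id.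
Qed.

Lemma contr_connected (G H : mgraph n) (pi : vert G -> vert H) ep :
  is_contr pi ep -> connected G -> connected H.
Proof.
move=> hc /andP[/card_gt0P[x0 _] /forallP hG]; apply/andP; split.
  by apply/card_gt0P; exists (pi x0).
apply/forallP => u; apply/forallP => v.
have [x /eqP <-] := c_surj hc u; have [y /eqP <-] := c_surj hc v.
have /forallP/(_ y)/connectP[q] := hG x.
elim: q x => [|a q IH] x /=; first by move=> _ ->.
case/andP => /existsP[e /andP[hx ha]] hp hl; apply: connect_trans (IH _ hp hl).
case: (boolP (e \in codom ep)) => [/codomP[f ef]|he].
  by subst e; apply/connect1/existsP; exists f; rewrite !(c_ends hc) !imset_f.
have -> : pi x = pi a; last exact: connect0.
by apply/(c_conn hc)/connect1/existsP; exists e; rewrite he hx ha.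
Qed.

Lemma sum_edges (G H : mgraph n) (pi : vert G -> vert H) ep (F : edge G -> nat) :
  is_contr pi ep ->
  (\sum_e F e = \sum_(e | e \notin codom ep) F e + \sum_f F (ep f))%N.
Proof.
move=> hc; rewrite (bigID (fun e => e \in codom ep)) /= addnC; congr (_ + _)%N.
rewrite -(big_imset (h := ep) F (A := mem predT)) /=; last by move=> ? ? _ _ /(c_inj hc).
by apply: eq_bigl => e; apply/codomP/imsetP => [[f ->]|[f _ ->]]; exists f.
Qed.

Lemma contr_genus_arith (a b vG vH eG eH s : nat) :
  (a + vG = b + s + vH)%N -> (eG = s + eH)%N ->
  eH%:Z - vH%:Z + 1 + a%:Z = eG%:Z - vG%:Z + 1 + b%:Z.
Proof. lia. Qed.

Lemma contr_genus (G H : mgraph n) (pi : vert G -> vert H) ep :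
  is_contr pi ep -> genus H = genus G.
Proof.
move=> hc; rewrite /genus /b1.
have e1 : (\sum_y (hgen y + \sum_(x | pi x == y) 1)
   = \sum_y (\sum_(x | pi x == y) hgen x
    + \sum_(e | (e \notin codom ep) && (pi @: ends e == [set y])) 1 + 1))%N.
  by apply: eq_bigr => y _; apply: (c_h hc).
have part (F : vert G -> nat) : (\sum_y \sum_(x | pi x == y) F x = \sum_x F x)%N.
  by rewrite [RHS](partition_big pi predT).
rewrite !big_split /= !part (contr_sum_sing _ hc) in e1.
have e2 := sum_edges (fun=> 1%N) hc.
have e3 : (\sum_(e | (e \notin codom ep) && [exists y, true && (pi @: ends e == [set y])]) 1
  = \sum_(e | e \notin codom ep) 1)%N.
  apply: eq_bigl => e; case: (boolP (e \in codom ep)) => //= he.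
  by have [y hy] := contr_sing hc he; apply/existsP; exists y; rewrite hy.
rewrite e3 !sum1_card in e1; rewrite !sum1_card in e2.
have z (X : mgraph n) : \sum_(v : vert X) (hgen v)%:Z = (\sum_(v : vert X) hgen v)%N%:Z.
  by rewrite (big_morph Posz PoszD (erefl _)).
rewrite !z; exact: contr_genus_arith e1 e2.
Qed.

Lemma fiber_edge (G H : mgraph n) (pi : vert G -> vert H) (e : edge G) y :
  (\sum_(x | (pi x == y) && (x \in ends e)) (if is_loop e then 2 else 1)
   = if y \in pi @: ends e then (if #|pi @: ends e| == 1 then 2 else 1) else 0)%N.
Proof.
rewrite /is_loop; have := ends_card e.
case: (boolP (#|ends e| == 1)%N) => [/cards1P[a ->] _|n1 h2].
  rewrite imset_set1 cards1 inE /= (eq_bigl (fun x => (x == a) && (pi x == y))).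
    rewrite big_mkcondr big_pred1_eq eq_sym; by case: ifP.
  by move=> x; rewrite inE andbC.
have /cards2P[a [b [ab ->]]] : (#|ends e| == 2)%N by move: n1 h2; case: #|_| => [|[|[|]]].
rewrite imsetU1 imset_set1.
have -> : (\sum_(x | (pi x == y) && (x \in [set a; b])) 1
          = (pi a == y) + (pi b == y))%N.
  rewrite (eq_bigl (fun x => (x \in [set a; b]) && (pi x == y))) => [|x]; last exact: andbC.
  rewrite big_mkcondr big_setU1 ?inE //= big_set1; by do 2!case: ifP.
rewrite cards2 !inE ![y == _]eq_sym; case: (eqVneq (pi a) (pi b)) => [->|nab] /=.
  by rewrite orbb; case: ifP.
case: (eqVneq (pi a) y) nab => [->|_ _]; first by rewrite eq_sym => /negPf ->.
by case: (pi b == y).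
Qed.

Lemma contr_valence (G H : mgraph n) (pi : vert G -> vert H) ep y :
  is_contr pi ep ->
  (\sum_(x | pi x == y) valence x
   = (\sum_(e | (e \notin codom ep) && (pi @: ends e == [set y])) 1) * 2 + valence y)%N.
Proof.
move=> hc; rewrite /valence (exchange_big_dep predT) //= (sum_edges _ hc).
congr (_ + _)%N.
  rewrite big_distrl /= [RHS]big_mkcondr /=; apply: eq_bigr => e he.
  rewrite fiber_edge; have [y0 ->] := contr_sing hc he.
  by rewrite cards1 inE (inj_eq set1_inj) eq_sym.
rewrite [RHS]big_mkcond /=; apply: eq_bigr => f _.
by rewrite fiber_edge -(c_ends hc).
Qed.

Lemma contr_stable g (w : 'I_n -> rat) (G H : mgraph n) (pi : vert G -> vert H) ep :
  is_contr pi ep -> stable g w G -> stable g w H.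
Proof.
move=> hc [h1 h2 h3]; split.
- exact: contr_connected hc h1.
- by rewrite (contr_genus hc).
move=> y.
have : 0 < \sum_(x | pi x == y) (2 * (hgen x)%:R - 2 + (valence x)%:R
     + weight w [set i | mark G i == x]).
  have [x0 hx0] := c_surj hc y; rewrite (bigD1 x0) //= ltr_pwDl //.
  by apply: sumr_ge0 => x _; apply: ltW.
rewrite !big_split /= -mulr_sumr -!natr_sum (contr_valence _ hc).
have -> : \sum_(x | pi x == y) weight w [set i | mark G i == x]
       = weight w [set i | mark H i == y].
  rewrite /weight (partition_big (mark G) (fun x => pi x == y)) /=; last first.
    by move=> i; rewrite inE (c_mark hc).
  apply: eq_bigr => x hx; apply: eq_bigl => i; rewrite !inE (c_mark hc).
  by case: eqP => [->|]; rewrite ?hx ?andbF.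
have -> : \sum_(x | pi x == y) (- 2 : rat) = - 2 * (\sum_(x | pi x == y) 1)%N%:R.
  by rewrite natr_sum mulr_sumr; under [RHS]eq_bigr do rewrite mulr1.
have := c_h hc y.
move: (\sum_(e | _) 1)%N (\sum_(x | _) 1)%N (\sum_(x | _) hgen x)%N => S F A.
move/(congr1 (fun k : nat => k%:R : rat)); rewrite !natrD natrM.
move: (weight _ _) (valence y)%:R => W v; lra.
Qed.

Lemma mem_block (G : mgraph n) (e : edge G) u v :
  (v \in block e u) = (block e v == block e u).
Proof.
rewrite /block; case: (boolP (u \in ends e)) => hu; case: (boolP (v \in ends e)) => hv.
- by rewrite eqxx.
- by apply/esym/eqP => E; rewrite -E inE eqxx in hv.
- rewrite inE; apply/eqP/eqP => [E|E]; first by rewrite -E hv in hu.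
  by rewrite E inE eqxx in hu.
- by rewrite inE (inj_eq set1_inj).
Qed.

Lemma contract_contr (G : mgraph n) (e : edge G) :
  @is_contr G (contract e) (@cproj n G e) val.
Proof.
have cod f : (f \in codom (val : cedge e -> edge G)) = (f != e).
  apply/codomP/idP => [[f' ->]|hf]; first exact: (valP f').
  by exists (exist _ f hf).
have blk v : v \in block e v by rewrite mem_block.
have fib x (B : cvert e) : (cproj e x == B) = (x \in val B).
  have /imsetP[v _ ev] := valP B.
  by rewrite -val_eqE /= ev mem_block.
have blkE : block e =1 fun v => if v \in ends e then ends e else [set v] by [].
split=> //.
- exact: val_inj.
- move=> B; have /imsetP[v _ ev] := valP B; exists v.
  by rewrite -val_eqE /= ev.
- move=> u v; split.
    move/(congr1 val) => /= E; have := blk v; rewrite -E /block.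
    case: ifP => hu hv; last by move: hv; rewrite inE => /eqP ->.
    by apply/connect1/existsP; exists e; rewrite cod eqxx hu hv.
  case/connectP => q; elim: q u => [|a q IH] u /=; first by move=> _ ->.
  case/andP => /existsP[f /and3P[]]; rewrite cod negbK => /eqP -> hu ha hp hl.
  by rewrite -(IH _ hp hl); apply: val_inj; rewrite /= /block hu ha.
- move=> B; rewrite /= /chgen.
  rewrite !(eq_bigl _ _ (fun x => fib x B)) sum1_card.
  rewrite -addnA -[RHS]addnA; congr (_ + _)%N.
  rewrite (eq_bigl (fun f => (f == e) && (val B == ends e))); last first.
    move=> f; rewrite cod negbK; case: eqP => //= ->.
    have [v hv] := ends_ex e.
    have -> : cproj e @: ends e = [set cproj e v].
      apply/setP => C; rewrite inE; apply/imsetP/eqP => [[u hu ->]|->]; last by exists v.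
      by apply: val_inj; rewrite /= /block hu hv.
    by rewrite (inj_eq set1_inj) -val_eqE /= /block hv eq_sym.
  rewrite big_mkcondr /= big_pred1_eq /is_loop.
  case: (eqVneq (val B) (ends e)) => [->|/eqP hB].
    have := ends_card e; rewrite andbT.
    by case: #|_| => [|[|[|]]].
  rewrite andbF; have /imsetP[v _] := valP B; rewrite /block.
  by case: ifP => // _ ->; rewrite cards1.
Qed.

End ContractionMorphism.

Section Pull.
Variable n : nat.

Lemma contract_labels_contr (L : eqType) (s : seq L) (x : lgraph n L) :
  injective (@lab n L x) ->
  exists (pi : vert x -> vert (contract_labels s x))
         (ep : edge (contract_labels s x) -> edge x),
    [/\ is_contr pi ep, forall f, lab (ep f) = lab f
      & forall e, (e \in codom ep) = (lab e \notin s)].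
Proof.
move=> hx; elim: s => [|l s [pi [ep [h1 h2 h3]]]] /=.
  exists id, id; split=> //; first exact: contr_id.
  by move=> e; apply/codomP; exists e.
move: pi ep h1 h2 h3; set y := contract_labels s x => pi ep h1 h2 h3.
have hy : injective (@lab n L y).
  by move=> e f; rewrite -!h2 => /hx; apply: (c_inj h1).
rewrite /contract_label; case: pickP => [e /eqP he|hN].
  exists (@cproj n y e \o pi), (ep \o val); split.
  - exact: contr_trans h1 (contract_contr e).
  - by move=> f /=; rewrite h2.
  move=> e'; rewrite inE negb_or -h3.
  apply/codomP/andP => [[f ->] /=|[hl /codomP[f ef]]].
    rewrite codom_f; split=> //; rewrite h2 -he.
    by apply/eqP => /hy hf; have /eqP[] := valP f.
  subst e'; have hf : f != e by apply: contra hl => /eqP ->; rewrite h2 he.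
  by exists (exist _ f hf).
exists pi, ep; split=> // e; rewrite inE negb_or h3.
case: (boolP (lab e \in s)) => hs; rewrite ?andbF ?andbT //=.
have /codomP[f ->] : e \in codom ep by rewrite h3.
by rewrite h2 hN.
Qed.

Definition pulls p q (i : Ihom p q) (x : lgraph n 'I_q.+1) (y : lgraph n 'I_p.+1) :=
  exists (pi : vert x -> vert y) (ep : edge y -> edge x),
    is_contr pi ep /\ forall e, lab (ep e) = i (lab e).

Lemma IinvK p q (i : Ihom p q) : cancel i (Iinv i).
Proof.
move=> k; rewrite /Iinv; case: pickP => [k' /eqP /(@Ifun_inj _ _ i)|/(_ k)] //.
by rewrite eqxx.
Qed.

Lemma pull_lgraph_pulls p q (i : Ihom p q) (x : lgraph n 'I_q.+1) :
  bijective (@lab n _ x) ->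
  pulls i x (pull_lgraph i x) /\ bijective (@lab n _ (pull_lgraph i x)).
Proof.
move=> [xl K1 K2]; rewrite /pull_lgraph; set s := filter _ _.
have [pi [ep [h1 h2 h3]]] := contract_labels_contr s (can_inj K1).
have sE l : (l \notin s) = (l \in codom i).
  by rewrite mem_filter mem_enum andbT negbK.
have hl f : i (Iinv i (@lab n _ (contract_labels s x) f)) = lab f.
  have := codom_f ep f; rewrite h3 sE h2 => /codomP[k ->].
  by rewrite IinvK.
split; first by exists pi, ep; split=> // e; rewrite h2 /= hl.
have inj : injective (@lab n _ (relabel (Iinv i) (contract_labels s x))).
  move=> e f /= E; apply: (c_inj h1); apply: (can_inj K1).
  by rewrite !h2 -[LHS]hl E hl.
have sur k : k \in codom (@lab n _ (relabel (Iinv i) (contract_labels s x))).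
  have : xl (i k) \in codom ep by rewrite h3 sE K2 codom_f.
  case/codomP => f ef; apply/codomP; exists f => /=.
  by rewrite -h2 -ef K2 IinvK.
exists (fun k => iinv (sur k)) => [e|k]; last exact: f_iinv.
by apply: inj; rewrite f_iinv.
Qed.

Lemma pulls_codom p q (i : Ihom p q) (x : lgraph n _) (y : lgraph n _) (pi : vert x -> vert y) ep :
  bijective (@lab n _ x) -> bijective (@lab n _ y) ->
  is_contr pi ep -> (forall e, lab (ep e) = i (lab e)) ->
  forall e, (e \in codom ep) = (lab e \in codom i).
Proof.
move=> bx [yl K1 K2] hc hl e; apply/codomP/codomP => [[f ->]|[k ek]].
  by exists (lab f); rewrite hl.
by exists (yl k); apply: (bij_inj bx); rewrite hl K2.
Qed.

Lemma pulls_unique p q (i : Ihom p q) x y z :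
  bijective (@lab n _ x) -> bijective (@lab n _ y) -> bijective (@lab n _ z) ->
  pulls i x y -> pulls i x z -> liso y z.
Proof.
move=> bx bY bz [pi [ep [h1 h2]]] [pi' [ep' [h3 h4]]].
have [|fV [fE [h5 h6]]] := contr_unique h1 h3.
  by move=> e; rewrite (pulls_codom bx bY h1 h2) (pulls_codom bx bz h3 h4).
exists fV, fE; split=> // e; apply: (@Ifun_inj _ _ i).
by rewrite -h4 h6 h2.
Qed.

Lemma pulls_trans p q r (i : Ihom q r) (j : Ihom p q) x y z :
  pulls i x y -> pulls j y z -> pulls (Icomp i j) x z.
Proof.
move=> [pi [ep [h1 h2]]] [pi' [ep' [h3 h4]]].
exists (pi' \o pi), (ep \o ep'); split; first exact: contr_trans h1 h3.
by move=> e /=; rewrite h2 h4.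
Qed.

Lemma pulls_refl p x : pulls (Iid p) x x.
Proof. by exists id, id; split=> //; apply: contr_id. Qed.

Lemma liso_pulls p (x y : lgraph n 'I_p.+1) : liso x y -> pulls (Iid p) x y.
Proof.
move=> [fV [fE [h1 h2]]]; have [_ [fE' K1 K2] _ _ _] := h1.
exists fV, fE'; split; first exact: iso_contr h1 K1 K2.
by move=> e; rewrite -h2 K2.
Qed.

Lemma liso_refl L (x : lgraph n L) : liso x x.
Proof.
by exists id, id; split=> //; split=> //; try (by exists id); move=> e; rewrite imset_id.
Qed.

Lemma liso_sym L (x y : lgraph n L) : liso x y -> liso y x.
Proof.
move=> [fV [fE [[[gV K1 K2] [gE K3 K4] h1 h2 h3] h4]]].
exists gV, gE; split; last by move=> e; rewrite -h4 K4.
split; [by exists fV|by exists fE| | |].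
- move=> e; rewrite -{2}(K4 e) h1 -imset_comp.
  by rewrite (eq_imset (g := id)) ?imset_id // => v /=; rewrite K1.
- by move=> v; rewrite -h2 K2.
- by move=> i; rewrite h3 K1.
Qed.

Lemma liso_trans L (x y z : lgraph n L) : liso x y -> liso y z -> liso x z.
Proof.
move=> [fV [fE [[b1 b2 h1 h2 h3] h4]]] [gV [gE [[b3 b4 k1 k2 k3] k4]]].
exists (gV \o fV), (gE \o fE); split; last by move=> e; rewrite /= k4 h4.
split; [exact: bij_comp|exact: bij_comp| | |].
- by move=> e; rewrite /= k1 h1 -imset_comp.
- by move=> v; rewrite /= k2 h2.
- by move=> i; rewrite k3 h3.
Qed.

Lemma liso_perm L (s : 'S_n) (x y : lgraph n L) : liso x y ->
  liso (@LGraph n L (perm_graph s x) (@lab n L x))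
       (@LGraph n L (perm_graph s y) (@lab n L y)).
Proof.
move=> [fV [fE [[b1 b2 h1 h2 h3] h4]]]; exists fV, fE; split=> //.
by split=> // i; apply: h3.
Qed.

End Pull.

Section EGraph.
Variables (g n : nat) (w : 'I_n -> rat).

Lemma pull_lgraph_stable p q (i : Ihom p q) (x : egraph g w q) :
  stable g w (pull_lgraph i x).
Proof.
have [[pi [ep [hc _]]] _] := pull_lgraph_pulls i (egr_bij x).
exact: contr_stable hc (egr_stable x).
Qed.

Definition pull_egraph p q (i : Ihom p q) (x : egraph g w q) : egraph g w p :=
  EGraph (pull_lgraph_stable i x) (pull_lgraph_pulls i (egr_bij x)).2.

Lemma pull_egraph_pulls p q (i : Ihom p q) (x : egraph g w q) :
  pulls i x (pull_egraph i x).
Proof. exact: (pull_lgraph_pulls i (egr_bij x)).1. Qed.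

Lemma valence_gt0 p (x : egraph g w p) (v : vert x) : (0 < valence v)%N.
Proof.
have [e hv] : exists e : edge x, v \in ends e.
  have [l _ K] := egr_bij x; have [u hu] := ends_ex (l ord0).
  case/andP: (stable_connected (egr_stable x)) => _ /forallP/(_ v)/forallP/(_ u).
  case/connectP => -[_ /= uv|a q /= /andP[/existsP[e /andP[hv _]] _] _]; last by exists e.
  by exists (l ord0); rewrite -uv.
by rewrite /valence (bigD1 e) //=; case: (is_loop e).
Qed.

Lemma perm_graph_stable (hw : forall i, 0 < w i <= 1) (s : 'S_n) p (x : egraph g w p) :
  s \in Aut_Kw w -> stable g w (perm_graph s x).
Proof.
move=> hs; have [h1 h2 h3] := egr_stable x; split=> // v.
have hv : (0 < @valence n (perm_graph s x) v)%N by apply: (valence_gt0 (x := x)).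
have := h3 v; rewrite -[@valence n x v]/(@valence n (perm_graph s x) v).
rewrite -[@hgen n x v]/(@hgen n (perm_graph s x) v).
move: (@hgen n (perm_graph s x) v) (@valence n (perm_graph s x) v) hv => h k hk.
set S := [set i | _]; set T := [set i | _].
have TE : T = s @: S.
  apply/setP => i; rewrite inE; apply/eqP/imsetP => [E|[j]].
    by exists ((s^-1)%g i); rewrite ?permKV // inE -E.
  by rewrite inE => /eqP E ->; rewrite /= permK.
have w0 (U : {set 'I_n}) : 0 <= weight w U.
  by apply: sumr_ge0 => i _; case/andP: (hw i) => /ltW.
have wpos (U : {set 'I_n}) : (0 < weight w U) = (U != set0).
  apply/idP/idP => [|/set0Pn[i hi]].
    by apply: contraL => /eqP ->; rewrite /weight big_set0 ltxx.
  rewrite /weight (bigD1 i) //= ltr_pwDl //; first by case/andP: (hw i).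
  by apply: sumr_ge0 => j _; case/andP: (hw j) => /ltW.
have hST : (weight w S <= 1) = (weight w T <= 1).
  by move: hs; rewrite inE => /forallP/(_ S)/eqP; rewrite !inE TE.
have h0 : (0 < weight w S) = (0 < weight w T) by rewrite !wpos TE imset_eq0.
move: (w0 S) (w0 T) h0 hST; move: (weight w S) (weight w T) => a b a0 b0 h0 hST hh.
have -> : 2 * h%:R - 2 + k%:R + b = (2 * h + k)%N%:R - 2 + b by rewrite natrD natrM; ring.
have : 0 < (2 * h + k)%N%:R - 2 + a by rewrite natrD natrM; move: hh; lra.
have : (0 < 2 * h + k)%N by lia.
case: (2 * h + k)%N => [//|[|[|m]]] _.
- have -> : (0 < 1%:R - 2 + a) = ~~ (a <= 1) by rewrite -ltNge; apply/idP/idP; lra.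
  by rewrite hST -ltNge; lra.
- have -> : (0 < 2%:R - 2 + a) = (0 < a) by apply/idP/idP; lra.
  by rewrite h0; lra.
move=> _; have : (3%:R : rat) <= m.+3%:R by rewrite ler_nat.
lra.
Qed.

Definition perm_egraph (hw : forall i, 0 < w i <= 1) (s : [subg Aut_Kw w]) p
    (x : egraph g w p) : egraph g w p :=
  @EGraph g n w p (@LGraph n _ (perm_graph (sgval s) x) (@lab n _ x))
    (perm_graph_stable hw x (subgP s)) (egr_bij x).

End EGraph.

(* The classes [G, tau] of edge-labelled w-stable graphs with p + 1 edges; a   *)
(* class is the set of all its members.                                        *)
Record cell (g n : nat) (w : 'I_n -> rat) (p : nat) := Cell {
  cell_mem :> egraph g w p -> Prop;
  cellP : exists x : egraph g w p, cell_mem = fun y => liso x y }.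

Section Cells.
Variables (g n : nat) (w : 'I_n -> rat).

Definition iso_class p (x : egraph g w p) : cell g w p :=
  @Cell g n w p (fun y => liso x y) (ex_intro _ x erefl).

Lemma cell_inj p (c d : cell g w p) : (forall y, c y <-> d y) -> c = d.
Proof.
case: c d => [c hc] [d hd] /= cd.
have E : c = d by apply: funext => y; apply: propext.
by subst d; rewrite (Prop_irrelevance hc hd).
Qed.

Lemma class_eq p (x y : egraph g w p) : iso_class x = iso_class y <-> liso x y.
Proof.
split=> [E|xy].
  by have : iso_class y y := liso_refl y; rewrite -E.
apply: cell_inj => z; split=> /= h; last exact: liso_trans xy h.
exact: liso_trans (liso_sym xy) h.
Qed.

Lemma class_surj p (c : cell g w p) : exists x, c = iso_class x.
Proof. by case: (cellP c) => x hx; exists x; apply: cell_inj => y; rewrite hx. Qed.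

Lemma pull_egraph_liso p q (i : Ihom p q) (x x' : egraph g w q) :
  liso x x' -> liso (pull_egraph i x) (pull_egraph i x').
Proof.
move=> xx'.
have h := pulls_trans (liso_pulls xx') (pull_egraph_pulls i x').
apply: (pulls_unique (i := i)) (pull_egraph_pulls i x) _; try exact: egr_bij.
by have -> : i = Icomp (Iid q) i by case: (i) => f hf; rewrite /Icomp /=; congr IHom; apply: Prop_irrelevance.
Qed.

Lemma pull_cell_subproof p q (i : Ihom p q) (c : cell g w q) :
  exists y : egraph g w p,
    (fun z : egraph g w p => exists2 x, c x & liso (pull_egraph i x) z)
    = fun z => liso y z.
Proof.
have [x ->] := class_surj c; exists (pull_egraph i x).
apply: funext => z; apply: propext; split=> [[x' hx' h]|h].
  exact: liso_trans (pull_egraph_liso i hx') h.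
by exists x => //; apply: liso_refl.
Qed.

(* i^* [G, tau] is the class of pull_egraph i (G, tau).                        *)
Definition pull_cell p q (i : Ihom p q) (c : cell g w q) : cell g w p :=
  Cell (pull_cell_subproof i c).

Lemma pull_class p q (i : Ihom p q) (x : egraph g w q) :
  pull_cell i (iso_class x) = iso_class (pull_egraph i x).
Proof.
apply: cell_inj => z; split=> [[x' hx' h]|h].
  exact: liso_trans (pull_egraph_liso i hx') h.
by exists x => //; apply: liso_refl.
Qed.

Lemma pull_cell_id p (c : cell g w p) : pull_cell (Iid p) c = c.
Proof.
have [x ->] := class_surj c; rewrite pull_class; apply/class_eq.
apply: pulls_unique (pull_egraph_pulls (Iid p) x) (pulls_refl x); exact: egr_bij.
Qed.

Lemma pull_cell_comp p q r (i : Ihom q r) (j : Ihom p q) (c : cell g w r) :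
  pull_cell (Icomp i j) c = pull_cell j (pull_cell i c).
Proof.
have [x ->] := class_surj c; rewrite !pull_class; apply/class_eq.
apply: pulls_unique (pull_egraph_pulls (Icomp i j) x)
  (pulls_trans (pull_egraph_pulls i x) (pull_egraph_pulls j _)); exact: egr_bij.
Qed.

End Cells.

(* Symmetric Delta-complexes: functors from I^op to sets.                      *)
Record symDelta := SymDelta {
  cells : nat -> Type;
  pull : forall p q, Ihom p q -> cells q -> cells p;
  pull_id : forall p (c : cells p), pull (Iid p) c = c;
  pull_comp : forall p q r (i : Ihom q r) (j : Ihom p q) (c : cells r),
    pull (Icomp i j) c = pull j (pull i c) }.

Record sdhom (X Y : symDelta) := SdHom {
  sdmap :> forall p, cells X p -> cells Y p;
  sdmap_nat : forall p q (i : Ihom p q) (c : cells X q),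
    sdmap (pull i c) = pull i (sdmap c) }.

Arguments sdmap {X Y} _ {p} c.

Definition sdid (X : symDelta) : sdhom X X :=
  @SdHom X X (fun p c => c) (fun p q i c => erefl).

Lemma sdcomp_nat (X Y Z : symDelta) (f : sdhom Y Z) (h : sdhom X Y) p q
    (i : Ihom p q) (c : cells X q) : f _ (h _ (pull i c)) = pull i (f _ (h _ c)).
Proof. by rewrite !sdmap_nat. Qed.

Definition sdcomp (X Y Z : symDelta) (f : sdhom Y Z) (h : sdhom X Y) : sdhom X Z :=
  SdHom (sdcomp_nat f h).

Definition sdinvertible (X : symDelta) (f : sdhom X X) : Prop :=
  exists h : sdhom X X, sdcomp f h = sdid X /\ sdcomp h f = sdid X.

Record sdaut (X : symDelta) := SdAut {
  aut_hom :> sdhom X X;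
  aut_inv : sdinvertible aut_hom }.

Definition Delta (g n : nat) (w : 'I_n -> rat) : symDelta :=
  SymDelta (@pull_cell_id g n w) (@pull_cell_comp g n w).

Section AutGroup.
Variable X : symDelta.

Lemma sdhom_eq (Y : symDelta) (f h : sdhom X Y) :
  (forall p (c : cells X p), f p c = h p c) -> f = h.
Proof.
case: f h => [f hf] [h hh] /= fh.
have E : f = h.
  by apply: functional_extensionality_dep => p; apply: funext => c; apply: fh.
by subst h; rewrite (Prop_irrelevance hf hh).
Qed.

Lemma aut_eq (f h : sdaut X) : (forall p (c : cells X p), f p c = h p c) -> f = h.
Proof.
case: f h => [f hf] [h hh] /= fh; have E : f = h by apply: sdhom_eq.
by subst h; rewrite (Prop_irrelevance hf hh).
Qed.

Lemma aut_id_inv : sdinvertible (sdid X).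
Proof. by exists (sdid X); split; apply: sdhom_eq. Qed.

Lemma aut_comp_inv (f h : sdaut X) : sdinvertible (sdcomp f h).
Proof.
case: f h => [f [f' [ff' f'f]]] [h [h' [hh' h'h]]] /=.
have E (a b : sdhom X X) : sdcomp a b = sdid X -> forall p (c : cells X p), a p (b p c) = c.
  by move=> ab p c; rewrite -[LHS]/(sdcomp a b p c) ab.
exists (sdcomp h' f'); split; apply: sdhom_eq => p c /=.
  by rewrite (E _ _ hh') (E _ _ ff').
by rewrite (E _ _ f'f) (E _ _ h'h).
Qed.

Definition aut_id : sdaut X := SdAut aut_id_inv.
Definition aut_comp (f h : sdaut X) : sdaut X := SdAut (aut_comp_inv f h).

Lemma aut_compA f h k : aut_comp f (aut_comp h k) = aut_comp (aut_comp f h) k.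
Proof. by apply: aut_eq. Qed.

Lemma aut_comp1l f : aut_comp aut_id f = f.
Proof. by apply: aut_eq. Qed.

Lemma aut_comp1r f : aut_comp f aut_id = f.
Proof. by apply: aut_eq. Qed.

Lemma aut_compV (f : sdaut X) : exists h, aut_comp f h = aut_id /\ aut_comp h f = aut_id.
Proof.
have [h [fh hf]] := aut_inv f; have hinv : sdinvertible h by exists f.
exists (SdAut hinv); split; apply: aut_eq => p c /=.
  by rewrite -[LHS]/(sdcomp f h p c) fh.
by rewrite -[LHS]/(sdcomp h f p c) hf.
Qed.

End AutGroup.

(* Main.v *)
Require Import Defs.
From mathcomp Require Import all_boot all_order all_fingroup all_algebra.
From mathcomp Require Import boolp zify lra.
Import Order.TTheory GRing.Theory Num.Theory.
Local Open Scope ring_scope.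
Set Implicit Arguments.
Unset Strict Implicit.
Unset Printing Implicit Defensive.

(* An automorphism F sends a graph G to a graph G' with the same edges,          *)
(* compatibly with contractions, and it suffices to know F on pure graphs (all   *)
(* vertex genera 0), since every graph is a contraction of a pure one.           *)
(*   The dipole with g + 1 edges is symmetric under all permutations of its      *)
(* edges, which forces its image to be a dipole. Hence F fixes the rose with g   *)
(* loops; G is pure exactly when it contracts to the rose, so F preserves purity *)
(* and, applying this to contractions, loops and parallel edges.                 *)
(*   On the digons with a single marking on a loopless vertex F acts by a        *)
(* permutation s of the markings. Uncontracting a two-vertex graph in various    *)
(* ways shows that F acts on it by s as well. A pendant vertex with marking set  *)
(* S is stable iff w(S) > 1, so s lies in Aut K_w.                               *)
(*   For at least three vertices one argues by induction: G is determined by its *)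
(* contractions G/e once it is known which vertex of G/e is the merged one,      *)
(* because this tells which edges and markings touch e, and this relation,       *)
(* together with the triangles, recovers the stars of the vertices.              *)

(** * Contraction of one edge *)

(** An automorphism F is studied through [rel_of F], which relates G to G' by an edge bijection b
    when F carries G to G' with the labels transported along b. Naturality makes it a [bicorr]:
    contractions of G correspond to contractions of G'. An isomorphism is a contraction of no edge
    and is carried over as well ([r_iso]), so symmetries of G reappear in G'.

    Loops and parallel edges can be read off from contractions. Contracting a non-loop keeps a graph
    pure and contracting a loop does not ([contr1_pure]); contracting e makes loops of the former
    loops and of the edges parallel to e, and of no others ([contr1_loop_iff]). Purity itself is
    preserved because it is so for the rose ([r_rose_ex], [r_pure]).

    The permutation s of the markings comes from [mark_perm2] when g is at least 2, where loops
    serve as anchors, and from [mark_perm1] when g = 1, where a loopless graph on two vertices is a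
    partition of the markings into two classes. The recurring device is a graph X, built by
    [expand], that contracts both to the graph under study and to a graph H whose image is
    understood; its image X' contracts to both images, and comparing them restricts what G' can be.
    This leads to [two_vertex_siso].

    From three vertices on, [rebuild] recovers G' from its contractions, and induction gives
    [pure_siso]; [stable_siso] trades vertex genus for loops. Finally [heavy_image] puts s into Aut
    K_w, so that F is the action of s ([act_surj]), while a digon with the single marking i on its
    bare vertex shows that s can be recovered from its action ([act_inj]). *)

Section Graphs.
Variable n : nat.
Implicit Types G H : mgraph n.

(** Edges and markings are handled together: a contraction carries both along as sets of vertices
    ([contr1_spot]), and the reconstruction of a graph compares incidences of edges with either
    kind. *)
Definition item G : Type := (edge G + 'I_n)%type.

Definition spot G (o : item G) : {set vert G} :=
  match o with inl e => ends e | inr i => [set mark G i] end.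

Lemma nonloopE G (e : edge G) : ~~ is_loop e = (#|ends e| == 2)%N.
Proof. by rewrite /is_loop; have := ends_card e; case: #|_| => [|[|[|]]]. Qed.

Lemma nonloopP G (e : edge G) :
  reflect (exists a b, a != b /\ ends e = [set a; b]) (~~ is_loop e).
Proof.
rewrite nonloopE; apply: (iffP idP) => [/cards2P|] [a [b [ab ->]]].
  by exists a, b.
by rewrite cards2 ab.
Qed.

Lemma loopP G (e : edge G) : reflect (exists a, ends e = [set a]) (is_loop e).
Proof. exact: cards1P. Qed.

Lemma nonloop_at G (e : edge G) v : ~~ is_loop e -> v \in ends e ->
  exists2 b, b != v & ends e = [set v; b].
Proof.
case/nonloopP=> a [b [ab ->]]; rewrite !inE => /orP[] /eqP ->.
  by exists b; rewrite // eq_sym.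
by exists a; rewrite // setUC.
Qed.

Lemma nonloop_two G (e : edge G) x y : ~~ is_loop e -> x \in ends e -> y \in ends e ->
  x != y -> ends e = [set x; y].
Proof.
move=> he hx hy xy; have [b bx E] := nonloop_at he hx.
move: hy; rewrite E !inE eq_sym (negPf xy) /= => /eqP ->; exact.
Qed.

Lemma loop_at G (e : edge G) v : is_loop e -> v \in ends e -> ends e = [set v].
Proof. by case/loopP=> a ->; rewrite inE => /eqP ->. Qed.

Definition pure G := forall v : vert G, hgen v = 0%N.

Lemma cut_edge G (A : {set vert G}) : connected G -> A != set0 -> A != setT ->
  exists e x y, [/\ x \in A, y \notin A & ends e = [set x; y]].
Proof.
case/andP=> _ /forallP hc /set0Pn[x xA] AT.
have [y yA] : exists y, y \notin A.
  by apply/existsP; rewrite -negb_forall; apply: contra AT => /forallP h;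
    apply/eqP/setP => z; rewrite inE h.
have /connectP[q hq yq] := forallP (hc x) y.
elim: q x xA hq yq => [|z q IH] x xA /=; first by move=> _ yx; rewrite yx xA in yA.
case/andP=> /existsP[e /andP[xe ze]] hq yq.
case: (boolP (z \in A)) => zA; first exact: IH zA hq yq.
exists e, x, z; split=> //.
have xz : x != z by apply: contraNneq zA => <-.
by apply: nonloop_two => //; apply/negP => /loopP[a ea]; move: xe ze;
  rewrite ea !inE => /eqP ex /eqP ez; rewrite ex ez eqxx in xz.
Qed.

(** A contraction of e up to isomorphism. The concrete [contract e] would not do on the image side,
    where naturality provides just some pair of maps. *)
Definition contr1 G H (e : edge G) (pi : vert G -> vert H) (ep : edge H -> edge G) :=
  is_contr pi ep /\ forall f, (f \in codom ep) = (f != e).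

Section Contr1.
Variables (G H : mgraph n) (e : edge G) (pi : vert G -> vert H) (ep : edge H -> edge G).
Hypothesis hc : contr1 e pi ep.

Lemma contr1_eq u v : pi u = pi v <-> u = v \/ (u \in ends e /\ v \in ends e).
Proof.
case: hc => h1 h2; rewrite (c_conn h1); split=> [/connectP[q]|].
  elim: q u => [|a q IH] u /=; first by move=> _ ->; left.
  case/andP=> /existsP[f /and3P[]]; rewrite h2 negbK => /eqP -> ue ae hq hv.
  by case: (IH _ hq hv) => [<-|[_ ve]]; right.
case=> [->|[ue ve]]; first exact: connect0.
by apply/connect1/existsP; exists e; rewrite h2 eqxx ue ve.
Qed.

Lemma contr1_ends f : ends f = pi @: ends (ep f).
Proof. exact: c_ends hc.1 f. Qed.

Lemma contr1_mark i : mark H i = pi (mark G i).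
Proof. exact: c_mark hc.1 i. Qed.

Lemma contr1_inj : injective ep.
Proof. exact: c_inj hc.1. Qed.

Lemma contr1_surj y : exists x, pi x = y.
Proof. by have [x /eqP] := c_surj hc.1 y; exists x. Qed.

Lemma contr1_neq f : ep f != e.
Proof. by rewrite -hc.2 codom_f. Qed.

Lemma contr1_lift f : f != e -> exists f', f = ep f'.
Proof. by rewrite -hc.2 => /codomP. Qed.

Definition iep (o : item H) : item G :=
  match o with inl f => inl (ep f) | inr i => inr i end.

Lemma contr1_spot o : spot o = pi @: spot (iep o).
Proof. by case: o => [f|i] /=; rewrite ?imset_set1 ?contr1_ends ?contr1_mark. Qed.

Lemma contr1_loop f : is_loop (ep f) -> is_loop f.
Proof. by move=> /loopP[a ea]; apply/loopP; exists (pi a); rewrite contr1_ends ea imset_set1. Qed.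

(** The ends of f get the same image only if they coincide or are both ends of e. This is how
    parallelism is detected: a non-loop f is parallel to e when contracting e makes a loop of it. *)
Lemma contr1_loop_iff f :
  is_loop f <-> is_loop (ep f) \/ ends (ep f) = ends e.
Proof.
split=> [/loopP[a]|].
  rewrite contr1_ends => E; case: (boolP (is_loop (ep f))) => hf; [by left|right].
  have [x [y [xy exy]]] := nonloopP _ hf.
  have : pi x = pi y.
    by have : pi x \in [set a] /\ pi y \in [set a];
      [rewrite -E exy !imset_f // !inE eqxx ?orbT | rewrite !inE => -[/eqP-> /eqP->]].
  case/contr1_eq=> [E'|[xe ye]]; first by rewrite E' eqxx in xy.
  have he : ~~ is_loop e.
    apply/negP=> /loopP[b eb]; move: xe ye; rewrite eb !inE => /eqP ex /eqP ey.
    by rewrite ex ey eqxx in xy.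
  by rewrite exy (nonloop_two he xe ye xy).
case=> [|E]; first exact: contr1_loop.
have [v hv] := ends_ex e; apply/loopP; exists (pi v); rewrite contr1_ends E.
apply/setP=> y; rewrite inE; apply/imsetP/eqP=> [[u hu ->]|->]; last by exists v.
by apply/contr1_eq; right.
Qed.

(** The balance [c_h] over a fibre decides: a contracted non-loop merges two vertices at no cost in
    genus, while a contracted loop leaves the fibre a single vertex and puts one unit of genus on
    it. *)
Lemma contr1_pure : pure H <-> pure G /\ ~~ is_loop e.
Proof.
have hs y := c_h hc.1 y.
split=> [hH|[hG he] y].
  have fib y : (\sum_(x | pi x == y) 1 >= 1)%N.
    by have [x hx] := contr1_surj y; rewrite (bigD1 x) ?hx //= leq_addr.
  have [v0 hv0] := ends_ex e.
  have imv : pi @: ends e == [set pi v0].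
    rewrite eqEsubset sub1set imset_f // andbT; apply/subsetP=> y /imsetP[u hu ->].
    by rewrite inE; apply/eqP/contr1_eq; right.
  have he : ~~ is_loop e.
    apply/negP=> he; have := hs (pi v0); rewrite hH.
    rewrite [X in (_ + X + 1)%N](bigD1 e) /=; last by rewrite hc.2 eqxx imv.
    rewrite (eq_bigl (pred1 v0)) ?big_pred1_eq; first lia.
    move=> x; apply/eqP/eqP=> [/contr1_eq[//|[xe _]]|-> //].
    by move: xe hv0; case/loopP: he => a ->; rewrite !inE => /eqP -> /eqP ->.
  split=> // v; have := hs (pi v); rewrite hH [X in (_ = X + _ + _)%N](bigD1 v) //=.
  case: (boolP (v \in ends e)) => hv.
    have [b bv eb] := nonloop_at he hv.
    have -> : (\sum_(x | pi x == pi v) 1 = 2)%N.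
      rewrite (eq_bigl (mem (ends e))); first by rewrite sum1_card; apply/eqP; rewrite -nonloopE.
      move=> x /=; apply/eqP/idP => [/contr1_eq[-> //|[] //]|xe].
      by apply/contr1_eq; right.
    rewrite [X in (_ + X + 1)%N](bigD1 e) /=; first lia.
    by rewrite hc.2 eqxx /=; rewrite (eqP imv) (inj_eq set1_inj); apply/eqP/contr1_eq; right.
  rewrite (eq_bigl (pred1 v)) ?big_pred1_eq; first lia.
  by move=> x; apply/eqP/eqP=> [/contr1_eq[//|[_ ]]|-> //]; rewrite (negPf hv).
have := hs y; rewrite [X in (_ = X + _ + _)%N]big1 => [|x _]; last exact: hG.
rewrite (eq_bigl (fun f => (f == e) && (pi @: ends e == [set y]))); last first.
  by move=> f; rewrite hc.2 negbK; case: eqP => //= ->.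
rewrite big_mkcondr /= big_pred1_eq.
have [a [b [ab eab]]] := nonloopP _ he.
have pab : pi b = pi a by apply/contr1_eq; right; rewrite eab !inE !eqxx orbT.
have -> : pi @: ends e = [set pi a] by rewrite eab imsetU1 imset_set1 pab setUid.
rewrite (inj_eq set1_inj); case: eqP => [<-|ya].
  rewrite (eq_bigl (mem (ends e))); last first.
    move=> x /=; apply/eqP/idP => [/contr1_eq[->|[] //]|xe].
      by rewrite eab !inE eqxx.
    by apply/contr1_eq; right; split=> //; rewrite eab !inE eqxx.
  by rewrite sum1_card eab cards2 ab; lia.
have [x xy] := contr1_surj y; rewrite (eq_bigl (pred1 x)) ?big_pred1_eq; first lia.
move=> z /=; apply/eqP/eqP=> [|-> //]; rewrite -xy => /contr1_eq[//|[_]].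
rewrite eab !inE => /orP[]/eqP E; first by case: ya; rewrite -xy E.
by case: ya; rewrite -xy E pab.
Qed.

Lemma contr1_connected : connected H -> connected G.
Proof.
case/andP=> /card_gt0P[y0 _] /forallP hH.
have [x0 _] := contr1_surj y0.
apply/andP; split; first by apply/card_gt0P; exists x0.
apply/forallP=> u; apply/forallP=> v.
have step a b : pi a = pi b -> connect (adj (G := G)) a b.
  case/contr1_eq=> [->|[ae be]]; first exact: connect0.
  by apply/connect1/existsP; exists e; rewrite ae be.
have /connectP[q] := forallP (hH (pi u)) (pi v).
elim: q u => [|z q IH] u /=; first by move=> _ /esym /step.
case/andP=> /existsP[f /andP[]]; rewrite !contr1_ends.
case/imsetP=> a ha ua /imsetP[b hb zb] hq hv.
apply: (@connect_trans _ _ a); first exact: step.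
apply: (@connect_trans _ _ b).
  by apply/connect1/existsP; exists (ep f); rewrite ha hb.
by apply: IH; rewrite -zb.
Qed.

End Contr1.

End Graphs.

(** * Uncontraction and stability *)

Section Split.
Variable n : nat.

(* What becomes of an edge at u when a new vertex None is split off u: a loop   *)
(* that is opened joins u and None, and Open keeps an edge that is not a loop.  *)
Inductive smode := Keep | Move | Open.

Variables (G : mgraph n) (u : vert G) (md : edge G -> smode) (mm : pred 'I_n).

Definition expand_ends (e : option (edge G)) : {set option (vert G)} :=
  if e isn't Some e then [set None; Some u] else
  if u \notin ends e then Some @: ends e else
  match md e with
  | Keep => Some @: ends e
  | Move => None |: Some @: (ends e :\ u)
  | Open => if is_loop e then [set None; Some u] else Some @: ends e
  end.

Lemma expand_ends_card e : (0 < #|expand_ends e| <= 2)%N.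
Proof.
case: e => [e|] /=; last by rewrite cards2.
have hS : (0 < #|(Some : vert G -> option (vert G)) @: ends e| <= 2)%N.
  by rewrite card_imset ?ends_card //; apply: Some_inj.
case: ifP => // /negbFE hu; case: (md e) => //; last by case: ifP => //; rewrite cards2.
rewrite cardsU1 (card_imset _ (@Some_inj _)).
have := ends_card e; rewrite (cardsD1 u) hu add1n => /andP[_ h].
by rewrite (_ : None \notin _) ?add1n //; apply/imsetP=> -[].
Qed.

(** An inverse to contraction: collapsing the edge [None] gives back G ([expand_contr]). Most
    auxiliary graphs below arise in this way. *)
Definition expand : mgraph n :=
  @MGraph n (option (vert G)) (option (edge G)) expand_ends expand_ends_card
    (fun v => if v is Some x then hgen x else 0%N)
    (fun i => if (mark G i == u) && mm i then None else Some (mark G i)).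

Lemma expand_keep e : md e = Keep -> ends (Some e : edge expand) = Some @: ends e.
Proof. by move=> he; rewrite /ends /= he; case: ifP. Qed.

Lemma expand_out e : u \notin ends e -> ends (Some e : edge expand) = Some @: ends e.
Proof. by move=> he; rewrite /ends /= he. Qed.

Lemma expand_open e : md e = Open -> is_loop e -> u \in ends e ->
  ends (Some e : edge expand) = [set None; Some u].
Proof. by move=> he hl hu; rewrite /ends /= hu he hl. Qed.

Lemma expand_move e : md e = Move -> u \in ends e ->
  ends (Some e : edge expand) = None |: Some @: (ends e :\ u).
Proof. by move=> he hu; rewrite /ends /= hu he. Qed.

Lemma expand_move_loop e : md e = Move -> is_loop e -> u \in ends e ->
  ends (Some e : edge expand) = [set None].
Proof.
move=> he hl hu; rewrite expand_move // (loop_at hl hu) setDv imset0 setU0 //.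
Qed.

Definition expand_pi (v : vert expand) : vert G := odflt u v.

Lemma expand_contr : contr1 (G := expand) (H := G) None expand_pi Some.
Proof.
have cod f : (f \in codom (Some : edge G -> option (edge G))) = (f != None).
  by case: f => [f|]; [apply: codom_f|apply/codomP=> -[]].
have odS (A : {set vert G}) : odflt u @: (Some @: A) = A.
  by rewrite -imset_comp (eq_imset (g := id)) ?imset_id.
have eds f : ends f = expand_pi @: expand_ends (Some f).
  rewrite /expand_pi /=; case: ifP => [_|/negbFE hu]; first by rewrite odS.
  case: (md f); rewrite ?odS //.
    by rewrite imsetU1 odS /= setD1K.
  case: ifP => hf; rewrite ?odS // imsetU1 imset_set1 /= setUid.
  exact: loop_at hf hu.
have adjN x y : adjC (Some : edge G -> edge expand) x y =
   (x \in [set None; Some u]) && (y \in [set None; Some u]).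
  apply/existsP/idP => [[[f|]]|h]; last by exists None; rewrite cod.
    by rewrite cod.
  by rewrite cod.
have spE (x y : vert expand) : expand_pi x = expand_pi y <->
    x = y \/ (x \in [set None; Some u]) && (y \in [set None; Some u]).
  rewrite /expand_pi !inE; split; last first.
    by case=> [->//|/andP[]]; case: x => [x|]; case: y => [y|] //=;
      [move=> /eqP[->] /eqP[->]|move=> /eqP[->]|move=> _ /eqP[->]].
  by case: x => [x|]; case: y => [y|] /= E; rewrite ?E; [left|right..|left];
    rewrite ?eqxx ?orbT.
split=> //; split.
- exact: Some_inj.
- by move=> y; exists (Some y).
- exact: eds.
- by move=> i /=; case: ifP => //= /andP[/eqP ->].
- move=> x y; rewrite spE; split.
    by case=> [->|h]; [exact: connect0|apply/connect1; rewrite adjN].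
  case/connectP=> q; elim: q x => [|a q IH] x /=; first by move=> _ ->; left.
  rewrite adjN => /andP[/andP[hx ha] hq hy]; case: (IH _ hq hy) => [<-|/andP[_ ->]].
    by right; rewrite hx ha.
  by right; rewrite hx.
- move=> y; rewrite [X in (_ + X + 1)%N](eq_bigl (fun f => (f == None) && (u == y))); last first.
    move=> f; rewrite cod negbK; case: eqP => //= ->.
    by rewrite /= imsetU1 imset_set1 /expand_pi /= setUid (inj_eq set1_inj).
  rewrite big_mkcondr /= big_pred1_eq.
  have hN F : (\sum_(x : vert expand | expand_pi x == y) F x =
      (if u == y then F None else 0) + F (Some y))%N.
    rewrite big_mkcond /= (bigD1 None) //= (bigD1 (Some y)) //= /expand_pi /= eqxx.
    rewrite big1 ?addn0 // => -[x|] //= /eqP; case: eqP => // ->; by case.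
  by rewrite !hN /=; case: eqP => _; lia.
Qed.

End Split.

(** * Stability of pure graphs *)

Section Stable.
Variables (g n : nat) (w : 'I_n -> rat).
Hypothesis hw : forall i, 0 < w i <= 1.
Implicit Types G H : mgraph n.

Definition ps G := stable g w G /\ pure G.

Definition vstable G (v : vert G) :=
  0 < 2 * (hgen v)%:R - 2 + (valence v)%:R + weight w [set i | mark G i == v].

Lemma weight_ge0 (S : {set 'I_n}) : 0 <= weight w S.
Proof. by apply: sumr_ge0 => i _; case/andP: (hw i) => /ltW. Qed.

Lemma weight_gt0 (S : {set 'I_n}) i : i \in S -> 0 < weight w S.
Proof.
move=> hi; rewrite /weight (bigD1 i) //= ltr_pwDl //; first by case/andP: (hw i).
by apply: sumr_ge0 => j _; case/andP: (hw j) => /ltW.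
Qed.

(** One marking weighs at most 1, so a set of weight above 1 has at least two. *)
Lemma weight_heavy (S : {set 'I_n}) i : 1 < weight w S -> exists2 j, j \in S & j != i.
Proof.
move=> hS; have : S :\ i != set0.
  apply: contraTneq hS => /eqP; rewrite setD_eq0 subset1 => /orP[] /eqP ->.
    by rewrite /weight big_set1 -leNgt; case/andP: (hw i).
  by rewrite /weight big_set0 -leNgt.
by case/set0Pn=> j; rewrite !inE => /andP[ji jS]; exists j.
Qed.

Lemma ps_card G : ps G -> (#|edge G| + 1 = g + #|vert G|)%N.
Proof.
case=> -[_ hg _] hp; move: hg; rewrite /genus /b1 big1 => [|v _]; last by rewrite hp.
lia.
Qed.

Lemma ps_connected G : ps G -> connected G.
Proof. by case=> -[]. Qed.

(** With genus 0, no loops and no markings at v, stability says that v has valence at least 3, so an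
    edge is left besides any two. *)
Lemma val_three G (v : vert G) : stable g w G -> hgen v = 0%N ->
  (forall e, v \in ends e -> ~~ is_loop e) -> (forall i, mark G i != v) ->
  forall e1 e2, exists e3, [/\ v \in ends e3, e3 != e1 & e3 != e2].
Proof.
case=> _ _ /(_ v) hs hp hl hm e1 e2; move: hs; rewrite hp mulr0 add0r.
rewrite /weight big1 ?addr0; last by move=> i; rewrite inE (negPf (hm i)).
rewrite /valence (eq_bigr (fun=> 1%N)); last by move=> e /hl /negPf ->.
rewrite sum1dep_card => h3.
have {h3} : (2 < #|[set x | v \in ends x]|)%N.
  by rewrite -(ltr_nat rat); move: h3; lra.
rewrite (cardsD1 e1) (cardsD1 e2) => h3.
have : (0 < #|[set x | v \in ends x] :\ e1 :\ e2|)%N.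
  by move: h3; case: (_ \in _); case: (_ \in _); lia.
by case/card_gt0P=> e3; rewrite !inE => /and3P[]; exists e3.
Qed.

(** The valence of v is at most 1, which leaves a weight above 1 as the only way to be stable. *)
Lemma leaf_heavy G (v : vert G) e : ps G -> ~~ is_loop e ->
  (forall f, v \in ends f -> f = e) -> 1 < weight w [set i | mark G i == v].
Proof.
case=> -[_ _ /(_ v)] hs hp hl he; move: hs; rewrite hp mulr0 add0r.
have : (valence v <= 1)%N.
  rewrite /valence (leq_trans (n := \sum_(f | f == e) 1)) //; last by rewrite big_pred1_eq.
  rewrite big_mkcond [leqRHS]big_mkcond /= leq_sum // => f _.
  by case: ifP => // /he ->; rewrite eqxx (negPf hl).
rewrite -(ler_nat rat); lra.
Qed.

Lemma leaf_two G (v : vert G) e i : ps G -> ~~ is_loop e ->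
  (forall f, v \in ends f -> f = e) -> exists2 j, mark G j = v & j != i.
Proof.
move=> hG he hv; have [j] := weight_heavy i (leaf_heavy hG he hv).
by rewrite inE => /eqP; exists j.
Qed.

Section VStable.
Variables (G : mgraph n) (v : vert G).
Hypothesis hp : pure G.

Lemma valence_ge (A : {set edge G}) : (forall e, e \in A -> v \in ends e) ->
  (#|A| <= valence v)%N.
Proof.
move=> hA; rewrite -sum1_card /valence big_mkcond [leqRHS]big_mkcond leq_sum // => e _.
by case: ifP => // /hA ->; case: ifP.
Qed.

Lemma vstable_three e1 e2 e3 : v \in ends e1 -> v \in ends e2 -> v \in ends e3 ->
  e1 != e2 -> e1 != e3 -> e2 != e3 -> vstable v.
Proof.
move=> h1 h2 h3 h12 h13 h23; rewrite /vstable hp mulr0 add0r.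
have : (3 <= valence v)%N.
  rewrite -[3%N]/(2.+1) -(_ : #|e1 |: [set e2; e3]| = 3%N).
    by apply: valence_ge => e; rewrite !inE => /or3P[] /eqP ->.
  by rewrite cardsU1 cards2 !inE negb_or h12 h13 h23.
rewrite -(ler_nat rat); have := weight_ge0 [set i | mark G i == v]; lra.
Qed.

Lemma vstable_loop l e : is_loop l -> v \in ends l -> v \in ends e -> l != e -> vstable v.
Proof.
move=> hl h1 h2 h12; rewrite /vstable hp mulr0 add0r.
have : (3 <= valence v)%N.
  rewrite /valence (bigD1 l) //= hl (bigD1 e) /=; last by rewrite h2 eq_sym.
  by case: ifP => _; lia.
rewrite -(ler_nat rat); have := weight_ge0 [set i | mark G i == v]; lra.
Qed.

Lemma vstable_marked e1 e2 i : v \in ends e1 -> v \in ends e2 -> e1 != e2 -> mark G i = v ->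
  vstable v.
Proof.
move=> h1 h2 h12 hi; rewrite /vstable hp mulr0 add0r.
have : (2 <= valence v)%N.
  rewrite -(_ : #|[set e1; e2]| = 2%N); last by rewrite cards2 h12.
  by apply: valence_ge => e; rewrite !inE => /orP[] /eqP ->.
have := @weight_gt0 [set i | mark G i == v] i; rewrite inE hi eqxx => /(_ isT).
rewrite -(ler_nat rat); lra.
Qed.

Lemma vstable_heavy e : v \in ends e -> 1 < weight w [set i | mark G i == v] -> vstable v.
Proof.
move=> h1; rewrite /vstable hp mulr0 add0r.
have : (1 <= valence v)%N.
  by rewrite -(cards1 e); apply: valence_ge => f; rewrite inE => /eqP ->.
rewrite -(ler_nat rat); lra.
Qed.

End VStable.

Section Contr1Stable.
Variables (G H : mgraph n) (e : edge G) (pi : vert G -> vert H) (ep : edge H -> edge G).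
Hypothesis hc : contr1 e pi ep.

Lemma contr1_in x f : x \notin ends e -> (pi x \in ends f) = (x \in ends (ep f)).
Proof.
move=> hx; rewrite (contr1_ends hc); apply/imsetP/idP => [[y hy]|h]; last by exists x.
by case/(contr1_eq hc)=> [->//|[]]; rewrite (negPf hx).
Qed.

Lemma contr1_is_loop x f : x \notin ends e -> x \in ends (ep f) ->
  is_loop f = is_loop (ep f).
Proof.
move=> hx hf; apply/idP/idP => [/(contr1_loop_iff hc)[//|E]|].
  by rewrite E (negPf hx) in hf.
by move=> h; apply: (contr1_loop hc h).
Qed.

Lemma contr1_vstable x : hgen x = hgen (pi x) -> x \notin ends e ->
  vstable (pi x) -> vstable x.
Proof.
move=> hh hx; rewrite /vstable hh.
have -> : valence (pi x) = valence x.
  rewrite /valence [RHS]big_mkcond /= (sum_edges _ hc.1) [X in (X + _)%N]big1 ?add0n.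
    rewrite [LHS]big_mkcond; apply: eq_bigr => f _; rewrite contr1_in //.
    by case: ifP => // hf; rewrite (contr1_is_loop hx hf).
  by move=> f; rewrite hc.2 negbK => /eqP ->; rewrite (negPf hx).
rewrite (_ : [set i | mark H i == pi x] = [set i | mark G i == x]) //.
apply/setP=> i; rewrite !inE (contr1_mark hc); apply/eqP/eqP => [|-> //].
by case/(contr1_eq hc)=> // -[_]; rewrite (negPf hx).
Qed.

Lemma contr1_card : (#|edge H| + 1 = #|edge G|)%N.
Proof.
rewrite -(card_codom (contr1_inj hc)) (eq_card (B := predC1 e)); last exact: hc.2.
by rewrite cardC1 addn1 prednK //; apply/card_gt0P; exists e.
Qed.

(** Away from e a vertex has the valence, genus and markings of its image, so stability of an
    uncontraction only has to be checked at the ends of e. *)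
Lemma contr1_ps : ps H -> (forall v, v \in ends e -> vstable v) -> ps G.
Proof.
move=> [hs hp] hv; have [hpG he] := (contr1_pure hc).1 hp.
split=> //; split.
- exact: contr1_connected hc (stable_connected hs).
- by rewrite -(contr_genus hc.1) (stable_genus hs).
move=> x; case: (boolP (x \in ends e)) => hx; first exact: hv.
by apply: contr1_vstable => //; [rewrite hp hpG|apply: stable_vert hs _].
Qed.

Lemma contr1_ps_down : ps G -> ~~ is_loop e -> ps H.
Proof.
move=> [hs hp] he; split; first exact: contr_stable hc.1 hs.
exact/(contr1_pure hc).
Qed.

End Contr1Stable.

Lemma expand_ps G (u : vert G) md mm : ps G ->
  @vstable (expand u md mm) None -> @vstable (expand u md mm) (Some u) ->
  ps (expand u md mm).
Proof.
move=> hG h1 h2; apply: (contr1_ps (expand_contr _ _ _) hG) => v.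
by rewrite !inE => /orP[] /eqP ->.
Qed.

Lemma expand_pure G (u : vert G) md mm : ps G -> pure (expand u md mm).
Proof. by case=> _ hp; have [] := (contr1_pure (expand_contr u md mm)).1 hp. Qed.

Lemma contract_contr1 G (e : edge G) : @contr1 n G (contract e) e (@cproj n G e) val.
Proof.
split; first exact: contract_contr.
move=> f; apply/codomP/idP => [[f' ->]|hf]; first exact: (valP f').
by exists (exist _ f hf).
Qed.

End Stable.

(** * Correspondences and purity *)

(** In each colour class, elements at equal positions of the two enumerations are matched. *)
Lemma colour_bij (E1 E2 : finType) (K : eqType) (c1 : E1 -> K) (c2 : E2 -> K) :
  (forall k, #|[pred x | c1 x == k]| = #|[pred x | c2 x == k]|) ->
  exists2 f : E1 -> E2, bijective f & forall x, c2 (f x) = c1 x.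
Proof.
move=> hk.
pose A1 k := enum [pred x | c1 x == k]; pose A2 k := enum [pred x | c2 x == k].
have sz k : size (A1 k) = size (A2 k) by have := hk k; rewrite !cardE.
have in1 x : x \in A1 (c1 x) by rewrite mem_enum inE.
have in2 x : x \in A2 (c2 x) by rewrite mem_enum inE.
pose Q x y := c2 y = c1 x /\ index x (A1 (c1 x)) = index y (A2 (c2 y)).
have ex1 x : exists y, Q x y.
  have := in1 x; rewrite -index_mem sz; case E: (A2 (c1 x)) => [//|y0 s] h.
  have hin := mem_nth y0 h; exists (nth y0 (y0 :: s) (index x (A1 (c1 x)))).
  have hy : c2 (nth y0 (y0 :: s) (index x (A1 (c1 x)))) = c1 x.
    by move: hin; rewrite -E mem_enum inE => /eqP.
  by split=> //; rewrite hy E index_uniq // -E enum_uniq.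
have ex2 y : exists x, Q x y.
  have := in2 y; rewrite -index_mem -sz; case E: (A1 (c2 y)) => [//|x0 s] h.
  have hin := mem_nth x0 h; exists (nth x0 (x0 :: s) (index y (A2 (c2 y)))).
  have hx : c1 (nth x0 (x0 :: s) (index y (A2 (c2 y)))) = c2 y.
    by move: hin; rewrite -E mem_enum inE => /eqP.
  by split=> //; rewrite hx E index_uniq // -E enum_uniq.
have [f hf] := choice ex1; have [f' hf'] := choice ex2.
exists f; last by move=> x; case: (hf x).
exists f' => [x|y].
  have [h1 h2] := hf x; have [h3 h4] := hf' (f x).
  have E : c1 (f' (f x)) = c1 x by rewrite -h3 h1.
  by rewrite -(nth_index x (in1 (f' (f x)))) h4 -h2 E nth_index.
have [h1 h2] := hf' y; have [h3 h4] := hf (f' y).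
have E : c2 (f (f' y)) = c2 y by rewrite h3 h1.
by rewrite -(nth_index y (in2 (f (f' y)))) -h4 h2 E nth_index.
Qed.

Lemma card_bij (E1 E2 : finType) : #|E1| = #|E2| -> exists f : E1 -> E2, bijective f.
Proof.
move=> h; have [|f hf _] := @colour_bij E1 E2 unit (fun=> tt) (fun=> tt); last by exists f.
by case; rewrite !(eq_card (B := predT)).
Qed.

Section Corr.
Variables (g n : nat) (w : 'I_n -> rat).
Hypothesis hw : forall i, 0 < w i <= 1.
Implicit Types G H : mgraph n.

Definition edge_rel := forall G G' : mgraph n, (edge G -> edge G') -> Prop.

(** What a morphism of the complex induces on unlabelled graphs; [r_nat] is naturality, phrased with
    contractions up to isomorphism. [r_tot] asks for an edge because every cell has at least one. *)
Record corr (R : edge_rel) : Prop := Corr {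
  r_st1 : forall G G' b, R G G' b -> stable g w G;
  r_st2 : forall G G' b, R G G' b -> stable g w G';
  r_bij : forall G G' b, R G G' b -> bijective b;
  r_tot : forall G, stable g w G -> (0 < #|edge G|)%N -> exists G' b, R G G' b;
  r_nat : forall G G' b H H' c pi ep, R G G' b -> R H H' c ->
    @is_contr n G H pi ep ->
    exists pi' ep', @is_contr n G' H' pi' ep' /\ forall f, ep' (c f) = b (ep f) }.

Definition inv_rel (R : edge_rel) : edge_rel := fun G' G c =>
  exists b, [/\ R G G' b, cancel b c & cancel c b].

Definition bicorr R := corr R /\ corr (inv_rel R).

Lemma inv_relK R : corr R -> inv_rel (inv_rel R) = R.
Proof.
move=> hR; apply: functional_extensionality_dep => G.
apply: functional_extensionality_dep => G'; apply: funext => b; apply: propext.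
split=> [[c [[b' [h K1 K2]] K3 K4]]|h].
  suff -> : b = b' by [].
  by apply: funext => x; apply: (can_inj K2); rewrite K4 K1.
have [c K1 K2] := r_bij hR h; exists c; split=> //; by exists b.
Qed.

Lemma bicorr_inv R : bicorr R -> bicorr (inv_rel R).
Proof. by case=> h1 h2; split=> //; rewrite inv_relK. Qed.

Lemma contr_bij_iso G H pi ep fE : @is_contr n G H pi ep -> cancel fE ep ->
  cancel ep fE -> is_iso pi fE.
Proof.
move=> hc K1 K2.
have cod e : e \in codom ep by rewrite -(K1 e) codom_f.
have inj : injective pi.
  move=> u v /(c_conn hc)/connect_false; apply=> a b.
  by apply/existsP=> -[e]; rewrite cod.
have [pi' K3] : exists pi', cancel pi' pi.
  exists (fun y => xchoose (c_surj hc y)) => y; exact/eqP/(xchooseP (c_surj hc y)).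
split.
- by exists pi' => // x; apply: inj; rewrite K3.
- by exists ep.
- by move=> e; rewrite (c_ends hc) K1.
- move=> v; have := c_h hc (pi v).
  have fib (F : vert G -> nat) : (\sum_(x | pi x == pi v) F x = F v)%N.
    by rewrite (eq_bigl (pred1 v)) ?big_pred1_eq // => x; rewrite (inj_eq inj).
  by rewrite !fib big1 => [|e]; [lia|rewrite cod].
- exact: c_mark hc.
Qed.

Section OneCorr.
Variable R : edge_rel.
Arguments R : clear implicits.
Hypothesis hR : corr R.

(** An isomorphism contracts no edge, so [r_nat] applies to it. In particular a symmetry of G
    induces one of G' with the corresponding effect on the edges. *)
Lemma r_iso G G' b H H' c fV fE : R G G' b -> R H H' c -> @is_iso n G H fV fE ->
  exists fV' fE', @is_iso n G' H' fV' fE' /\ forall e, fE' (b e) = c (fE e).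
Proof.
move=> h1 h2 hi; have [_ [fE1 K1 K2] _ _ _] := hi.
have [pi' [ep' [h3 h4]]] := r_nat hR h1 h2 (iso_contr hi K1 K2).
have [b' Kb1 Kb2] := r_bij hR h1; have [c' Kc1 Kc2] := r_bij hR h2.
exists pi', (c \o fE \o b'); split; last by move=> e /=; rewrite Kb1.
apply: (contr_bij_iso h3) => e /=; first by rewrite h4 K1 Kb2.
by rewrite -{1}(Kc2 e) h4 Kb1 K2 Kc2.
Qed.

Lemma r_contr1 G G' b H H' c e pi ep : R G G' b -> R H H' c ->
  @contr1 n G H e pi ep ->
  exists pi' ep', @contr1 n G' H' (b e) pi' ep' /\ forall f, ep' (c f) = b (ep f).
Proof.
move=> h1 h2 [h3 h4]; have [pi' [ep' [h5 h6]]] := r_nat hR h1 h2 h3.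
exists pi', ep'; split=> //; split=> // f.
have [b' Kb1 Kb2] := r_bij hR h1; have [c' Kc1 Kc2] := r_bij hR h2.
rewrite -(Kb2 f) (inj_eq (can_inj Kb1)) -h4; apply/codomP/codomP=> -[x hx].
  by exists (c' x); apply: (can_inj Kb1); rewrite -h6 Kc2 -hx.
by exists (c x); rewrite h6 -hx.
Qed.

Lemma r_card G G' b : R G G' b -> #|edge G| = #|edge G'|.
Proof. by move/(r_bij hR)/bij_eq_card. Qed.

End OneCorr.

Lemma iso_pure G H fV fE : @is_iso n G H fV fE -> pure G -> pure H.
Proof. by case=> -[fV' K1 K2] _ _ hh _ hp v; rewrite -(K2 v) hh hp. Qed.

Lemma ps_edge G : (0 < g)%N -> ps g w G -> (0 < #|edge G|)%N.
Proof.
move=> hg hG; have := ps_card hG; have : (0 < #|vert G|)%N.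
  by case/andP: (ps_connected hG).
lia.
Qed.

Lemma one_loop G (e : edge G) : #|vert G| = 1%N -> is_loop e.
Proof.
move=> hV; apply/negPn/negP; rewrite nonloopE => /eqP h.
by have := max_card (mem (ends e)); rewrite h hV.
Qed.

Lemma two_nonloop G (v : vert G) : connected G -> (1 < #|vert G|)%N ->
  exists2 e : edge G, ~~ is_loop e & v \in ends e.
Proof.
move=> hc hV; have [||e [x [y [xv yv E]]]] := cut_edge (A := [set v]) hc.
- by apply/set0Pn; exists v; rewrite inE.
- by apply: contraTneq hV => E; rewrite -cardsT -E cards1.
exists e; last by rewrite E; move: xv; rewrite !inE => /eqP ->; rewrite eqxx.
by apply/nonloopP; exists x, y; split=> //; apply: contraNneq yv => <-.
Qed.

(** Both graphs consist of g loops at one vertex, so any bijection of the edges is an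
    isomorphism. *)
Lemma one_iso G H : ps g w G -> ps g w H -> #|vert G| = 1%N -> #|vert H| = 1%N ->
  exists fV fE, @is_iso n G H fV fE.
Proof.
move=> hG hH cG cH.
have [|fE hE] := @card_bij (edge G) (edge H).
  by have := ps_card hG; have := ps_card hH; rewrite cG cH; lia.
have [|fV hV] := @card_bij (vert G) (vert H); first by rewrite cG cH.
have uniq (x y : vert H) : x = y.
  by move/eqP/fintype1P: cH => [z hz]; rewrite (hz x) (hz y).
exists fV, fE; split=> [//|//|e|v|i]; last exact: uniq.
  have /loopP[a ->] := one_loop (fE e) cH.
  by have /loopP[b ->] := one_loop e cG; rewrite imset_set1 (uniq a (fV b)).
by rewrite hG.2 hH.2.
Qed.

Hypotheses (hg : (1 <= g)%N) (hgn : (3 <= 2 * g - 2 + n)%N).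

(** * Roses, dipoles and the preservation of purity *)

Lemma rose_ends_card (e : 'I_g) : (0 < #|[set tt]| <= 2)%N.
Proof. by rewrite cards1. Qed.

Definition rose : mgraph n := MGraph rose_ends_card (fun=> 0%N) (fun=> tt).

Lemma rose_card : #|vert rose| = 1%N.
Proof. exact: card_unit. Qed.

Lemma rose_ps : ps g w rose.
Proof.
split; last by [].
split.
- apply/andP; split; first by rewrite rose_card.
  by apply/forallP=> -[]; apply/forallP=> -[]; apply: connect0.
- by rewrite /genus /b1 rose_card big1 //= card_ord; lia.
case.
have h1 : (2 * g <= @valence n rose tt)%N.
  rewrite /valence (eq_bigr (fun=> 2%N)); last by move=> e _; rewrite /is_loop /= cards1.
  rewrite (eq_bigl predT); last by move=> e; rewrite inE.
  by rewrite sum_nat_const card_ord; lia.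
have h2 : 0 <= weight w [set i | mark rose i == tt] by apply: weight_ge0.
have : (2 <= g)%N \/ g = 1%N /\ (0 < n)%N by move: hgn hg; lia.
case=> [h3|[h3 h4]].
  have : (4 <= @valence n rose tt)%N by move: h1 h3; lia.
  rewrite -(ler_nat rat) /=; move: h2; lra.
have : 0 < weight w [set i | mark rose i == tt].
  by apply: (weight_gt0 hw (i := Ordinal h4)); rewrite inE.
have : (2 <= @valence n rose tt)%N by move: h1; rewrite h3; lia.
rewrite -(ler_nat rat) /=; lra.
Qed.

(** Opening all loops of the rose gives g + 1 parallel edges. For g = 1 each vertex has valence 2
    and needs a marking: the one of index 0 goes to the new vertex and the others stay. *)
Definition dipole : mgraph n :=
  @expand n rose tt (fun=> Open) (fun i => (g == 1%N) && (i == 0%N :> nat)).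

Lemma dipole_ends (e : edge dipole) : ends e = [set None; Some tt].
Proof.
case: e => [e|] //=; rewrite inE /= /is_loop /= cards1 //=.
Qed.

Lemma dipole_ps : ps g w dipole.
Proof.
have hp : pure dipole by apply: expand_pure rose_ps.
have inD (v : vert dipole) e : v \in ends e.
  by rewrite dipole_ends !inE; case: v => [[]|].
suff hv (v : vert dipole) : vstable w v by apply: (expand_ps rose_ps); apply: hv.
have : (2 <= g)%N \/ g = 1%N /\ (1 < n)%N by move: hgn hg; lia.
case=> [h3|[h3 h4]].
  have h0 : (0 < g)%N by lia.
  apply: (vstable_three hw hp (inD v None) (inD v (Some (Ordinal h0)))
    (inD v (Some (Ordinal h3)))) => //.
have h0 : (0 < g)%N by lia.
have h0' : (0 < n)%N by lia.
case: v => [[]|]; [apply: (vstable_marked hw hp (inD _ None) (inD _ (Some (Ordinal h0))) _ (i := Ordinal h4))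
  |apply: (vstable_marked hw hp (inD _ None) (inD _ (Some (Ordinal h0))) _ (i := Ordinal h0'))]; by rewrite //= h3.
Qed.

(* The genera add up to #|V| - 2, so two vertices have genus 0, and by symmetry *)
(* such a vertex lies on all edges.                                             *)
Lemma symmetric_pure G : stable g w G -> #|edge G| = g.+1 ->
  (forall s : edge G -> edge G, bijective s -> exists fV, is_iso (G := G) (H := G) fV s) ->
  pure G /\ forall e : edge G, ~~ is_loop e.
Proof.
move=> hs hE hsym.
have hconn := stable_connected hs.
have hV : (\sum_(v : vert G) hgen v + 2 = #|vert G|)%N.
  have := stable_genus hs; rewrite /genus /b1 hE -(big_morph Posz PoszD (erefl _)); lia.
have hV2 : (1 < #|vert G|)%N by rewrite -hV; lia.
have perm e f : exists fV, [/\ injective fV, forall i, mark G i = fV (mark G i) &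
    forall h, ends (tperm e f h) = fV @: ends h].
  have [|fV [h1 _ h2 _ h3]] := hsym (tperm e f); first exact: inv_bij (tpermK e f).
  by exists fV; split=> //; apply: bij_inj.
have hZ : (1 < #|[set v : vert G | hgen v == 0%N]|)%N.
  have := cardC [set v : vert G | hgen v == 0%N]; rewrite -hV.
  have : (#|[predC [set v : vert G | hgen v == 0%N]]| <= \sum_(v : vert G) hgen v)%N.
    rewrite -sum1_card big_mkcond leq_sum // => v _.
    by rewrite !inE; case: (hgen v).
  lia.
have hnl (e : edge G) : ~~ is_loop e.
  have [v _] := card_gt0P (ltnW hV2).
  have [e0 he0 _] := two_nonloop v hconn hV2.
  have [fV [fi _ hf]] := perm e0 e.
  by move: he0; rewrite !nonloopE -(tpermL e0 e) hf card_imset.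
have key (v : vert G) : hgen v = 0%N -> forall e : edge G, v \in ends e.
  move=> hv e; have [e1 _ ve1] := two_nonloop v hconn hV2.
  case: (boolP [exists i, mark G i == v]) => [/existsP[i /eqP hi]|].
    have [fV [fi hm hf]] := perm e1 e.
    by rewrite -(tpermL e1 e) hf -hi hm hi imset_f.
  rewrite negb_exists => /forallP hm.
  have [e2 [ve2 e21 _]] := val_three hs hv (fun e _ => hnl e) hm e1 e1.
  have [e3 [ve3 e31 e32]] := val_three hs hv (fun e _ => hnl e) hm e1 e2.
  case: (eqVneq e e1) => [->//|ee1]; case: (eqVneq e e2) => [->//|ee2].
  (* The edges e1, e2, e3 lie at v. If e1 and e2 are parallel, exchanging e2 with e fixes e1 and
     makes e parallel to it. Otherwise v is the only common vertex of e1 and e2, so exchanging e3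
     with e, which fixes both, fixes v. *)
  case: (eqVneq (ends e1) (ends e2)) => [E|E].
    have [fV [fi _ hf]] := perm e2 e.
    by rewrite -(tpermL e2 e) hf -E -hf tpermD // eq_sym.
  have [fV [fi _ hf]] := perm e3 e.
  rewrite -(tpermL e3 e) hf; suff {1}<- : fV v = v by apply: imset_f.
  apply/eqP/negPn/negP=> vv; case/eqP: E.
  have in1 : fV v \in ends e1 by rewrite -(tpermD e31 ee1) hf imset_f.
  have in2 : fV v \in ends e2 by rewrite -(tpermD e32 ee2) hf imset_f.
  by rewrite (nonloop_two (hnl e1) ve1 in1) ?(nonloop_two (hnl e2) ve2 in2) // eq_sym.
split=> // v.
have /card_gt1P[a [b [ha hb ab]]] := hZ.
have {}ha := key a (eqP (etrans (esym (in_set _ _)) ha)).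
have {}hb := key b (eqP (etrans (esym (in_set _ _)) hb)).
have [e _ ve] := two_nonloop v hconn hV2.
have : v \in [set a; b] by rewrite -(nonloop_two (hnl e) (ha e) (hb e) ab).
have /card_gt1P[a' [b' [ha' hb' ab']]] := hZ.
have [ka kb] := (key a' (eqP (etrans (esym (in_set _ _)) ha')) e, key b' (eqP (etrans (esym (in_set _ _)) hb')) e).
have : v \in [set a'; b'] by rewrite -(nonloop_two (hnl e) ka kb ab').
by rewrite !inE => /orP[] /eqP -> _; apply/eqP; move: ha' hb'; rewrite !inE.
Qed.

Section Purity.
Variable R : edge_rel.
Arguments R : clear implicits.
Hypothesis hR : corr R.

(** Every permutation of the edges of the dipole is a symmetry, hence also one of its image, which
    is then pure and loopless by [symmetric_pure]. Contracting one edge on both sides gives the rose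
    and a pure image. *)
Lemma r_rose_ex : exists G G' b, [/\ R G G' b, ps g w G, #|vert G| = 1%N & pure G'].
Proof.
have [D' [b hD]] := r_tot hR dipole_ps.1 (ps_edge hg dipole_ps).
have [b' K1 K2] := r_bij hR hD.
have hD' : stable g w D' := r_st2 hR hD.
have [||pD' nlD'] := symmetric_pure hD'.
- by rewrite -(r_card hR hD) card_option card_ord.
- move=> s hs; pose s0 := b' \o s \o b.
  have hi : @is_iso n dipole dipole id s0.
    split=> //; try by [exists id].
      by apply: bij_comp => //; [apply: bij_comp => //; exists b|exists b'].
    by move=> e; rewrite !dipole_ends imset_id.
  have [fV [fE [h1 h2]]] := r_iso hR hD hD hi.
  exists fV; suff <- : fE = s by [].
  by apply: funext => e; rewrite -(K2 e) h2 /s0 /= !K2.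
pose hc := contract_contr1 (None : edge dipole).
have hnl : ~~ is_loop (None : edge dipole).
  by rewrite nonloopE dipole_ends cards2.
have hG := contr1_ps_down hc dipole_ps hnl.
have [G' [c hG']] := r_tot hR hG.1 (ps_edge hg hG).
have [pi' [ep' [hc' _]]] := r_contr1 hR hD hG' hc.
exists (contract (None : edge dipole)), G', c; split=> //.
  have := ps_card hG; have := ps_card dipole_ps; have := contr1_card hc.
  by rewrite !card_option card_unit card_ord; lia.
exact: (contr1_ps_down hc' (conj hD' pD') (nlD' _)).2.
Qed.

(** Induction on the number of vertices: a non-loop of G is contracted, and G' is pure because its
    corresponding contraction is. One-vertex graphs are all isomorphic to the one of [r_rose_ex]. *)
Lemma r_pure G G' b : R G G' b -> ps g w G -> pure G'.
Proof.
have [G0 [G0' [b0 [h0 p0 c0 q0]]]] := r_rose_ex.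
have [k] := ubnP #|vert G|; elim: k => // k IH in G G' b *.
rewrite ltnS => hk hGG' hG.
case: (leqP #|vert G| 1) => hV.
  have cG : #|vert G| = 1%N.
    by apply/eqP; rewrite eqn_leq hV; case/andP: (ps_connected hG).
  have [fV [fE hi]] := one_iso p0 hG c0 cG.
  have [fV' [fE' [hi' _]]] := r_iso hR h0 hGG' hi.
  exact: iso_pure hi' q0.
have [v _] := card_gt0P (ltnW hV).
have [e he _] := two_nonloop v (ps_connected hG) hV.
have hc := contract_contr1 e.
have hH := contr1_ps_down hc hG he.
have [H' [c hHH']] := r_tot hR hH.1 (ps_edge hg hH).
have [pi' [ep' [hc' _]]] := r_contr1 hR hGG' hHH' hc.
apply: ((contr1_pure hc').1 _).1; apply: (IH _ _ _ _ hHH' hH).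
have := ps_card hG; have := ps_card hH; have := contr1_card hc; lia.
Qed.

(** Contracting e gives a pure graph, whose image is pure; this image is the contraction of b e,
    which could not be pure if b e were a loop. *)
Lemma r_nonloop G G' b e : R G G' b -> ps g w G -> ~~ is_loop e -> ~~ is_loop (b e).
Proof.
move=> hGG' hG he; have hc := contract_contr1 e.
have hH := contr1_ps_down hc hG he.
have [H' [c hHH']] := r_tot hR hH.1 (ps_edge hg hH).
have [pi' [ep' [hc' _]]] := r_contr1 hR hGG' hHH' hc.
exact: ((contr1_pure hc').1 (r_pure hHH' hH)).2.
Qed.

End Purity.

Lemma bir_loop R G G' b e : bicorr R -> R G G' b -> ps g w G -> is_loop (b e) = is_loop e.
Proof.
case=> h1 h2 hG pG; apply/idP/idP; apply: contraLR; first exact: r_nonloop h1 _ _ _ e hG pG.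
have pG' : ps g w G' by split; [exact: r_st2 h1 _ _ _ hG|exact: r_pure h1 _ _ _ hG pG].
have [b' K1 K2] := r_bij h1 hG.
have hG' : inv_rel R b' by exists b.
by move=> h; rewrite -(K1 e); apply: (r_nonloop h2 hG').
Qed.

Lemma r_ps R G G' b : corr R -> R G G' b -> ps g w G -> ps g w G'.
Proof. by move=> h1 hG pG; split; [apply: (r_st2 h1 hG)|apply: (r_pure h1 hG)]. Qed.

Lemma r_vcard R G G' b : corr R -> R G G' b -> ps g w G -> #|vert G'| = #|vert G|.
Proof.
move=> h1 hG pG; have := ps_card (r_ps h1 hG pG); rewrite -(r_card h1 hG).
have := ps_card pG; lia.
Qed.

End Corr.

(** * Graphs with two vertices *)

Lemma vert2 (T : finType) (a b v : T) : #|T| = 2%N -> a != b -> v = a \/ v = b.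
Proof.
move=> h ab; have : [set a; b] = setT.
  by apply/eqP; rewrite eqEcard subsetT cardsT h cards2 ab.
by move/setP/(_ v); rewrite !inE => /orP[] /eqP; [left|right].
Qed.

Lemma vert3 (T : finType) (a b c v : T) : #|T| = 3%N -> a != b -> a != c -> b != c ->
  [\/ v = a, v = b | v = c].
Proof.
move=> h ab ac bc; have : a |: [set b; c] = setT.
  by apply/eqP; rewrite eqEcard subsetT cardsT h cardsU1 cards2 !inE negb_or ab ac bc.
by move/setP/(_ v); rewrite !inE => /or3P[] /eqP;
  [constructor 1|constructor 2|constructor 3].
Qed.

Lemma other2 (T : finType) (a : T) : #|T| = 2%N -> exists b, b != a.
Proof.
move=> h; have /card_gt0P[b hb] : (0 < #|predC1 a|)%N by rewrite cardC1 h.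
by exists b.
Qed.

Section Two.
Variables (g n : nat) (w : 'I_n -> rat).
Implicit Types G H : mgraph n.
Notation ps := (ps g w).

(** An isomorphism onto G' after renaming the markings by s, with prescribed edge map. Genera are
    left out since they vanish on pure graphs. *)
Definition siso (s : 'I_n -> 'I_n) G G' (b : edge G -> edge G') (fV : vert G -> vert G') :=
  [/\ bijective fV, forall e, ends (b e) = fV @: ends e
    & forall i, mark G' (s i) = fV (mark G i)].

Lemma contr1_out G H e pi ep x y : @contr1 n G H e pi ep -> x \notin ends e ->
  (pi y == pi x) = (y == x).
Proof.
move=> hc hx; apply/eqP/eqP => [/(contr1_eq hc)[//|[_]]|-> //]; by rewrite (negPf hx).
Qed.

Lemma contr1_vcard G H e pi ep : @contr1 n G H e pi ep -> ps G -> ps H ->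
  #|vert G| = #|vert H|.+1.
Proof. by move=> hc /ps_card h1 /ps_card h2; have := contr1_card hc; lia. Qed.

(** With two vertices every non-loop joins both, so all that matters is which loops and markings sit
    at one chosen vertex. *)
Lemma two_siso s G G' (b : edge G -> edge G') c c' :
  #|vert G| = 2%N -> #|vert G'| = 2%N ->
  (forall e, is_loop (b e) = is_loop e) ->
  (forall e, is_loop e -> (c' \in ends (b e)) = (c \in ends e)) ->
  (forall i, (mark G' (s i) == c') = (mark G i == c)) ->
  exists2 fV, siso s b fV & fV c = c'.
Proof.
move=> h2 h2' hl he hm; have [d dc] := other2 c h2; have [d' dc'] := other2 c' h2'.
pose fV v := if v == c then c' else d'.
have fc : fV c = c' by rewrite /fV eqxx.
have fd : fV d = d' by rewrite /fV (negPf dc).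
exists fV => //; split.
- exists (fun v => if v == c' then c else d) => v.
    by have [->|->] := vert2 v h2 dc; rewrite ?fd ?fc ?eqxx // (negPf dc').
  by have [->|->] := vert2 v h2' dc'; rewrite ?eqxx // (negPf dc').
- move=> e; case: (boolP (is_loop e)) => le; last first.
    have full (X : mgraph n) (f : edge X) (x y : vert X) : #|vert X| = 2%N -> ~~ is_loop f -> y != x ->
        ends f = [set x; y].
      move=> hX; rewrite nonloopE => /eqP hf xy; apply/esym/eqP.
      rewrite eqEcard hf cards2 eq_sym xy andbT.
      suff -> : ends f = setT by apply: subsetT.
      by apply/eqP; rewrite eqEcard subsetT cardsT hX hf.
    rewrite (full G e c d) // (full G' (b e) c' d') ?hl //.
    by rewrite imsetU1 imset_set1 fc fd.
  have lbe : is_loop (b e) by rewrite hl.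
  have := he e le; have /loopP[a ea] := le; have /loopP[a' ea'] := lbe.
  rewrite ea ea' imset_set1 !inE.
  have [->|->] := vert2 a h2 dc; have [->|->] := vert2 a' h2' dc';
    by rewrite ?eqxx ?fd ?fc // eq_sym ?(negPf dc) ?(negPf dc') // eq_sym ?(negPf dc) ?(negPf dc').
- move=> i; have := hm i.
  have [->|->] := vert2 (mark G i) h2 dc; have [->|->] := vert2 (mark G' (s i)) h2' dc';
    by rewrite ?eqxx ?fd ?fc // ?(negPf dc) ?(negPf dc').
Qed.

Lemma siso_iso G G' b fV : ps G -> ps G' -> bijective b -> siso id b fV -> @is_iso n G G' fV b.
Proof. by move=> hG hG' hb [h1 h2 h3]; split=> // v; rewrite hG.2 hG'.2. Qed.

Definition bigon H := exists e1 e2 : edge H,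
  e1 != e2 /\ forall e, ~~ is_loop e = (e == e1) || (e == e2).

Definition bare H (c : vert H) := forall e, is_loop e -> c \notin ends e.

(* A digon with the markings in A on one vertex, which carries no loop; the     *)
(* g - 1 loops and all other markings sit on the other vertex.                  *)
Definition ctype H (A : pred 'I_n) := [/\ ps H, #|vert H| = 2%N, bigon H &
  exists2 c : vert H, bare c & forall j, (mark H j == c) = A j].

(** The genus fixes the number of edges, hence of loops, and all loops sit on the vertex that is not
    bare; nothing else can vary. *)
Lemma ctype_iso H1 H2 A : ctype H1 A -> ctype H2 A ->
  exists fV fE, @is_iso n H1 H2 fV fE.
Proof.
move=> [p1 v1 [e1 [e1' [ne1 l1]]] [c1 b1 m1]] [p2 v2 [e2 [e2' [ne2 l2]]] [c2 b2 m2]].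
have nl (H : mgraph n) (x y : edge H) : x != y ->
    (forall e, ~~ is_loop e = (e == x) || (e == y)) -> #|[pred e : edge H | ~~ is_loop e]| = 2%N.
  move=> xy h; rewrite (eq_card (B := [set x; y])) ?cards2 ?xy // => e.
  by rewrite !inE h.
have eE : #|edge H1| = #|edge H2|.
  by have := ps_card p1; have := ps_card p2; rewrite v1 v2; lia.
have [k|fE hb hE] := @colour_bij (edge H1) (edge H2) bool (@is_loop n H1) (@is_loop n H2).
  have f1 := nl _ _ _ ne1 l1; have f2 := nl _ _ _ ne2 l2.
  have E1 := cardC [pred e : edge H1 | ~~ is_loop e].
  have E2 := cardC [pred e : edge H2 | ~~ is_loop e].
  case: k.
    rewrite (eq_card (B := predC [pred e : edge H1 | ~~ is_loop e])); last first.
      by move=> e; rewrite !inE negbK; case: is_loop.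
    rewrite [RHS](eq_card (B := predC [pred e : edge H2 | ~~ is_loop e])); last first.
      by move=> e; rewrite !inE negbK; case: is_loop.
    by move: E1 E2; rewrite f1 f2 eE => E1 E2; exact: (addnI (etrans E1 (esym E2))).
  rewrite (eq_card (B := [pred e : edge H1 | ~~ is_loop e])) => [|e]; last first.
    by rewrite !inE; case: is_loop.
  rewrite [RHS](eq_card (B := [pred e : edge H2 | ~~ is_loop e])) => [|e]; last first.
    by rewrite !inE; case: is_loop.
  by rewrite f1 f2.
have [||fV h _] := @two_siso id H1 H2 fE c1 c2 v1 v2 hE.
- by move=> e le; rewrite (negPf (b1 e le)); apply: negbTE; apply: b2; rewrite hE.
- by move=> i; rewrite m1 m2.
by exists fV, fE; apply: siso_iso.
Qed.

Hypothesis hw : forall i, 0 < w i <= 1.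
Hypotheses (hg : (1 <= g)%N) (hgn : (3 <= 2 * g - 2 + n)%N).

(** One loop of the rose is opened and the markings in A move to the new vertex. The hypotheses are
    what stability asks: a marking at the new vertex, and a loop or a marking at the old one. *)
Lemma ctype_ex (A : pred 'I_n) : (exists i, A i) -> (2 <= g)%N \/ (exists j, ~~ A j) ->
  exists H, ctype H A.
Proof.
move=> [i Ai] hj.
pose o0 : edge (rose g n) := Ordinal hg.
pose md (e : edge (rose g n)) := if e == o0 then Open else Keep.
pose H := @expand n (rose g n) tt md A.
have e0 : ends (Some o0 : edge H) = [set None; Some tt].
  apply: expand_open; [by rewrite /md eqxx|by rewrite /is_loop cards1|by rewrite inE].
have e1 e : e != o0 -> ends (Some e : edge H) = [set Some tt].
  by move=> he; rewrite expand_keep ?imset_set1 // /md (negPf he).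
have hN : ends (None : edge H) = [set None; Some tt] by [].
have pR := rose_ps hw hg hgn.
have hp : pure H by apply: expand_pure pR.
have pH : ps H.
  apply: expand_ps => //.
    apply: (@vstable_marked _ _ hw H None hp None (Some o0) i) => //.
    - by rewrite hN !inE.
    - by rewrite e0 !inE.
    - by rewrite /= Ai.
  case: hj => [h2|[j Aj]].
    pose o1 : edge (rose g n) := Ordinal h2.
    apply: (@vstable_loop _ _ hw H (Some tt) hp (Some o1) None) => //.
    - by rewrite /is_loop e1 // cards1.
    - by rewrite e1 // !inE.
    - by rewrite hN !inE.
  apply: (@vstable_marked _ _ hw H (Some tt) hp None (Some o0) j) => //.
  - by rewrite hN !inE.
  - by rewrite e0 !inE.
  - by rewrite /= (negPf Aj).
exists H; split=> //.
- by rewrite card_option card_unit.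
- exists None, (Some o0); split=> // -[e|]; last by rewrite nonloopE hN cards2.
  rewrite nonloopE; case: (eqVneq e o0) => [->|he].
    by rewrite e0 cards2 eqxx orbT.
  by rewrite e1 // cards1 /= (inj_eq (@Some_inj _)) (negPf he).
- exists None.
    case=> [e|]; last by rewrite /is_loop hN cards2.
    case: (eqVneq e o0) => [->|he]; first by rewrite /is_loop e0 cards2.
    by rewrite e1 // !inE.
  by move=> j /=; case: (A j).
Qed.

(** Exchanging l1 and l2 is a symmetry of G, hence one of G'. If their images sat at different
    vertices it would exchange the two vertices of G', but a marking or the image of a third loop
    keeps one of them fixed. *)
Lemma loops_together R G G' b l1 l2 : bicorr g w R -> R G G' b -> ps G ->
  #|vert G| = 2%N -> is_loop l1 -> is_loop l2 -> ends l1 = ends l2 ->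
  (0 < n)%N \/ (exists l3, [/\ is_loop l3, l3 != l1 & l3 != l2]) ->
  ends (b l1) = ends (b l2).
Proof.
move=> hB hG pG v2 h1 h2 E hex; have pG' := r_ps hw hg hgn hB.1 hG pG.
have v2' : #|vert G'| = 2%N by rewrite (r_vcard hw hg hgn hB.1 hG pG).
have lp e : is_loop (b e) = is_loop e by apply: bir_loop hB hG pG.
have hi : @is_iso n G G id (tperm l1 l2).
  split=> //; try by [exists id]; first exact: inv_bij (tpermK l1 l2).
  by move=> e; rewrite imset_id; case: tpermP => [->|->|].
have [fV [fE [[_ _ h3 _ h4] h5]]] := r_iso hB.1 hG hG hi.
have /loopP[a ea] : is_loop (b l1) by rewrite lp.
have /loopP[c ec] : is_loop (b l2) by rewrite lp.
have fa : fV a = c.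
  by apply: set1_inj; rewrite -imset_set1 -ea -h3 h5 tpermL ec.
have fc : fV c = a.
  by apply: set1_inj; rewrite -imset_set1 -ec -h3 h5 tpermR ea.
rewrite ea ec; case: (eqVneq a c) => [->//|ac]; exfalso.
have nofix x : fV x <> x.
  by have [->|->] := vert2 x v2' ac; rewrite ?fa ?fc => /eqP; rewrite ?(negPf ac) // eq_sym (negPf ac).
case: hex => [n0|[l3 [h6 h7 h8]]]; first exact: nofix (esym (h4 (Ordinal n0))).
have /loopP[d ed] : is_loop (b l3) by rewrite lp.
apply: (nofix d); apply: set1_inj.
by rewrite -imset_set1 -ed -h3 h5 tpermD // eq_sym.
Qed.

(* X opens the loop l of E and puts the marking i on it.                       *)
Lemma open_bridge E (b0 l : edge E) i : ps E -> #|vert E| = 2%N ->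
  (forall e, ~~ is_loop e = (e == b0)) -> is_loop l -> mark E i \in ends l ->
  exists (X H : mgraph n) (l2 : edge X) pi ep pi2 ep2,
   [/\ ps X, @contr1 n X E l2 pi ep, @contr1 n X H (ep b0) pi2 ep2,
      ctype H (pred1 i) & forall e, ~~ is_loop e = [|| e == ep l, e == l2 | e == ep b0]].
Proof.
move=> pE vE nl ll il; set u := mark E i.
pose md e := if e == l then Open else Keep.
pose X := expand u md (pred1 i).
have hl := loop_at ll il.
have lb : l != b0 by rewrite -(nl l) negbK in ll * => //; apply/negP=> h; rewrite nl h in ll.
have e0 : ends (Some l : edge X) = [set None; Some u].
  by apply: expand_open; rewrite // /md eqxx.
have e1 e : e != l -> ends (Some e : edge X) = Some @: ends e.
  by move=> he; apply: expand_keep; rewrite /md (negPf he).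
have hN : ends (None : edge X) = [set None; Some u] by [].
have hp : pure X by apply: expand_pure pE.
have nS (A : {set vert E}) : None \in Some @: A = false by apply/negP=> /imsetP[].
have ub : u \in ends b0.
  have := nl b0; rewrite eqxx => nb; have [d du] := other2 u vE.
  by have [x [y [xy ->]]] := nonloopP _ nb; have [->|->] := vert2 u vE xy; rewrite !inE eqxx ?orbT.
have pX : ps X.
  apply: expand_ps => //.
    apply: (@vstable_marked _ _ hw X None hp None (Some l) i) => //.
    - by rewrite hN !inE.
    - by rewrite e0 !inE.
    - by rewrite /= eqxx /= eqxx.
  apply: (@vstable_three _ _ hw X (Some u) hp None (Some l) (Some b0)) => //.
  - by rewrite hN !inE eqxx.
  - by rewrite e0 !inE eqxx.
  - by rewrite e1 ?imset_f // eq_sym.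
have nlX e : ~~ @is_loop n X e = [|| e == Some l, e == None | e == Some b0].
  case: e => [e|]; last by rewrite nonloopE hN cards2.
  rewrite nonloopE; case: (eqVneq e l) => [->|he]; first by rewrite e0 cards2 eqxx.
  rewrite e1 // card_imset; last exact: Some_inj.
  by rewrite -nonloopE nl !(inj_eq (@Some_inj _)) (negPf he).
have outs (x : edge X) : x != Some l -> x != None -> (None : vert X) \notin ends x.
  by case: x => [e|] //; rewrite (inj_eq (@Some_inj _)) => h _; rewrite e1 // nS.
have hc := contract_contr1 (Some b0 : edge X).
have nb : ~~ @is_loop n X (Some b0) by rewrite nlX eqxx !orbT.
have pH := contr1_ps_down hc pX nb.
have NN : (None : vert X) \notin ends (Some b0 : edge X) by rewrite e1 1?eq_sym // nS.
exists X, (contract (Some b0 : edge X)), None, (@expand_pi n E u md (pred1 i)), Some, (cproj (Some b0 : edge X)), val; split=> //.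
- exact: expand_contr.
- split=> //.
  + by have := contr1_vcard hc pX pH; rewrite card_option vE => -[].
  + exists (exist _ None isT), (exist _ (Some l) lb); split=> // f.
    rewrite -!val_eqE /=; apply/idP/idP=> [h|].
      have : ~~ is_loop (val f) by apply: contra h; apply: (contr1_loop hc).
      rewrite nlX => /or3P[q|q|/eqP h']; [by apply/orP; right|by apply/orP; left|].
      by have := contr1_neq hc f; rewrite h' eqxx.
    move=> h; apply/negP=> /(contr1_loop_iff hc)[|h'].
      by apply/negP; rewrite nlX; case/orP: h => /eqP q; apply/or3P;
        [constructor 2|constructor 1]; apply/eqP.
    have : None \in ends (val f) by case/orP: h => /eqP q; rewrite [X in ends X]q ?e0 ?hN !inE.
    by rewrite h' (negPf NN).
  + exists (cproj (Some b0 : edge X) None).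
      move=> f lf; rewrite (contr1_in hc) //.
      case/(contr1_loop_iff hc): lf => [lf|->] //.
      have := nlX (val f); rewrite lf /= => /esym/norP[h1 /norP[h2 h3]].
      exact: outs h1 h2.
    move=> j; rewrite (contr1_mark hc) (contr1_out _ hc) //=.
    by case: ifP => [/andP[_ ->]//|]; case: (eqVneq j i) => [->|//]; rewrite eqxx.
Qed.

End Two.

(** * The permutation of the markings *)

Section Marks.
Variables (g n : nat) (w : 'I_n -> rat).
Hypothesis hw : forall i, 0 < w i <= 1.
Hypotheses (hg : (1 <= g)%N) (hgn : (3 <= 2 * g - 2 + n)%N).
Implicit Types G H : mgraph n.
Notation ps := (ps g w).
Notation corr := (corr g w).
Notation bicorr := (bicorr g w).
Notation ctype := (ctype g w).

Lemma to_inv R G G' b : corr R -> R G G' b ->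
  exists b', [/\ @inv_rel n R G' G b', cancel b b' & cancel b' b].
Proof. by move=> hR h; have [b' K1 K2] := r_bij hR h; exists b'; split=> //; exists b. Qed.

Lemma tot_ps R G : corr R -> ps G -> exists G' b, R G G' b.
Proof. by move=> hR hG; apply: (r_tot hR hG.1 (ps_edge hg hG)). Qed.

Section OneRel.
Variable R : edge_rel n.
Arguments R : clear implicits.
Hypothesis hB : bicorr R.

Lemma bi_loop G G' b e : R G G' b -> ps G -> is_loop (b e) = is_loop e.
Proof. by move=> hG pG; apply: (bir_loop hw hg hgn _ hB hG pG). Qed.

Lemma bi_ps G G' b : R G G' b -> ps G -> ps G'.
Proof. by move=> hG pG; apply: (r_ps hw hg hgn hB.1 hG pG). Qed.

Lemma bi_vcard G G' b : R G G' b -> ps G -> #|vert G'| = #|vert G|.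
Proof. by move=> hG pG; apply: (r_vcard hw hg hgn hB.1 hG pG). Qed.

Lemma bi_bigon G G' b : R G G' b -> ps G -> bigon G -> bigon G'.
Proof.
move=> hG pG [e1 [e2 [ne hl]]]; have [b' K1 K2] := r_bij hB.1 hG.
exists (b e1), (b e2); rewrite (inj_eq (can_inj K1)); split=> // e.
by rewrite -(K2 e) (bi_loop _ hG pG) hl !(inj_eq (can_inj K1)).
Qed.

Lemma ctype_image H1 H2 A H1' H2' b1 b2 c1 : ctype H1 A -> ctype H2 A ->
  R H1 H1' b1 -> R H2 H2' b2 -> bare c1 ->
  exists2 c2 : vert H2', bare c2 & forall j, (mark H2' j == c2) = (mark H1' j == c1).
Proof.
move=> t1 t2 h1 h2 bc; have [fV [fE hi]] := ctype_iso t1 t2.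
have [fV' [fE' [[i1 i2 i3 _ i5] _]]] := r_iso hB.1 h1 h2 hi.
exists (fV' c1); last by move=> j; rewrite i5 (inj_eq (bij_inj i1)).
move=> e le; have [fi _ K] := i2; rewrite -(K e) i3 mem_imset; last exact: bij_inj.
apply: bc; move: le; rewrite -{1}(K e) /is_loop i3 card_imset //; exact: bij_inj.
Qed.

(** The loops of H sit together, so those of H' do too and leave a vertex bare. It has no edges but
    the two of the digon, so stability requires a marking there. *)
Lemma ctype_bare H A H' b : (0 < n)%N -> ctype H A -> R H H' b ->
  exists2 c : vert H', bare c & exists j, mark H' j = c.
Proof.
move=> n0 [pH vH bH [c bc _]] hH.
have pH' := bi_ps hH pH; have vH' := bi_vcard hH pH; rewrite vH in vH'.
have [b' K1 K2] := r_bij hB.1 hH.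
have [d dc] := other2 c vH.
have tog (e1 e2 : edge H') : is_loop e1 -> is_loop e2 -> ends e1 = ends e2.
  rewrite -(K2 e1) -(K2 e2) !(bi_loop _ hH pH) => l1 l2.
  apply: (loops_together hw hg hgn hB hH pH) => //; last by left.
  have at_d e : is_loop e -> ends e = [set d].
    move=> le; have /loopP[a ea] := le; have := bc _ le.
    by rewrite ea inE eq_sym; have [->|->] := vert2 a vH dc; rewrite // eqxx.
  by rewrite !at_d.
have [c' bc'] : exists c' : vert H', bare c'.
  case: (pickP (@is_loop n H')) => [l0 ll0|hN].
    have /loopP[a ea] := ll0; have [c' ca] := other2 a vH'.
    by exists c' => l ll; rewrite (tog _ _ ll ll0) ea inE.
  have [c' _] : exists c' : vert H', c' \in predT by apply/card_gt0P; rewrite vH'.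
  by exists c' => l; rewrite hN.
exists c' => //.
have [e1 [e2 [_ hl]]] := bi_bigon hH pH bH.
case: (boolP [exists j, mark H' j == c']) => [/existsP[j /eqP hj]|]; first by exists j.
rewrite negb_exists => /forallP hm; exfalso.
have nl e : c' \in ends e -> ~~ is_loop e.
  by apply: contraL => le; apply: bc'.
have [e3 [h3 h31 h32]] := val_three pH'.1 (pH'.2 c') nl hm e1 e2.
by have := nl _ h3; rewrite hl (negPf h31) (negPf h32).
Qed.

(** The image of the configuration of [open_bridge]. The opened loop is again a pair of parallel
    edges in X', because contracting [l2] turns its partner, a non-loop, into the loop c l. A vertex
    off this pair lies on no non-loop but the bridge b1. *)
Lemma open_image E E' (c : edge E -> edge E') (b0 l : edge E) i :
  ps E -> #|vert E| = 2%N -> (forall e, ~~ is_loop e = (e == b0)) -> is_loop l ->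
  mark E i \in ends l -> R E E' c ->
  exists (X' H H' : mgraph n) (d : edge H -> edge H') (l2 b1 : edge X') pi ep pi2 ep2,
   [/\ ps X' /\ #|vert X'| = 3%N, @contr1 n X' E' l2 pi ep,
      @contr1 n X' H' b1 pi2 ep2, ctype H (pred1 i) /\ R H H' d
    & [/\ ends (c l) = pi @: ends l2, ~~ is_loop b1, ~~ is_loop l2 &
       forall x e, x \notin ends l2 -> ~~ is_loop e -> x \in ends e -> e = b1]].
Proof.
move=> pE vE nl ll il hE.
have [X [H [l2 [pi [ep [pi2 [ep2 [pX c1 c2 tH nX]]]]]]]] := open_bridge hw pE vE nl ll il.
have [X' [cx hX]] := tot_ps hB.1 pX.
have [pH _ _ _] := tH; have [H' [d hH]] := tot_ps hB.1 pH.
have [pi' [ep' [c1' k1]]] := r_contr1 hB.1 hX hE c1.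
have [pi2' [ep2' [c2' k2]]] := r_contr1 hB.1 hX hH c2.
have [b' K1 K2] := r_bij hB.1 hX.
have lX e := bi_loop e hX pX.
have par : ends (cx (ep l)) = ends (cx l2).
  have : is_loop (c l) by rewrite (bi_loop _ hE pE).
  case/(contr1_loop_iff c1'); rewrite k1 // lX => le.
  by have := nX (ep l); rewrite le eqxx.
exists X', H, H', d, (cx l2), (cx (ep b0)), pi', ep', pi2', ep2'; split=> //.
  split; first exact: bi_ps hX pX.
  by rewrite (bi_vcard hX pX) (contr1_vcard c1 pX pE) vE.
split.
- by rewrite (contr1_ends c1') k1 par.
- by rewrite lX nX eqxx !orbT.
- by rewrite lX nX eqxx !orbT.
move=> x e hx; rewrite -(K2 e) lX nX => /or3P[] /eqP -> //; rewrite ?par => h;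
  by rewrite h in hx.
Qed.

Lemma uncontracted_loop X H (e : edge X) pi ep (l : edge X) r :
  @contr1 n X H e pi ep -> ~~ is_loop e -> is_loop l -> r \in ends l -> ~ bare (pi r).
Proof.
move=> hc he hl hr hb; have [|f hf] := contr1_lift hc (f := l).
  by apply: contraNneq he => <-.
have := hb f; rewrite (contr1_ends hc) -hf imset_f //.
by move/(_ (contr1_loop hc _)); rewrite -hf => /(_ hl).
Qed.

(** If j were off the parallel pair in X', it would share the third vertex with the loop that comes
    from y. That loop survives the contraction of b1, so the vertex of j in the digon could not be
    bare. *)
Lemma bridge_side E E' (c : edge E -> edge E') (b0 l y : edge E) i H H' d c' j :
  (0 < n)%N -> ps E -> #|vert E| = 2%N -> (forall e, ~~ is_loop e = (e == b0)) ->
  is_loop l -> is_loop y -> ends y != ends l -> mark E i \in ends l -> R E E' c ->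
  ctype H (pred1 i) -> R H H' d -> bare c' -> mark H' j = c' -> mark E' j \in ends (c l).
Proof.
move=> n0 pE vE nl ll ly yl il hE tH hH bc' hj.
have [X' [H1 [H1' [d1 [l2 [b1 [pi [ep [pi2 [ep2 [[pX vX] c1 c2 [tH1 hH1] [k1 k2 k3 k4]]]]]]]]]]]] :=
  open_image pE vE nl ll il hE.
have [c1' bc1 m1] := ctype_image tH tH1 hH hH1 bc'.
have {}m1 : mark H1' j = c1' by apply/eqP; rewrite m1 hj.
rewrite k1 (contr1_mark c1); case: (boolP (mark X' j \in ends l2)) => hr; first exact: imset_f.
exfalso.
have ycl : ends (c y) != ends (c l).
  apply: contra yl => /eqP E1.
  have [ci [hi K1 K2]] := to_inv hB.1 hE.
  rewrite -(K1 y) -(K1 l); apply/eqP.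
  apply: (loops_together hw hg hgn (bicorr_inv hB) hi (bi_ps hE pE)) => //.
  - by rewrite (bi_vcard hE pE).
  - by rewrite (bi_loop _ hE pE).
  - by rewrite (bi_loop _ hE pE).
  by left.
have lcy : is_loop (c y) by rewrite (bi_loop _ hE pE).
have [lt|pt] := (contr1_loop_iff c1 (c y)).1 lcy; last first.
  by move/eqP: ycl; case; rewrite k1 (contr1_ends c1) pt.
have /loopP[t et] := lt.
have tl2 : t \notin ends l2.
  apply: contra ycl => tl; rewrite k1 (contr1_ends c1) et imset_set1.
  apply/eqP/setP=> z; rewrite inE; apply/eqP/imsetP=> [->|[z' hz' ->]]; first by exists t.
  by apply/(contr1_eq c1); right.
have [p [q [pq epq]]] := nonloopP _ k3.
have rt : mark X' j = t.
  have pr : p != mark X' j by apply: contraNneq hr => <-; rewrite epq !inE eqxx.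
  have qr : q != mark X' j by apply: contraNneq hr => <-; rewrite epq !inE eqxx orbT.
  have pt : p != t by apply: contraNneq tl2 => <-; rewrite epq !inE eqxx.
  have qt : q != t by apply: contraNneq tl2 => <-; rewrite epq !inE eqxx orbT.
  have [E1|E1|//] := vert3 t vX pq pr qr; first by rewrite E1 eqxx in pt.
  by rewrite E1 eqxx in qt.
apply: (uncontracted_loop (r := t) c2 k2 lt); first by rewrite et inE.
by rewrite -rt -(contr1_mark c2) m1.
Qed.

End OneRel.

(** A dumbbell: loops at both ends of a bridge, with i alone at one end. Two loops require g at
    least 2. *)
Lemma bridge_ex i j : (2 <= g)%N -> i != j ->
  exists (E : mgraph n) (b0 l y : edge E),
    [/\ ps E, #|vert E| = 2%N, forall e, ~~ is_loop e = (e == b0), is_loop l /\ is_loop y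
     & [/\ ends y != ends l, mark E i \in ends l & mark E j \in ends y]].
Proof.
move=> g2 ij.
pose o0 : edge (rose g n) := Ordinal hg; pose o1 : edge (rose g n) := Ordinal g2.
pose md (e : edge (rose g n)) := if e == o0 then Keep else Move.
pose E := @expand n (rose g n) tt md (predC1 i).
have hN : ends (None : edge E) = [set None; Some tt] by [].
have e0 : ends (Some o0 : edge E) = [set Some tt].
  by rewrite expand_keep ?imset_set1 // /md eqxx.
have e1 e : e != o0 -> ends (Some e : edge E) = [set None].
  move=> he; apply: expand_move_loop; rewrite ?inE //; first by rewrite /md (negPf he).
  by rewrite /is_loop cards1.
have pR := rose_ps hw hg hgn.
have hp : pure E by apply: expand_pure pR.
have lo e : ~~ is_loop (e : edge E) = (e == None).
  case: e => [e|]; last by rewrite nonloopE hN cards2.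
  by rewrite nonloopE; case: (eqVneq e o0) => [->|he]; rewrite ?e0 ?e1 // cards1.
exists E, None, (Some o0), (Some o1); split=> //.
- apply: expand_ps => //.
    apply: (@vstable_loop _ _ hw E None hp (Some o1) None) => //.
    + by rewrite /is_loop e1 // cards1.
    + by rewrite e1 // inE.
    + by rewrite hN !inE.
  apply: (@vstable_loop _ _ hw E (Some tt) hp (Some o0) None) => //.
  + by rewrite /is_loop e0 // cards1.
  + by rewrite e0 // inE.
  + by rewrite hN !inE.
- by rewrite card_option card_unit.
- by rewrite /is_loop e0 e1 // !cards1.
split.
- by rewrite e0 e1 // (inj_eq set1_inj).
- by rewrite e0 /= !inE eqxx.
- by rewrite e1 //= inE; case: (eqVneq j i) ij.
Qed.

Definition mark_perm (R : edge_rel n) (s : {perm 'I_n}) :=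
  forall i H H' b, R H H' b -> ctype H (pred1 i) -> ctype H' (pred1 (s i)).

(** F i j says that j appears on the bare vertex of the image of the digon marked i. Distinct i and
    i2 cannot share j: in a dumbbell separating them [bridge_side] would put j at both ends. So a
    choice function for F is injective, hence a permutation. *)
Lemma mark_perm2 R : (2 <= g)%N -> bicorr R -> exists s, mark_perm R s.
Proof.
move=> g2 hB.
pose F i j := exists H H' b c, [/\ ctype H (pred1 i), R H H' b, @bare n H' c & mark H' j = c].
have Fex i : exists j, F i j.
  have [|H tH] := ctype_ex hw hg hgn (A := pred1 i) _ (or_introl g2); first by exists i => /=.
  have [pH _ _ _] := tH; have [H' [b hH]] := tot_ps hB.1 pH.
  have [|c bc [j hj]] := ctype_bare hB _ tH hH; first by case: (i) => k; lia.
  by exists j, H, H', b, c.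
have Finj i i2 j : F i j -> F i2 j -> i = i2.
  move=> [H [H' [b [c [tH hH bc hj]]]]] [H2 [H2' [b2 [c2 [tH2 hH2 bc2 hj2]]]]].
  apply/eqP/negPn/negP=> ii2.
  have n0 : (0 < n)%N by case: (i) => k; lia.
  have [E [b0 [l [y [pE vE nl [ll ly] [yl il iy]]]]]] := bridge_ex g2 ii2.
  have [E' [d hE]] := tot_ps hB.1 pE.
  have h1 := bridge_side hB n0 pE vE nl ll ly yl il hE tH hH bc hj.
  have ly' : ends l != ends y by rewrite eq_sym.
  have h2 := bridge_side hB n0 pE vE nl ly ll ly' iy hE tH2 hH2 bc2 hj2.
  case/eqP: yl; have [di [hi K1 K2]] := to_inv hB.1 hE.
  rewrite -(K1 y) -(K1 l).
  have lp e : is_loop (d e) = is_loop e by exact: (bi_loop hB _ hE pE).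
  apply: (loops_together hw hg hgn (bicorr_inv hB) hi (bi_ps hB hE pE)) => //.
  - by rewrite (bi_vcard hB hE pE).
  - by rewrite lp.
  - by rewrite lp.
  - by rewrite (loop_at _ h1) ?lp // (loop_at _ h2) ?lp.
  by left.
have [f hf] := choice Fex.
have finj : injective f by move=> i i2 E; apply: (Finj i i2 (f i)); rewrite // {1}E.
exists (perm finj) => i H H' b hH tH; have [pH vH bH _] := tH.
have n0 : (0 < n)%N by case: (i) => k; lia.
have [c bc [j0 hj0]] := ctype_bare hB n0 tH hH.
(* Surjectivity of f gives uniqueness: j is the value of f at some marking, and [Finj] identifies
   that marking with i. *)
have key j : mark H' j = c -> j = f i.
  move=> hj; have -> : j = f ((perm finj)^-1%g j) by rewrite -[f _](permE finj) permKV.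
  congr f; apply: (Finj _ _ j); last by exists H, H', b, c.
  by have := hf ((perm finj)^-1%g j); rewrite -[f _](permE finj) permKV.
split; [exact: bi_ps hB _ _ _ hH pH|by rewrite (bi_vcard hB hH pH)|exact: bi_bigon hB _ _ _ hH pH bH|].
exists c => // j /=; rewrite permE; apply/eqP/eqP=> [/key //|->].
by rewrite -(key j0).
Qed.

End Marks.

(** * Genus one *)

Section GenusOne.
Variables (n : nat) (w : 'I_n -> rat).
Implicit Types G H : mgraph n.
Notation g := 1%N.
Notation ps := (ps g w).
Notation corr := (corr g w).
Notation bicorr := (bicorr g w).
Notation ctype := (ctype g w).

Definition noloop H := forall e : edge H, ~~ is_loop e.

(** In genus 1 this is a 2-cycle, given by a partition of the markings into two nonempty classes. *)
Definition cyc2 H := [/\ ps H, #|vert H| = 2%N & noloop H].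

Lemma cyc2_edges H : cyc2 H -> #|edge H| = 2%N.
Proof. by case=> /ps_card h1 h2 _; move: h1; rewrite h2; lia. Qed.

Lemma ctype_cyc2 H A : ctype H A -> cyc2 H.
Proof.
move=> [pH vH [e1 [e2 [ne hl]]] _]; split=> // e; rewrite hl.
have hE : #|edge H| = 2%N by have := ps_card pH; rewrite vH; lia.
by have [->|->] := vert2 e hE ne; rewrite eqxx ?orbT.
Qed.

Lemma cyc2_two H : cyc2 H -> exists e1 e2 : edge H, e1 != e2.
Proof.
move=> hH; have hE := cyc2_edges hH.
have [e1 _] : exists e1 : edge H, e1 \in predT by apply/card_gt0P; rewrite hE.
by have [e2 h] := other2 e1 hE; exists e2, e1.
Qed.

Lemma cyc2_ctype H A (c : vert H) : cyc2 H -> (forall j, (mark H j == c) = A j) -> ctype H A.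
Proof.
move=> hH hA; have [pH vH nH] := hH; split=> //.
  have [e1 [e2 ne]] := cyc2_two hH; exists e1, e2; split=> // e.
  by rewrite nH; have [->|->] := vert2 e (cyc2_edges hH) ne; rewrite eqxx ?orbT.
by exists c => // e le; have := nH e; rewrite le.
Qed.

Lemma noloop_ends H e (c : vert H) : cyc2 H -> c \in ends e.
Proof.
move=> [pH vH nH]; have := nH e; rewrite nonloopE => /eqP h.
suff -> : ends e = setT by rewrite inE.
by apply/eqP; rewrite eqEcard subsetT cardsT vH h.
Qed.

Lemma cyc2_marked H (c : vert H) : cyc2 H -> exists i, mark H i = c.
Proof.
move=> hH; have [pH vH nH] := hH.
case: (boolP [exists j, mark H j == c]) => [/existsP[j /eqP hj]|]; first by exists j.
rewrite negb_exists => /forallP hm; exfalso.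
have [e1 [e2 ne]] := cyc2_two hH.
have [e3 [_ h31 h32]] := val_three pH.1 (pH.2 c) (fun e _ => nH e) hm e1 e2.
by have [h|h] := vert2 e3 (cyc2_edges hH) ne; rewrite h eqxx in h31 h32.
Qed.

Lemma contr1_nopar X H (e : edge X) pi ep f : @contr1 n X H e pi ep -> noloop H ->
  f != e -> ends f <> ends e.
Proof.
move=> hc nH fe E; have [f' hf] := contr1_lift hc fe.
by have /negP := nH f'; apply; apply/(contr1_loop_iff hc); right; rewrite -hf.
Qed.

Hypothesis hw : forall i, 0 < w i <= 1.

(** Splitting i off its class gives a 3-cycle with classes {i}, the rest of that class, and the
    other class of K. Each of the three contractions merges two of them. *)
Lemma triangle K i j : cyc2 K -> i != j -> mark K i = mark K j ->
  exists (X H1 H2 : mgraph n) (e0 e1 e2 : edge X) pi0 ep0 pi1 ep1 pi2 ep2,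
  [/\ ps X /\ uniq [:: e0; e1; e2], @contr1 n X K e0 pi0 ep0,
    @contr1 n X H1 e1 pi1 ep1, @contr1 n X H2 e2 pi2 ep2
    & [/\ ctype H2 (pred1 i), cyc2 H1 & exists c, forall k,
        (mark H1 k == c) = (mark K k == mark K i) && (k != i)]].
Proof.
move=> hK ij Eij; have [pK vK nK] := hK; set q := mark K i.
have [e1 [e2 ne]] := cyc2_two hK; have all2 e := vert2 e (cyc2_edges hK) ne.
pose md e := if e == e1 then Move else Keep.
pose X := expand q md (pred1 i).
have qe e : q \in ends e by apply: noloop_ends.
have [v vq ev] := nonloop_at (nK e1) (qe e1).
have ev2 : ends e2 = [set q; v].
  apply: nonloop_two => //; last by rewrite eq_sym.
  exact: noloop_ends.
have hN : ends (None : edge X) = [set None; Some q] by [].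
have h1 : ends (Some e1 : edge X) = [set None; Some v].
  rewrite expand_move ?qe // /md ?eqxx // ev setU1K ?imset_set1 //.
  by rewrite inE eq_sym.
have h2 : ends (Some e2 : edge X) = [set Some q; Some v].
  by rewrite expand_keep /md ?(negPf ne) 1?eq_sym ?(negPf ne) // ev2 imsetU1 imset_set1.
have hp : pure X by apply: expand_pure pK.
have pX : ps X.
  apply: expand_ps => //.
    apply: (@vstable_marked _ _ hw X None hp None (Some e1) i) => //.
    - by rewrite hN !inE.
    - by rewrite h1 !inE.
    - by rewrite /= eqxx /= eqxx.
  apply: (@vstable_marked _ _ hw X (Some q) hp None (Some e2) j) => //.
  - by rewrite hN !inE eqxx.
  - by rewrite h2 !inE eqxx.
  - by rewrite /= (eq_sym j) (negPf ij) andbF -Eij.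
have nX e : ~~ @is_loop n X e.
  case: e => [e|]; last by rewrite nonloopE hN cards2.
  have [->|->] := all2 e; first by rewrite nonloopE h1 cards2.
  by rewrite nonloopE h2 cards2 (inj_eq (@Some_inj _)) (eq_sym q) vq.
have vX : #|vert X| = 3%N by rewrite card_option vK.
have vqS : (Some v : vert X) == Some q = false by rewrite (inj_eq (@Some_inj _)) (negPf vq).
have cl (e f : edge X) : e != f -> ends e != ends f.
  have d01 : ends (None : edge X) != ends (Some e1 : edge X).
    by rewrite hN h1; apply/eqP=> /setP/(_ (Some q)); rewrite !inE eqxx ?(inj_eq (@Some_inj _)) (eq_sym q v) (negPf vq).
  have d02 : ends (None : edge X) != ends (Some e2 : edge X).
    by rewrite hN h2; apply/eqP=> /setP/(_ None); rewrite !inE eqxx.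
  have d12 : ends (Some e1 : edge X) != ends (Some e2 : edge X).
    by rewrite h1 h2; apply/eqP=> /setP/(_ None); rewrite !inE eqxx.
  case: e f => [e|] [f|] //; rewrite ?(inj_eq (@Some_inj _)) => h.
  - have [E1|E1] := all2 e; have [E2|E2] := all2 f; move: h; rewrite E1 E2 ?eqxx //.
    by move=> _; rewrite eq_sym.
  - by have [->|->] := all2 e; rewrite eq_sym.
  - by have [->|->] := all2 f.
have down (e : edge X) : cyc2 (contract e).
  have hc := contract_contr1 e; have pH := contr1_ps_down hc pX (nX e); split=> //.
    by have := contr1_vcard hc pX pH; rewrite vX => -[].
  move=> f; apply/negP=> /(contr1_loop_iff hc)[h|h].
    by have := nX (val f); rewrite h.
  by have := cl _ _ (contr1_neq hc f); rewrite h eqxx.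
have hc1 := contract_contr1 (Some e1 : edge X).
have hc2 := contract_contr1 (Some e2 : edge X).
have hm k : mark X k = if (mark K k == q) && (k == i) then None else Some (mark K k) by [].
exists X, (contract (Some e1 : edge X)), (contract (Some e2 : edge X)), None, (Some e1), (Some e2).
exists (@expand_pi n K q md (pred1 i)), Some, (cproj (Some e1 : edge X)), val, (cproj (Some e2 : edge X)), val.
split=> //.
- by split=> //=; rewrite !inE (inj_eq (@Some_inj _)) ne.
- exact: expand_contr.
split=> //.
- apply: (@cyc2_ctype (contract (Some e2 : edge X)) (pred1 i) (cproj (Some e2 : edge X) None)) => // k.
  rewrite (contr1_mark hc2) (contr1_out _ hc2) ?h2 ?inE // hm.
  by rewrite /=; case: (eqVneq k i) => [->|ki]; rewrite ?eqxx ?andbF.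
- exists (cproj (Some e1 : edge X) (Some q)) => k.
  have qN : (Some q : vert X) \notin ends (Some e1 : edge X).
    by rewrite h1 !inE /= (inj_eq (@Some_inj _)) eq_sym.
  rewrite (contr1_mark hc1) (contr1_out _ hc1) // hm.
  by case: (eqVneq k i) => [->|ki]; rewrite ?eqxx ?andbF ?andbT ?(inj_eq (@Some_inj _)).
Qed.

Hypothesis hn : (3 <= n)%N.

Let hg : (1 <= g)%N := isT.
Let hgn : (3 <= 2 * g - 2 + n)%N := hn.

Lemma bi_cyc2 R G G' b : bicorr R -> R G G' b -> cyc2 G -> cyc2 G'.
Proof.
move=> hB hG [pG vG nG]; split.
- exact: (bi_ps hw hg hgn hB hG pG).
- by rewrite (bi_vcard hw hg hgn hB hG pG).
move=> e; have [b' K1 K2] := r_bij hB.1 hG.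
by rewrite -(K2 e) (bi_loop hw hg hgn hB _ hG pG).
Qed.

Lemma third_mark (i j : 'I_n) : exists k : 'I_n, k != i /\ k != j.
Proof.
have : (0 < #|~: [set i; j]|)%N.
  by have := cardsC [set i; j]; rewrite cards2 card_ord; case: (_ != _); move: hn; lia.
by case/card_gt0P=> k; rewrite !inE negb_or => /andP[]; exists k.
Qed.

(** Otherwise both classes of H' contain two markings, say a1, a2 and d1, d2. Let K' have the class
    {a1, d1} and let K be its preimage. If i is alone in K, then K is isomorphic to H and K' would
    split the markings as H' does. If not, [triangle] gives X contracting to K and to a copy of H,
    and in X' the four markings need four vertices, but there are three. *)
Lemma ctype_singleton R i H H' b : bicorr R -> R H H' b -> ctype H (pred1 i) ->
  exists j, ctype H' (pred1 j).
Proof.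
move=> hB hH tH; have cH := ctype_cyc2 tH; have cH' := bi_cyc2 hB hH cH.
have [pH' vH' nH'] := cH'.
apply: contrapT => hno.
have two (c : vert H') : exists a b, [/\ a != b, mark H' a = c & mark H' b = c].
  have [a ha] := cyc2_marked c cH'.
  case: (boolP [exists k, (k != a) && (mark H' k == c)]) => [/existsP[k /andP[ka /eqP hk]]|].
    by exists a, k; rewrite eq_sym.
  rewrite negb_exists => /forallP hk; case: hno; exists a.
  apply: (cyc2_ctype (c := c)) => // j /=; have := hk j.
  by case: (eqVneq j a) => [->|] /=; [rewrite ha eqxx|move=> _ /negPf].
have [u _] : exists u : vert H', u \in predT by apply/card_gt0P; rewrite vH'.
have [v vu] := other2 u vH'.
have [a1 [a2 [a12 ma1 ma2]]] := two u; have [d1 [d2 [d12 md1 md2]]] := two v.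
have ad (a d : 'I_n) : mark H' a = u -> mark H' d = v -> a != d.
  by move=> ha hd; apply: contraNneq vu => E; rewrite -ha -hd E.
have [||K' tK'] := @ctype_ex 1 n w hw hg hgn (pred2 a1 d1).
- by exists a1; rewrite /= eqxx.
- by right; exists a2; rewrite /= negb_or eq_sym a12 (ad a2 d1).
have [pK' vK' _ [c _ mc]] := tK'.
have [K [bi hKi]] := tot_ps hg hB.2 pK'.
have [bK [hK _ _]] := hKi.
have cK := bi_cyc2 (bicorr_inv hB) hKi (ctype_cyc2 tK').
have diff (X : mgraph n) (x y z : vert X) : #|vert X| = 2%N -> x != z -> y != z -> x = y.
  by move=> hX xz yz; have [//|E] := vert2 x hX yz; rewrite E eqxx in xz.
have K1 : mark K' a1 != mark K' a2.
  have := mc a1; have := mc a2; rewrite /= eqxx => + /eqP ->; rewrite eq_sym => ->.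
  by rewrite negb_or eq_sym a12 (ad a2 d1).
have K2 : mark K' a1 = mark K' d1.
  by transitivity c; [|symmetry]; apply/eqP; rewrite mc /= eqxx ?orbT.
have K3 : mark K' d2 = mark K' a2.
  apply: (diff K' _ _ c) => //; rewrite mc /= negb_or.
    by rewrite (eq_sym d2) (ad a1 d2) // eq_sym d12.
  by rewrite eq_sym a12 (ad a2 d1).
case: (boolP [exists j, (j != i) && (mark K j == mark K i)]); last first.
  rewrite negb_exists => /forallP hk.
  have tK : ctype K (pred1 i).
    apply: (cyc2_ctype (c := mark K i)) => // j /=; have := hk j.
    by case: (eqVneq j i) => [->|] /=; [rewrite eqxx|move=> _ /negPf].
  have [fV [fE hi]] := ctype_iso tH tK.
  have [fV' [fE' [[_ _ _ _ hm] _]]] := r_iso hB.1 hH hK hi.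
  by case/eqP: K1; rewrite !hm ma1 ma2.
case/existsP=> j /andP[ji /eqP jq].
have ij : i != j by rewrite eq_sym.
have [X [H1 [H2 [e0 [e1 [e2 [pi0 [ep0 [pi1 [ep1 [pi2 [ep2 [[pX _] c0 c1 c2 [tH2 cH1 _]]]]]]]]]]]]]] :=
  triangle cK ij (esym jq).
have [pH2 _ _ _] := tH2.
have [X' [bX hX]] := tot_ps hg hB.1 pX; have [H2' [b2 hH2]] := tot_ps hg hB.1 pH2.
have [pi0' [ep0' [c0' _]]] := r_contr1 hB.1 hX hK c0.
have [pi2' [ep2' [c2' _]]] := r_contr1 hB.1 hX hH2 c2.
have [fV [fE hi]] := ctype_iso tH tH2.
have [fV' [fE' [[bf _ _ _ hm] _]]] := r_iso hB.1 hH hH2 hi.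
have X0 x y : mark K' x != mark K' y -> mark X' x != mark X' y.
  by apply: contraNneq; rewrite !(contr1_mark c0') => ->.
have X2 x y : mark H' x = u -> mark H' y = v -> mark X' x != mark X' y.
  move=> hx hy; apply: contraNneq vu => E; apply/eqP/(bij_inj bf).
  by rewrite -hx -hy -!hm !(contr1_mark c2') E.
have vX : #|vert X'| = 3%N.
  by rewrite (bi_vcard hw hg hgn hB hX pX) (contr1_vcard c2 pX pH2); case: tH2 => _ ->.
have [h|h|h] := vert3 (mark X' d2) vX (X0 a1 a2 K1) (X2 a1 d1 ma1 md1) (X2 a2 d1 ma2 md1).
- by have := X2 a1 d2 ma1 md2; rewrite h eqxx.
- by have := X2 a2 d2 ma2 md2; rewrite h eqxx.
by have := X0 d2 d1; rewrite h eqxx K3 -K2 eq_sym => /(_ K1).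
Qed.

Definition singleton_rel (R : edge_rel n) i j := exists H H' b,
  [/\ R H H' b, ctype H (pred1 i) & ctype H' (pred1 j)].

(** Equal images force isomorphic preimages. Since there are at least three markings, the partition
    with the class {i} determines i. *)
Lemma singleton_rel_inj R i i2 j : bicorr R -> singleton_rel R i j ->
  singleton_rel R i2 j -> i = i2.
Proof.
move=> hB [H1 [H1' [b1 [h1 t1 t1']]]] [H2 [H2' [b2 [h2 t2 t2']]]].
have [fV [fE hi]] := ctype_iso t1' t2'.
have [b1' [h1' _ _]] := to_inv hB.1 h1; have [b2' [h2' _ _]] := to_inv hB.1 h2.
have [fV' [fE' [[bf _ _ _ hm] _]]] := r_iso hB.2 h1' h2' hi.
have [_ v1 _ [c1 _ m1]] := t1; have [_ v2 _ [c2 _ m2]] := t2.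
apply/eqP/negPn/negP=> ii2.
have [k [ki ki2]] := third_mark i i2.
have Ei : mark H1 i = c1 by apply/eqP; rewrite m1 /= eqxx.
have Ek : mark H1 k != c1 by rewrite m1.
have Ei2 : mark H1 i2 != c1 by rewrite m1 /= eq_sym.
have : mark H1 k = mark H1 i2 by have [//|h] := vert2 (mark H1 k) v1 Ei2; rewrite h eqxx in Ek.
move/(congr1 fV'); rewrite -!hm.
have -> : mark H2 i2 = c2 by apply/eqP; rewrite m2 /= eqxx.
by move/eqP; rewrite m2 /= (negPf ki2).
Qed.

Lemma mark_perm1 R : bicorr R -> exists s, mark_perm 1 w R s.
Proof.
move=> hB.
have Fex i : exists j, singleton_rel R i j.
  have [||H tH] := @ctype_ex 1 n w hw hg hgn (pred1 i); first by exists i => /=.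
    by right; have [k [ki _]] := third_mark i i; exists k.
  have [pH _ _ _] := tH; have [H' [b hH]] := tot_ps hg hB.1 pH.
  by have [j tj] := ctype_singleton hB hH tH; exists j, H, H', b.
have [f hf] := choice Fex.
have finj : injective f.
  by move=> i i2 E; apply: (@singleton_rel_inj R i i2 (f i)); rewrite // {1}E.
exists (perm finj) => i H H' b hH tH.
have [j tj] := ctype_singleton hB hH tH.
rewrite permE; suff -> : f i = j by [].
have sw k : singleton_rel R i k -> singleton_rel (inv_rel R) k i.
  case=> [X [X' [bX [h1 h2 h3]]]]; have [bX' [h _ _]] := to_inv hB.1 h1.
  by exists X', X, bX'.
apply: (singleton_rel_inj (bicorr_inv hB) (sw _ (hf i))).
by apply: sw; exists H, H', b.
Qed.

(** Induction on the class at q, from which i is split off by [triangle]. In the images of both H1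
    and H2 the markings s x and s y are together, so if they were apart in X', two distinct edges
    would join their vertices; these would be parallel, and contracting one would create a loop. *)
Lemma cyc2_marks R s H H' b (q : vert H) x y : bicorr R -> mark_perm 1 w R s ->
  R H H' b -> cyc2 H -> mark H x != q -> mark H y != q -> mark H' (s x) = mark H' (s y).
Proof.
move=> hB hs.
have [m] := ubnP #|[set k | mark H k == q]|; elim: m => // m IH in H H' b q *.
rewrite ltnS => hm hH cH xq yq.
have [pH' vH' _] := bi_cyc2 hB hH cH.
have diff (X : mgraph n) (c a d : vert X) : #|vert X| = 2%N -> a != c -> d != c -> a = d.
  by move=> hX ac dc; have [//|E] := vert2 a hX dc; rewrite E eqxx in ac.
have sing i K K' bK : R K K' bK -> ctype K (pred1 i) -> x != i -> y != i ->
    mark K' (s x) = mark K' (s y).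
  move=> hK tK xi yi; have [_ vK' _ [c _ mc]] := hs _ _ _ _ hK tK.
  by apply: (diff K' c) => //; rewrite mc /= (inj_eq perm_inj).
have [i hi] := cyc2_marked q cH.
have xi : x != i by apply: contraNneq xq => ->; rewrite hi.
have yi : y != i by apply: contraNneq yq => ->; rewrite hi.
case: (boolP [exists j, (j != i) && (mark H j == q)]); last first.
  rewrite negb_exists => /forallP hk; apply: (sing i _ _ _ hH) => //.
  apply: (cyc2_ctype (c := q)) => // j /=; have := hk j.
  by case: (eqVneq j i) => [->|] /=; [rewrite hi eqxx|move=> _ /negPf].
case/existsP=> j /andP[ji /eqP jq].
have [||X [H1 [H2 [e0 [e1 [e2 [pi0 [ep0 [pi1 [ep1 [pi2 [ep2 [[pX ue] c0 c1 c2 [tH2 cH1 [c hc]]]]]]]]]]]]]]] :=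
  triangle (i := i) (j := j) cH; first by rewrite eq_sym.
  by rewrite hi.
have [pH2 _ _ _] := tH2; have [pH1 _ _] := cH1.
have [X' [bX hX]] := tot_ps hg hB.1 pX; have [H2' [b2 hH2]] := tot_ps hg hB.1 pH2.
have [H1' [b1 hH1]] := tot_ps hg hB.1 pH1.
have [pi0' [ep0' [c0' _]]] := r_contr1 hB.1 hX hH c0.
have [pi1' [ep1' [c1' _]]] := r_contr1 hB.1 hX hH1 c1.
have [pi2' [ep2' [c2' _]]] := r_contr1 hB.1 hX hH2 c2.
have E2 := sing i _ _ _ hH2 tH2 xi yi.
have E1 : mark H1' (s x) = mark H1' (s y).
  apply: (IH H1 H1' b1 c) => //; last 2 first.
  - by rewrite hc hi (negPf xq).
  - by rewrite hc hi (negPf yq).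
  apply: leq_trans hm; apply: proper_card; apply/properP; split.
    by apply/subsetP=> k; rewrite !inE hc hi => /andP[].
  by exists i; rewrite !inE ?hc ?hi !eqxx.
rewrite !(contr1_mark c0'); congr pi0'.
apply/eqP/negPn/negP=> ne.
move: E1 E2; rewrite !(contr1_mark c1') !(contr1_mark c2').
case/(contr1_eq c1')=> [E|[a1 a2]]; first by rewrite E eqxx in ne.
case/(contr1_eq c2')=> [E|[a3 a4]]; first by rewrite E eqxx in ne.
have [_ _ nH1'] := bi_cyc2 hB hH1 cH1.
have e12 : e2 != e1 by apply: contraTneq ue => ->; rewrite /= !inE eqxx /= andbF.
have nl e : e = e1 \/ e = e2 -> ~~ is_loop (bX e).
  rewrite (bi_loop hw hg hgn hB _ hX pX) => -[] ->.
    by have := (contr1_pure c1).1 pH1.2; case.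
  by have := (contr1_pure c2).1 pH2.2; case.
have [b' K1 K2] := r_bij hB.1 hX.
have bne : bX e2 != bX e1 by rewrite (inj_eq (can_inj K1)).
apply: (contr1_nopar c1' nH1' bne).
rewrite (nonloop_two (nl e1 _) a1 a2 ne); last by left.
by rewrite (nonloop_two (nl e2 _) a3 a4 ne) //; right.
Qed.

End GenusOne.

(** * Reconstruction with two vertices *)

Section TwoVertices.
Variables (g n : nat) (w : 'I_n -> rat).
Hypothesis hw : forall i, 0 < w i <= 1.
Hypotheses (hg : (1 <= g)%N) (hgn : (3 <= 2 * g - 2 + n)%N).
Implicit Types G H : mgraph n.
Notation ps := (ps g w).
Notation corr := (corr g w).
Notation bicorr := (bicorr g w).
Notation ctype := (ctype g w).
Notation mark_perm := (mark_perm g w).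

(** If i and j sat alone on different bare vertices, there would be no loops, so g = 1 and n is at
    least 3, and a third marking would have no vertex to sit on. *)
Lemma ctype_inj H i j : ctype H (pred1 i) -> ctype H (pred1 j) -> i = j.
Proof.
move=> [pH vH [e1 [e2 [ne nl]]] [c bc mc]] [_ _ _ [d bd md]].
have ic : mark H i = c by apply/eqP; rewrite mc /= eqxx.
have jd : mark H j = d by apply/eqP; rewrite md /= eqxx.
case: (eqVneq c d) => [E|cd]; first by apply/eqP; rewrite -[_ == _]md ic E.
have hE : #|edge H| = 2%N.
  have : [set e1; e2] = setT.
    apply/setP=> e; rewrite !inE -nl; apply/negP=> le.
    have /loopP[a ea] := le; have := bc _ le; have := bd _ le; rewrite ea !inE.
    by have [->|->] := vert2 a vH cd; rewrite eqxx.
  by move/(congr1 (fun A : {set _} => #|A|)); rewrite cardsT cards2 ne.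
have g1 : g = 1%N by have := ps_card pH; rewrite hE vH; lia.
have n3 : (3 <= n)%N by move: hgn; rewrite g1.
have [k [ki kj]] := third_mark n3 i j.
have [h|h] := vert2 (mark H k) vH cd.
  by have := mc k; rewrite h eqxx /= (negPf ki).
by have := md k; rewrite h eqxx /= (negPf kj).
Qed.

Lemma mark_perm_ex R : bicorr R -> exists s, mark_perm R s.
Proof.
move=> hB; have [g2|g1] := leqP 2 g; first exact: (mark_perm2 hw hg hgn g2 hB).
have E : g = 1%N by move: hg g1; lia.
move: hB hgn; rewrite E => hB hgn'; exact: (mark_perm1 hw hgn' hB).
Qed.

(** The inverse correspondence has some permutation of its own; following a digon to its image and
    back identifies it by [ctype_inj]. *)
Lemma mark_perm_inv R (s : {perm 'I_n}) : bicorr R -> mark_perm R s -> mark_perm (inv_rel R) (s^-1)%g.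
Proof.
move=> hB hs; have [s2 hs2] := mark_perm_ex (bicorr_inv hB).
suff -> : (s^-1)%g = s2 by [].
apply/permP=> i; rewrite -{2}(permKV s i); set j := (s^-1)%g i.
have hn : (0 < n)%N by case: (i) => k; lia.
have [||H tH] := @ctype_ex g n w hw hg hgn (pred1 j); first by exists j => /=.
  have [g2|g1] := leqP 2 g; [by left|right].
  have n3 : (3 <= n)%N by move: hg hgn g1; lia.
  by have [k [kj _]] := third_mark n3 j j; exists k.
have [pH _ _ _] := tH; have [H' [b hH]] := tot_ps hg hB.1 pH.
have [b' [hH' _ _]] := to_inv hB.1 hH.
exact: ctype_inj tH (hs2 _ _ _ _ hH' (hs _ _ _ _ hH tH)).
Qed.

Definition bridged G := exists b0 : edge G, forall e, ~~ is_loop e = (e == b0).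

(** Half of the agreement at the vertex of l0: nothing leaves it. The converse is the same property
    of the inverse correspondence ([loop_siso]). *)
Definition loop_ok (s : 'I_n -> 'I_n) G G' (b : edge G -> edge G') (l0 : edge G) :=
  (forall l, is_loop l -> ends l = ends l0 -> ends (b l) = ends (b l0)) /\
  (forall i, mark G i \in ends l0 -> mark G' (s i) \in ends (b l0)).

Section Rel.
Variables (R : edge_rel n) (s : {perm 'I_n}).
Arguments R : clear implicits.
Hypotheses (hB : bicorr R) (hs : mark_perm R s).

(** For the markings, l0 is opened with i on the new vertex. If s i missed the parallel pair in X',
    its vertex would be a leaf at the bridge and carry a second marking, but after contracting the
    bridge s i is alone on its vertex. *)
Lemma bridged_loop_ok G G' b l0 : R G G' b -> ps G -> #|vert G| = 2%N -> bridged G ->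
  is_loop l0 -> loop_ok s b l0.
Proof.
move=> hG pG vG [b0 nl] l0l; split.
  move=> l ll E; case: (eqVneq l l0) => [->//|ne].
  apply: (loops_together hw hg hgn hB hG pG) => //.
  have [n0|n0] := posnP n; [right|by left].
  (* Here n = 0, so g is at least 3 and there are at least four edges: one loop is left besides the
     bridge, l and l0. *)
  have : (0 < #|~: (b0 |: [set l; l0])|)%N.
    have := cardsC (b0 |: [set l; l0]); rewrite cardsU1 cards2.
    have g3 : (3 <= g)%N by move: hgn n0; lia.
    have := ps_card pG; rewrite vG; case: (_ \notin _); case: (_ != _); lia.
  case/card_gt0P=> l3; rewrite !inE !negb_or => /and3P[h1 h2 h3].
  by exists l3; split=> //; rewrite -[is_loop _]negbK nl.
move=> i hi.
have [X' [H1 [H1' [d1 [l2 [b1 [pi [ep [pi2 [ep2 [[pX vX] c1 c2 [tH1 hH1] [k1 k2 k3 k4]]]]]]]]]]]] :=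
  open_image hw hg hgn hB pG vG nl l0l hi hG.
have [_ _ _ [c' bc' mc']] := hs hH1 tH1.
rewrite k1 (contr1_mark c1); case: (boolP (mark X' (s i) \in ends l2)) => hr; first exact: imset_f.
exfalso; set r := mark X' (s i) in hr.
have rc : pi2 r = c' by rewrite -(contr1_mark c2); apply/eqP; rewrite mc' /= eqxx.
have [|j hj ji] := leaf_two hw (v := r) (e := b1) (s i) pX k2.
  move=> f rf; case: (boolP (is_loop f)) => lf; last exact: (k4 r).
  by case: (uncontracted_loop c2 k2 lf rf); rewrite rc.
by have := mc' j; rewrite (contr1_mark c2) hj rc eqxx /= (negPf ji).
Qed.

End Rel.

Lemma loop_siso R (s : {perm 'I_n}) G G' b b' l0 : bicorr R -> R G G' b -> ps G -> #|vert G| = 2%N ->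
  is_loop l0 -> cancel b b' -> cancel b' b ->
  loop_ok s b l0 -> loop_ok (s^-1)%g b' (b l0) ->
  exists fV, siso s b fV.
Proof.
move=> hB hG pG vG ll K1 K2 [h1 h2] [h3 h4].
have lp e : is_loop (b e) = is_loop e by exact: (bi_loop hw hg hgn hB _ hG pG).
have /loopP[c ec] := ll; have /loopP[c' ec'] : is_loop (b l0) by rewrite lp.
have vG' : #|vert G'| = 2%N by rewrite (bi_vcard hw hg hgn hB hG pG).
have [||fV h _] := @two_siso n s G G' b c c' vG vG' lp.
- move=> e le; have lbe : is_loop (b e) by rewrite lp.
  apply/idP/idP=> [/(loop_at lbe)|/(loop_at le)].
    by rewrite -ec' => /(h3 _ lbe); rewrite !K1 ec => ->; rewrite inE.
  by rewrite -ec => /(h1 _ le); rewrite ec' => ->; rewrite inE.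
- move=> i; apply/eqP/eqP=> [E|E].
    have := h4 (s i); rewrite ec' E inE eqxx permK K1 ec inE => /(_ isT); exact/eqP.
  have := h2 i; rewrite ec' ec E !inE eqxx => /(_ isT); exact/eqP.
by exists fV.
Qed.

Lemma bi_bridged R G G' b : bicorr R -> R G G' b -> ps G -> bridged G -> bridged G'.
Proof.
move=> hB hG pG [b0 h]; have [b' K1 K2] := r_bij hB.1 hG.
exists (b b0) => e; rewrite -(K2 e) (bi_loop hw hg hgn hB _ hG pG) h.
by rewrite (inj_eq (can_inj K1)).
Qed.

Lemma bridged_siso R (s : {perm 'I_n}) G G' b : bicorr R -> mark_perm R s -> R G G' b -> ps G ->
  #|vert G| = 2%N -> bridged G -> exists fV, siso s b fV.
Proof.
move=> hB hs hG pG vG hb; have [b' [hG' K1 K2]] := to_inv hB.1 hG.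
have [b0 nl] := hb.
have [l0 l0b] : exists l0, l0 != b0.
  have : (0 < #|predC1 b0|)%N by rewrite cardC1; have := ps_card pG; rewrite vG; move: hg; lia.
  by case/card_gt0P=> l0 h; exists l0.
have ll : is_loop l0 by rewrite -[is_loop _]negbK nl.
have pG' := bi_ps hw hg hgn hB hG pG.
apply: (loop_siso hB hG pG vG ll K1 K2).
  exact: (bridged_loop_ok hB hs hG pG vG hb ll).
apply: (bridged_loop_ok (bicorr_inv hB) (mark_perm_inv hB hs) hG' pG').
- by rewrite (bi_vcard hw hg hgn hB hG pG).
- exact: bi_bridged hB hG pG hb.
by rewrite (bi_loop hw hg hgn hB _ hG pG).
Qed.

Lemma two_full G (e : edge G) x : #|vert G| = 2%N -> ~~ is_loop e -> x \in ends e.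
Proof.
move=> hV; rewrite nonloopE => /eqP h.
suff -> : ends e = setT by rewrite inE.
by apply/eqP; rewrite eqEcard subsetT cardsT hV h.
Qed.

Lemma two_parallel G (e f : edge G) : #|vert G| = 2%N -> ~~ is_loop e -> ~~ is_loop f ->
  ends e = ends f.
Proof. by move=> hV he hf; apply/setP=> x; rewrite !two_full. Qed.

(* Items at p stay together in the image: contracting k cannot have brought     *)
(* them together, since k2, which is parallel to k, becomes a loop elsewhere.   *)
Lemma image_together X X' (cX : edge X -> edge X') H H' (cH : edge H -> edge H')
    (k : edge X) pi ep pi' ep' fV (p q : vert X) k2 :
  @contr1 n X H k pi ep -> @contr1 n X' H' (cX k) pi' ep' ->
  (forall f, ep' (cH f) = cX (ep f)) ->
  (forall e, ends (cH e) = fV @: ends e) -> injective fV ->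
  p \notin ends k -> q \in ends k -> ends k2 = [set pi q] ->
  ~~ is_loop (cX (ep k2)) ->
  forall x y, pi' x = fV (pi p) -> pi' y = fV (pi p) -> x = y.
Proof.
move=> c1 c1' hep hf inj pk qk e2 nl x y hx hy.
have lk2 : is_loop (cH k2) by apply/loopP; exists (fV (pi q)); rewrite hf e2 imset_set1.
have [|par] := (contr1_loop_iff c1' (cH k2)).1 lk2; first by rewrite hep (negPf nl).
have pq : fV (pi q) != fV (pi p) by rewrite (inj_eq inj) (contr1_out _ c1) //; apply: contraNneq pk => <-.
have out : x \notin ends (cX k).
  apply: contra pq => xk; rewrite -hx; have : pi' x \in ends (cH k2).
    by rewrite (contr1_ends c1') par imset_f.
  by rewrite hf e2 imset_set1 inE eq_sym.
by apply/esym/eqP; rewrite -(contr1_out _ c1' out) hx hy.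
Qed.

(** The loops and markings at u move to a new vertex, joined to u by a single edge. Contracting k
    turns its parallels into loops and leaves a bridged graph, where [bridged_siso] applies;
    [image_together] lifts the conclusion to X', and it descends to G'. *)
Lemma multi_loop_ok R (s : {perm 'I_n}) G G' b (l0 : edge G) : bicorr R -> mark_perm R s ->
  R G G' b -> ps G -> #|vert G| = 2%N -> ~ bridged G -> is_loop l0 -> loop_ok s b l0.
Proof.
move=> hB hs hG pG vG nb ll; have /loopP[u eu] := ll.
have [k nk _] := @two_nonloop n G u (ps_connected pG) (eq_leq (esym vG)).
have [k2 nk2 k2k] : exists2 k2, ~~ is_loop k2 & k2 != k.
  apply: contrapT => h; apply: nb; exists k => e; apply/idP/eqP=> [ne|-> //].
  by apply: contrapT => /eqP ek; apply: h; exists e.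
pose md (e : edge G) := if is_loop e then Move else Keep.
pose X := expand u md predT.
have hN : ends (None : edge X) = [set None; Some u] by [].
have hl e : is_loop e -> u \in ends e -> ends (Some e : edge X) = [set None].
  by move=> le ue; apply: expand_move_loop; rewrite // /md le.
have hnl e : ~~ is_loop e -> ends (Some e : edge X) = Some @: ends e.
  by move=> ne; apply: expand_keep; rewrite /md (negPf ne).
have hm i : mark X i = if mark G i == u then None else Some (mark G i).
  by rewrite /=; case: eqP.
have hp : pure X by apply: expand_pure pG.
have kk e : ~~ is_loop e -> Some u \in ends (Some e : edge X).
  by move=> ne; rewrite hnl // imset_f // two_full.
have pX : ps X.
  apply: expand_ps => //.
    apply: (@vstable_loop _ _ hw X None hp (Some l0) None) => //.
    - by rewrite /is_loop hl ?cards1 // eu inE.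
    - by rewrite hl ?inE // eu inE.
    - by rewrite hN !inE.
  apply: (@vstable_three _ _ hw X (Some u) hp None (Some k) (Some k2)) => //.
  - by rewrite hN !inE eqxx.
  - exact: kk.
  - exact: kk.
  - by rewrite (inj_eq (@Some_inj _)) eq_sym.
have nS (A : {set vert G}) : None \in Some @: A = false by apply/negP=> /imsetP[].
have nX e : ~~ is_loop e -> ~~ @is_loop n X (Some e).
  by move=> ne; rewrite nonloopE hnl // card_imset; [rewrite -nonloopE|apply: Some_inj].
have lX e : is_loop e -> @is_loop n X (Some e).
  move=> le; case: (boolP (u \in ends e)) => ue; first by rewrite /is_loop hl ?cards1.
  by rewrite /is_loop expand_out // card_imset //; apply: Some_inj.
have hc := contract_contr1 (Some k : edge X).
have pH := contr1_ps_down hc pX (nX _ nk).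
have vX : #|vert X| = 3%N by rewrite card_option vG.
have vH : #|vert (contract (Some k : edge X))| = 2%N.
  by have := contr1_vcard hc pX pH; rewrite vX => -[].
set H := contract (Some k : edge X) in hc pH vH.
have NN : (None : vert X) \notin ends (Some k : edge X) by rewrite hnl // nS.
have loopk (x : edge X) : x != None -> is_loop x \/ ends x = ends (Some k : edge X).
  case: x => [e|] // _; case: (boolP (is_loop e)) => le; [left|right]; first exact: lX.
  by rewrite !hnl // (two_parallel vG le nk).
have bH : bridged H.
  exists (exist _ None isT) => f; rewrite -val_eqE /=; apply/idP/eqP=> [|E].
    apply: contraNeq => fN; apply/(contr1_loop_iff hc).
    exact: loopk fN.
  apply/negP=> /(contr1_loop_iff hc); rewrite [val f]E => -[|/setP/(_ None)].
    by rewrite /is_loop hN cards2.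
  by rewrite hN !inE eqxx (negPf NN).
have [X' [cX hX]] := tot_ps hg hB.1 pX; have [H' [cH hH]] := tot_ps hg hB.1 pH.
have [fV [fVb fVe fVm]] := bridged_siso hB hs hH pH vH bH.
have [pi0 [ep0 [c0 q0]]] := r_contr1 hB.1 hX hG (expand_contr u md predT).
have [pi1 [ep1 [c1 q1]]] := r_contr1 hB.1 hX hH hc.
have lpX e : is_loop (cX e) = is_loop e by exact: (bi_loop hw hg hgn hB _ hX pX).
have k2s : Some k2 != Some k :> edge X by rewrite (inj_eq (@Some_inj _)).
pose p1 := cproj (Some k : edge X); pose fk2 : edge H := exist _ (Some k2) k2s.
have together : forall x y, pi1 x = fV (p1 None) -> pi1 y = fV (p1 None) -> x = y.
  apply: (image_together (X := X) (k2 := fk2) (q := Some u) hc c1 q1 fVe (bij_inj fVb) NN).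
  - exact: kk.
  - rewrite (contr1_ends hc) (_ : val fk2 = Some k2 :> edge X) // (hnl k2 nk2) (two_parallel vG nk2 nk) -hnl //.
    apply/setP=> y; rewrite inE; apply/imsetP/eqP=> [[z hz ->]|->]; last by exists (Some u); rewrite ?kk.
    by apply/(contr1_eq hc); right; split=> //; apply: kk.
  - by rewrite lpX nX.
have at_u l : is_loop l -> u \in ends l -> exists2 x, ends (cX (Some l)) = [set x] & pi1 x = fV (p1 None).
  move=> lp ul; have /loopP[x ex] : is_loop (cX (Some l)) by rewrite lpX lX.
  exists x => //; have lk : Some l != Some k :> edge X.
    by rewrite (inj_eq (@Some_inj _)); apply: contraTneq lp => ->.
  pose fl : edge H := exist _ (Some l) lk.
  apply: set1_inj; rewrite -imset_set1 -ex -[in LHS](q1 fl) -(contr1_ends c1) fVe.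
  by rewrite (contr1_ends hc) (_ : val fl = Some l :> edge X) // hl // !imset_set1.
have ul0 : u \in ends l0 by rewrite eu inE.
have [x0 ex0 px0] := at_u l0 ll ul0.
split=> [l lp E|i hi].
  have [|x ex px] := at_u l lp; first by rewrite E.
  rewrite !(contr1_ends c0) !q0 ex ex0; congr (_ @: [set _]); exact: together.
rewrite (contr1_ends c0) q0 (contr1_mark c0); apply: imset_f.
rewrite ex0 inE; apply/eqP/together => //.
rewrite -(contr1_mark c1) fVm (contr1_mark hc) hm.
by move: hi; rewrite eu inE => ->.
Qed.

Lemma bi_bridged_iff R G G' b : bicorr R -> R G G' b -> ps G -> bridged G' -> bridged G.
Proof.
move=> hB hG pG hb; have [b' [hG' _ _]] := to_inv hB.1 hG.
exact: bi_bridged (bicorr_inv hB) hG' (bi_ps hw hg hgn hB hG pG) hb.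
Qed.

Lemma loopy_siso R (s : {perm 'I_n}) G G' b (l0 : edge G) : bicorr R -> mark_perm R s ->
  R G G' b -> ps G -> #|vert G| = 2%N -> is_loop l0 -> exists fV, siso s b fV.
Proof.
move=> hB hs hG pG vG ll.
case: (pselect (bridged G)) => hb; first exact: bridged_siso hB hs hG pG vG hb.
have [b' [hG' K1 K2]] := to_inv hB.1 hG.
have pG' := bi_ps hw hg hgn hB hG pG.
apply: (loop_siso hB hG pG vG ll K1 K2); first exact: (multi_loop_ok hB hs hG pG vG hb ll).
apply: (multi_loop_ok (bicorr_inv hB) (mark_perm_inv hB hs) hG' pG').
- by rewrite (bi_vcard hw hg hgn hB hG pG).
- by move=> h; apply: hb; apply: bi_bridged_iff hB hG pG h.
by rewrite (bi_loop hw hg hgn hB _ hG pG).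
Qed.

(** For g = 1 this is [cyc2_marks]. For larger g there are three parallel edges f, k, k2: f and all
    markings at u move to a new vertex, and contracting k makes k2 a loop, so that [loopy_siso]
    applies. *)
Lemma loopless_marks R (s : {perm 'I_n}) G G' b i j : bicorr R -> mark_perm R s ->
  R G G' b -> ps G -> #|vert G| = 2%N -> noloop G ->
  mark G i = mark G j -> mark G' (s i) = mark G' (s j).
Proof.
move=> hB hs hG pG vG nl Eij.
have [g2|g1] := leqP 2 g; last first.
  have E1 : g = 1%N by move: hg g1; lia.
  have n3 : (3 <= n)%N by move: hgn g1; lia.
  have [q qi] := other2 (mark G i) vG.
  move: pG hB hs; rewrite E1 => pG' hB' hs'.
  apply: (cyc2_marks hw n3 (q := q) hB' hs' hG); first by split.
    by rewrite eq_sym.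
  by rewrite -Eij eq_sym.
set u := mark G i.
have [f [k [k2 [fk fk2' kk2]]]] : exists f k k2 : edge G, [/\ f != k, f != k2 & k != k2].
  have hE : (2 < #|edge G|)%N by have := ps_card pG; rewrite vG; lia.
  have /card_gt2P[f [k [k2 [_ [h1 h2 h3]]]]] : (2 < #|[set: edge G]|)%N by rewrite cardsT.
  by exists f, k, k2; split=> //; rewrite eq_sym.
pose md e := if e == f then Move else Keep.
pose X := expand u md predT.
have full (e : edge G) x : x \in ends e by apply: two_full.
have [v vu] := other2 u vG.
have ef : ends f = [set u; v] by apply: nonloop_two => //; rewrite eq_sym.
have hN : ends (None : edge X) = [set None; Some u] by [].
have hf : ends (Some f : edge X) = [set None; Some v].
  rewrite expand_move ?full // /md ?eqxx // ef setU1K ?imset_set1 //.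
  by rewrite inE eq_sym.
have hk e : e != f -> ends (Some e : edge X) = Some @: ends e.
  by move=> ne; apply: expand_keep; rewrite /md (negPf ne).
have kf : k != f by rewrite eq_sym.
have k2f : k2 != f by rewrite eq_sym.
have hm l : mark X l = if mark G l == u then None else Some (mark G l).
  by rewrite /=; case: eqP.
have hp : pure X by apply: expand_pure pG.
have uk e : e != f -> Some u \in ends (Some e : edge X).
  by move=> ne; rewrite hk // imset_f.
have pX : ps X.
  apply: expand_ps => //.
    apply: (@vstable_marked _ _ hw X None hp None (Some f) i) => //.
    - by rewrite hN !inE.
    - by rewrite hf !inE.
    - by rewrite hm eqxx.
  apply: (@vstable_three _ _ hw X (Some u) hp None (Some k) (Some k2)) => //.
  - by rewrite hN !inE eqxx.
  - exact: uk.
  - exact: uk.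
have nS (A : {set vert G}) : None \in Some @: A = false by apply/negP=> /imsetP[].
have nX e : e != f -> ~~ @is_loop n X (Some e).
  by move=> ne; rewrite nonloopE hk // card_imset; [rewrite -nonloopE|apply: Some_inj].
have hc := contract_contr1 (Some k : edge X).
have pH := contr1_ps_down hc pX (nX _ kf).
have vX : #|vert X| = 3%N by rewrite card_option vG.
have vH : #|vert (contract (Some k : edge X))| = 2%N.
  by have := contr1_vcard hc pX pH; rewrite vX => -[].
set H := contract (Some k : edge X) in hc pH vH.
have NN : (None : vert X) \notin ends (Some k : edge X) by rewrite hk // nS.
have k2s : Some k2 != Some k :> edge X by rewrite (inj_eq (@Some_inj _)) eq_sym.
pose p1 := cproj (Some k : edge X); pose fk2 : edge H := exist _ (Some k2) k2s.
have ek2 : ends fk2 = [set p1 (Some u)].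
  rewrite (contr1_ends hc) (_ : val fk2 = Some k2 :> edge X) // (hk k2 k2f).
  rewrite (two_parallel vG (nl k2) (nl k)) -hk //.
  apply/setP=> y; rewrite inE; apply/imsetP/eqP=> [[z hz ->]|->]; last by exists (Some u); rewrite ?uk.
  by apply/(contr1_eq hc); right; split=> //; apply: uk.
have lk2 : is_loop fk2 by apply/loopP; exists (p1 (Some u)).
have [X' [cX hX]] := tot_ps hg hB.1 pX; have [H' [cH hH]] := tot_ps hg hB.1 pH.
have [fV [fVb fVe fVm]] := loopy_siso hB hs hH pH vH lk2.
have [pi0 [ep0 [c0 q0]]] := r_contr1 hB.1 hX hG (expand_contr u md predT).
have [pi1 [ep1 [c1 q1]]] := r_contr1 hB.1 hX hH hc.
rewrite !(contr1_mark c0); congr pi0.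
have at_u l : mark G l = u -> pi1 (mark X' (s l)) = fV (p1 None).
  by move=> hl; rewrite -(contr1_mark c1) fVm (contr1_mark hc) hm hl eqxx.
apply: (image_together (X := X) (k2 := fk2) (q := Some u) hc c1 q1 fVe (bij_inj fVb) NN).
- exact: uk.
- exact: ek2.
- by rewrite (bi_loop hw hg hgn hB _ hX pX) nX.
- exact: at_u.
- by apply: at_u; rewrite -Eij.
Qed.

Theorem two_vertex_siso R (s : {perm 'I_n}) G G' b : bicorr R -> mark_perm R s ->
  R G G' b -> ps G -> #|vert G| = 2%N -> exists fV, siso s b fV.
Proof.
move=> hB hs hG pG vG.
case: (pickP (@is_loop n G)) => [l0 ll|nl]; first exact: loopy_siso hB hs hG pG vG ll.
have lp e : is_loop (b e) = is_loop e by exact: (bi_loop hw hg hgn hB _ hG pG).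
have vG' : #|vert G'| = 2%N by rewrite (bi_vcard hw hg hgn hB hG pG).
have noG : noloop G by move=> e; rewrite nl.
have [b' [hG' K1 K2]] := to_inv hB.1 hG.
have noG' : noloop G' by move=> e; rewrite -(K2 e) lp nl.
have pG' := bi_ps hw hg hgn hB hG pG.
have [c [c' hcc]] : exists (c : vert G) (c' : vert G'),
    forall i, (mark G' (s i) == c') = (mark G i == c).
  have [n0|n0] := posnP n.
    have /card_gt0P[c _] : (0 < #|vert G|)%N by rewrite vG.
    have /card_gt0P[c' _] : (0 < #|vert G'|)%N by rewrite vG'.
    by exists c, c' => i; have := ltn_ord i; move: n0; lia.
  (* The vertices of one marking are matched; [loopless_marks] for R and for its inverse shows that
     the same markings share them. *)
  pose i0 := Ordinal n0; exists (mark G i0), (mark G' (s i0)) => i.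
  apply/eqP/eqP=> E; last exact: (loopless_marks hB hs hG pG vG noG).
  rewrite -(permK s i) -(permK s i0).
  exact: (loopless_marks (bicorr_inv hB) (mark_perm_inv hB hs) hG' pG' vG' noG').
have [||fV h _] := @two_siso n s G G' b c c' vG vG' lp; last by exists fV.
  by move=> e; rewrite nl.
exact: hcc.
Qed.

End TwoVertices.

(** * Reconstruction with at least three vertices *)

Definition meets (T : finType) (A B : {set T}) := exists2 v, v \in A & v \in B.

Lemma meets_imset (T U : finType) (p : T -> U) (E A B : {set T}) :
  (forall x y, p x = p y <-> x = y \/ (x \in E /\ y \in E)) ->
  meets (p @: A) (p @: B) <-> meets A B \/ (meets A E /\ meets E B).
Proof.
move=> hp; split.
  case=> v /imsetP[x xA ->] /imsetP[y yB] /hp[E1|[xE yE]].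
    by left; exists x => //; rewrite E1.
  by right; split; [exists x|exists y].
case=> [[v vA vB]|[[x xA xE] [y yE yB]]]; first by exists (p v); rewrite imset_f.
exists (p x); first exact: imset_f.
by apply/imsetP; exists y => //; apply/hp; right.
Qed.

(* Among the pairs C that meet both A and B, those through the common point v  *)
(* of A and B are told apart from the third side of a triangle by collapsing A.*)
Lemma star_mem (T U : finType) (p : T -> U) (A B C : {set T}) v :
  #|A| = 2%N -> #|B| = 2%N -> #|C| = 2%N -> v \in A -> v \in B -> A <> B ->
  (forall x y, p x = p y <-> x = y \/ (x \in A /\ y \in A)) ->
  v \in C <-> [/\ meets C A, meets C B & B = C \/ p @: B <> p @: C].
Proof.
have pair (X : {set T}) x : #|X| = 2%N -> x \in X -> exists2 y, y != x & X = [set x; y].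
  move=> /eqP/cards2P[y [z [yz ->]]]; rewrite !inE => /orP[] /eqP ->.
    by exists z; rewrite // eq_sym.
  by exists y; rewrite // setUC.
move=> cA cB cC vA vB AB hp.
have [a av eA] := pair A v cA vA; have [c cv eB] := pair B v cB vB.
have cA' : c \notin A.
  by rewrite eA !inE negb_or cv; apply/eqP=> E; apply: AB; rewrite eA eB E.
split=> [vC|[[x xC xA] [y yC yB] h]].
  split; [by exists v|by exists v|].
  have [d dv eC] := pair C v cC vC.
  case: (eqVneq c d) => [E|cd]; first by left; rewrite eB eC E.
  right=> /setP/(_ (p c)).
  rewrite eB eC !imsetU1 !imset_set1 !inE eqxx orbT => /esym/orP[] /eqP /hp[E|[h _]].
  - by rewrite E eqxx in cv.
  - by rewrite h in cA'.
  - by rewrite E eqxx in cd.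
  - by rewrite h in cA'.
apply/negPn/negP=> vC.
have aC : a \in C.
  by move: xA xC; rewrite eA !inE => /orP[] /eqP -> // h'; rewrite h' in vC.
have cC' : c \in C.
  by move: yB yC; rewrite eB !inE => /orP[] /eqP -> // h'; rewrite h' in vC.
have ac : a != c by apply: contraNneq cA' => <-; rewrite eA !inE eqxx orbT.
have eC : C = [set a; c].
  have [d da E] := pair C a cC aC; move: cC'; rewrite E !inE eq_sym (negPf ac) /=.
  by move=> /eqP ->.
case: h => [E|]; first by rewrite -E vB in vC.
apply; rewrite eB eC !imsetU1 !imset_set1 (_ : p v = p a) //.
by apply/hp; right; rewrite eA !inE !eqxx orbT.
Qed.

Section Many.
Variables (g n : nat) (w : 'I_n -> rat).
Implicit Types G H : mgraph n.
Notation ps := (ps g w).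

Definition item_map (s : 'I_n -> 'I_n) G G' (b : edge G -> edge G') (o : item G) : item G' :=
  match o with inl e => inl (b e) | inr i => inr (s i) end.

Definition single G (o : item G) := #|spot o| == 1%N.

Lemma spot_ex G (o : item G) : exists v, v \in spot o.
Proof.
case: o => [e|i] /=; first exact: ends_ex.
by exists (mark G i); rewrite inE.
Qed.

Lemma spot_in1 G (o : item G) v : v \in spot o -> single o -> spot o = [set v].
Proof. by move=> h /cards1P[x ox]; move: h; rewrite ox inE => /eqP ->. Qed.

Lemma val_three_single G (v : vert G) : ps G ->
  (forall o : item G, single o -> v \notin spot o) ->
  forall e1 e2, exists e3, [/\ v \in ends e3, e3 != e1, e3 != e2 & ~~ is_loop e3].
Proof.
move=> pG hv e1 e2.
have hl (e : edge G) : v \in ends e -> ~~ is_loop e.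
  by apply: contraL => le; apply: (hv (inl e)).
have hm i : mark G i != v.
  by have := hv (inr i); rewrite /single /= cards1 inE eq_sym => /(_ isT).
have [e3 [h1 h2 h3]] := val_three pG.1 (pG.2 v) hl hm e1 e2.
by exists e3; split=> //; apply: hl.
Qed.

(* The last hypothesis says that an edge could be inserted at z or at x with   *)
(* the same incidences in all further contractions; it leaves no room for the  *)
(* edges at a third vertex t.                                                  *)
Lemma star_false H (z x t : vert H) (f : edge H) : ps H -> z != x -> t != z -> t != x ->
  ends f = [set z; t] ->
  (forall (f : edge H) (o : item H), ~~ is_loop f -> o != inl f ->
     (z \in spot o \/ (z \in ends f /\ meets (ends f) (spot o))) <->
     (x \in spot o \/ (x \in ends f /\ meets (ends f) (spot o)))) -> False.
Proof.
move=> pH zx tz tx ef star.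
have nf : ~~ is_loop f by apply/nonloopP; exists z, t; rewrite eq_sym.
have A (o : item H) : o != inl f -> t \in spot o -> x \in spot o.
  move=> of_ to; have [|//|[]] := (star f o nf of_).1.
    right; split; first by rewrite ef !inE eqxx.
    by exists t; rewrite // ef !inE eqxx orbT.
  by rewrite ef !inE eq_sym (negPf zx) eq_sym (negPf tx).
have bt (o : item H) : single o -> t \notin spot o.
  move=> so; apply/negP=> to; have ot := spot_in1 to so.
  have of_ : o != inl f.
    by apply: contraTneq so => ->; rewrite /single /= -/(is_loop f) (negPf nf).
  by have := A o of_ to; rewrite ot inE eq_sym (negPf tx).
have [f2 [tf2 f2f _ n2]] := val_three_single pH bt f f.
have [f3 [tf3 f3f f32 n3]] := val_three_single pH bt f f2.
have inlI (a b : edge H) : (inl a != inl b :> item H) = (a != b) by [].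
have xf2 : x \in ends f2 by apply: (A (inl f2)); rewrite ?inlI.
have xf3 : x \in ends f3 by apply: (A (inl f3)); rewrite ?inlI.
have zf k : ~~ is_loop k -> t \in ends k -> x \in ends k -> z \notin ends k.
  move=> nk tk xk; rewrite (nonloop_two nk tk xk tx) !inE negb_or zx andbT.
  by rewrite eq_sym.
case: ((star f2 (inl f3) n2 f32).2 (or_introl xf3)) => [h|[h _]].
  by move: (zf f3 n3 tf3 xf3); rewrite h.
by move: (zf f2 n2 tf2 xf2); rewrite h.
Qed.

(** * Recovering a graph from its one-edge contractions *)

Section Quot.
Variables (s : 'I_n -> 'I_n) (G G' : mgraph n) (b : edge G -> edge G').

(* A contraction of G' by b e, with vertices named by those of G / e.          *)
Definition quot (e : edge G) (P : vert G' -> vert (contract e)) :=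
  [/\ forall y, exists x, P x = y,
     forall x y, P x = P y <-> x = y \/ (x \in ends (b e) /\ y \in ends (b e))
   & forall o, o != inl e -> P @: spot (item_map s b o) = cproj e @: spot o].

Lemma cproj_eq (e : edge G) x y :
  cproj e x = cproj e y <-> x = y \/ (x \in ends e /\ y \in ends e).
Proof. exact: (contr1_eq (contract_contr1 e)). Qed.

Lemma cproj_nonloop (e f : edge G) : ~~ is_loop e -> ~~ is_loop f ->
  (#|cproj e @: ends f| == 1%N) = (ends f == ends e).
Proof.
move=> ne nf; apply/cards1P/eqP=> [[z hz]|E].
  have [x [y [xy ef]]] := nonloopP _ nf.
  have : cproj e x = cproj e y.
    have : cproj e x \in [set z] /\ cproj e y \in [set z] by rewrite -hz !imset_f // ef !inE eqxx ?orbT.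
    by rewrite !inE => -[/eqP -> /eqP ->].
  case/cproj_eq=> [h|[hx hy]]; first by rewrite h eqxx in xy.
  by rewrite ef (nonloop_two ne hx hy xy).
have [v hv] := ends_ex e; exists (cproj e v); rewrite E.
apply/setP=> y; rewrite inE; apply/imsetP/eqP=> [[u hu ->]|->]; last by exists v.
by apply/cproj_eq; right.
Qed.

Lemma quot_nonloop e (P : vert G' -> vert (contract e)) f : quot P -> ~~ is_loop (b e) -> ~~ is_loop (b f) ->
  (#|P @: ends (b f)| == 1%N) = (ends (b f) == ends (b e)).
Proof.
case=> _ hP _ ne nf; apply/cards1P/eqP=> [[z hz]|E].
  have [x [y [xy ef]]] := nonloopP _ nf.
  have : P x = P y.
    have : P x \in [set z] /\ P y \in [set z] by rewrite -hz !imset_f // ef !inE eqxx ?orbT.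
    by rewrite !inE => -[/eqP -> /eqP ->].
  case/hP=> [h|[hx hy]]; first by rewrite h eqxx in xy.
  by rewrite ef (nonloop_two ne hx hy xy).
have [v hv] := ends_ex (b e); exists (P v); rewrite E.
apply/setP=> y; rewrite inE; apply/imsetP/eqP=> [[u hu ->]|->]; last by exists v.
by apply/hP; right.
Qed.

Hypotheses (pG : ps G) (pG' : ps G') (vG' : #|vert G'| = #|vert G|).
Hypotheses (bb : bijective b) (lp : forall e, is_loop (b e) = is_loop e).
(** Supplied by the induction on vertices. What it leaves open is whether P sends the merged vertex
    of G' to the merged vertex of G / e. *)
Hypothesis quotE : forall e, ~~ is_loop e -> exists P : vert G' -> vert (contract e), quot P.

Lemma par_iff e f : ~~ is_loop e -> ~~ is_loop f ->
  (ends (b f) == ends (b e)) = (ends f == ends e).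
Proof.
move=> ne nf; have [P hP] := quotE ne.
case: (eqVneq f e) => [->|fe]; first by rewrite !eqxx.
rewrite -(quot_nonloop hP) ?lp // -cproj_nonloop //.
by have [_ _ h] := hP; rewrite -(h (inl f)).
Qed.

Definition touch (e : edge G) (o : item G) := meets (ends e) (spot o).
Definition touch' (e : edge G) (o : item G) := meets (ends (b e)) (spot (item_map s b o)).

(** This turns incidence with e into incidence with the merged vertex, so incidence is preserved as
    soon as P respects merged vertices. *)
Lemma merged_in e v (o : item G) : v \in ends e ->
  cproj e v \in cproj e @: spot o <-> touch e o.
Proof.
move=> ve; split=> [/imsetP[x xo] /cproj_eq[E|[_ xe]]|[x xe xo]].
- by exists v; rewrite // E.
- by exists x.
by apply/imsetP; exists x => //; apply/cproj_eq; right.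
Qed.

Lemma merged_in' e (P : vert G' -> vert (contract e)) v (o : item G) : quot P -> v \in ends (b e) -> o != inl e ->
  P v \in cproj e @: spot o <-> touch' e o.
Proof.
case=> _ hP ho ve oe; rewrite -ho //; split=> [/imsetP[x xo] /hP[E|[_ xe]]|[x xe xo]].
- by exists v; rewrite // E.
- by exists x.
by apply/imsetP; exists x => //; apply/hP; right.
Qed.

(** After contracting f, e and o meet if they met before or both meet f, and this can be seen in the
    contraction, which G and G' share. *)
Lemma touch_quot e f o : ~~ is_loop f -> e != f -> o != inl f ->
  (touch e o \/ (touch e (inl f) /\ touch f o)) <->
  (touch' e o \/ (touch' e (inl f) /\ touch' f o)).
Proof.
move=> nf ef of_; have [P [_ hP ho]] := quotE nf.
have h1 := meets_imset (ends e) (spot o) (cproj_eq f).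
have h2 := meets_imset (ends (b e)) (spot (item_map s b o)) hP.
have E : meets (cproj f @: ends e) (cproj f @: spot o) <->
    meets (P @: ends (b e)) (P @: spot (item_map s b o)) by rewrite (ho o of_) (ho (inl e)).
by rewrite /touch /touch'; tauto.
Qed.

(** Let z be the merged vertex of G / e and x the name of the merged vertex of G'. If they differed,
    both would fit all further contractions equally well by [touch_quot]. With four vertices in G
    there is a third vertex in G / e, and an edge from it to z or x contradicts [star_false]. *)
Lemma touch4 e o : (4 <= #|vert G|)%N -> ~~ is_loop e -> o != inl e ->
  touch e o <-> touch' e o.
Proof.
move=> v4 ne oe; have [P hP] := quotE ne.
have [v ve] := ends_ex e; have [v' ve'] := ends_ex (b e).
have [E|zx] := eqVneq (cproj e v) (P v').
  by rewrite -(merged_in o ve) E (merged_in' hP ve' oe).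
exfalso; set z := cproj e v in zx; set x := P v' in zx; clear o oe.
have hc := contract_contr1 e; have pH := contr1_ps_down hc pG ne.
have nH (f : edge (contract e)) : ~~ is_loop f -> ~~ is_loop (val f).
  by apply: contra; apply: (contr1_loop hc).
have star (f : edge (contract e)) (o : item (contract e)) : ~~ is_loop f -> o != inl f ->
     (z \in spot o \/ (z \in ends f /\ meets (ends f) (spot o))) <->
     (x \in spot o \/ (x \in ends f /\ meets (ends f) (spot o))).
  move=> nf of_; have fe : val f != e := valP f.
  pose o1 : item G := @iep n G (contract e) val o.
  have o1e : o1 != inl e.
    by rewrite /o1; case: (o) => [h|i] //=; apply: (valP h).
  have o1f : o1 != inl (val f).
    by rewrite /o1; move: of_; case: (o) => [h|i].
  rewrite (contr1_spot hc o) (contr1_ends hc f) -/o1.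
  have a1 := merged_in o1 ve; have a2 := merged_in (inl (val f)) ve.
  have a3 := merged_in' hP ve' o1e; have a4 := merged_in' (o := inl (val f)) hP ve' fe.
  have a5 := meets_imset (ends (val f)) (spot o1) (cproj_eq e).
  have [_ hP2 ho] := hP.
  have a6 := meets_imset (ends (b (val f))) (spot (item_map s b o1)) hP2.
  rewrite (ho o1 o1e) (ho (inl (val f)) fe) in a6.
  have a7 := touch_quot (nH _ nf) (e := e) (o := o1) _ o1f.
  have {}a7 := a7 (contra_neq (fun h => esym h) fe).
  have mC (p q : edge G) : touch p (inl q) <-> touch q (inl p) by split=> -[y h1 h2]; exists y.
  have mC' (p q : edge G) : touch' p (inl q) <-> touch' q (inl p) by split=> -[y h1 h2]; exists y.
  have := mC e (val f); have := mC' e (val f).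
  move: a1 a2 a3 a4 a5 a6 a7; rewrite /touch /touch' /= -/z -/x; tauto.
have vH : (3 <= #|vert (contract e)|)%N.
  by have := ps_card pG; have := ps_card pH; have := contr1_card hc; lia.
have [||f [p [q [pA qA ef]]]] := cut_edge (G := contract e) (A := [set z; x]) (ps_connected pH).
- by apply/set0Pn; exists z; rewrite !inE eqxx.
- by apply: contraTneq vH => E; rewrite -cardsT -E cards2 zx.
move: qA; rewrite !inE negb_or => /andP[qz qx].
move: pA; rewrite !inE => /orP[] /eqP pE; rewrite pE in ef.
  exact: (star_false (H := contract e) pH zx qz qx ef star).
apply: (star_false (H := contract e) pH _ qx qz ef) => [|f' o' nf' of']; first by rewrite eq_sym.
by apply: iff_sym; apply: star.
Qed.

Lemma item_map_single o : single (item_map s b o) = single o.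
Proof. by case: o => [e|i]; rewrite /single /= ?cards1 //; apply: lp. Qed.

(** Two non-loops on three vertices always meet, so only loops and markings matter. If the merged
    vertices had different names, those at the vertex c off e would land on ends of b e, and the
    others on the vertex c' off b e ([T1], [T2]). Contracting two further edges then shows that no
    loop or marking can sit anywhere. *)
Lemma touch3 e o : #|vert G| = 3%N -> ~~ is_loop e -> o != inl e ->
  touch e o <-> touch' e o.
Proof.
move=> v3 ne oe.
have v3' : #|vert G'| = 3%N by rewrite vG'.
case: (boolP (single o)) => [so|]; last first.
  case: o oe => [f|i] oe; last by rewrite /single /= cards1.
  move=> nf.
  have mt (X : mgraph n) (h k : edge X) : #|vert X| = 3%N -> ~~ is_loop h -> ~~ is_loop k ->
      meets (ends h) (ends k).
    move=> vX nh nk; have : (0 < #|ends h :&: ends k|)%N.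
      have := cardsUI (ends h) (ends k); move: nh nk; rewrite !nonloopE => /eqP -> /eqP ->.
      by have := subset_leq_card (subsetT (ends h :|: ends k)); rewrite cardsT vX; lia.
    by case/card_gt0P=> x; rewrite inE => /andP[]; exists x.
  by split=> _; apply: mt; rewrite ?lp.
have [P hP] := quotE ne.
have [v ve] := ends_ex e; have [v' ve'] := ends_ex (b e).
have [E|zx] := eqVneq (cproj e v) (P v').
  by rewrite -(merged_in o ve) E (merged_in' hP ve' oe).
exfalso; have [_ fP hPo] := hP.
have third (X : mgraph n) (h : edge X) : #|vert X| = 3%N -> ~~ is_loop h ->
    exists c, forall x, (x \in ends h) = (x != c).
  move=> vX; rewrite nonloopE => /eqP ch.
  have /eqP/cards1P[c ec] : #|~: ends h| = 1%N by have := cardsC (ends h); rewrite ch vX; lia.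
  by exists c => x; rewrite -[ends h]setCK ec !inE.
have nbe : ~~ is_loop (b e) by rewrite lp.
have [c hc] := third G e v3 ne; have [c' hc'] := third G' (b e) v3' nbe.
have cce := contract_contr1 e; have pH := contr1_ps_down cce pG ne.
have vH : #|vert (contract e)| = 2%N by have := contr1_vcard cce pG pH; rewrite v3 => -[].
have cc : cproj e c = P v'.
  have [h|//] := vert2 (cproj e c) vH zx.
  by case/cproj_eq: h => [h|[]]; [move: ve; rewrite -h|]; rewrite hc eqxx.
have cc' : P c' = cproj e v.
  have [//|h] := vert2 (P c') vH zx.
  by case/fP: h => [h|[]]; [move: ve'; rewrite -h|]; rewrite hc' eqxx.
have single_ne (q : item G) (f : edge G) : single q -> ~~ is_loop f -> q != inl f.
  by move=> sq nf; apply: contraTneq sq => ->; rewrite /single /= -/(is_loop f) (negPf nf).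
have T1 (q : item G) y : single q -> c \in spot q -> y \in spot (item_map s b q) -> y \in ends (b e).
  move=> sq cq yq; have : P y \in P @: spot (item_map s b q) by apply: imset_f.
  rewrite hPo ?single_ne // (spot_in1 cq sq) imset_set1 inE cc => /eqP /fP[->|[]] //.
have T2 (q : item G) y : single q -> c \notin spot q -> y \in spot (item_map s b q) -> y = c'.
  move=> sq cq yq; have : P y \in P @: spot (item_map s b q) by apply: imset_f.
  have [x xq] := spot_ex q; have xe : x \in ends e.
    by rewrite hc; apply: contraNneq cq => <-.
  rewrite hPo ?single_ne // (spot_in1 xq sq) imset_set1 inE.
  rewrite (_ : cproj e x = cproj e v) => [|]; last by apply/cproj_eq; right.
  by rewrite -cc' => /eqP /fP[//|[_]]; rewrite hc' eqxx.
have np f : ~~ is_loop f -> f != e -> c \in ends f.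
  move=> nf fe; apply/negPn/negP=> cf.
  have E : ends f = ends e.
    have [x [y [xy exy]]] := nonloopP _ nf.
    have inE' t : t \in ends f -> t \in ends e by move=> tf; rewrite hc; apply: contraNneq cf => <-.
    rewrite exy; apply/esym; apply: nonloop_two => //; apply: inE'; by rewrite exy !inE eqxx ?orbT.
  have := par_iff ne nf; rewrite E eqxx => /eqP Eb.
  have : P v' \in cproj e @: ends f by rewrite -(hPo (inl f)) //= Eb imset_f.
  rewrite E => /imsetP[x xe h]; case/eqP: zx; rewrite h.
  by apply/cproj_eq; right.
have np' f : ~~ is_loop f -> f != e -> c' \in ends (b f).
  move=> nf fe; apply/negPn/negP=> cf.
  have nbf : ~~ is_loop (b f) by rewrite lp.
  have E : ends (b f) = ends (b e).
    have [x [y [xy exy]]] := nonloopP _ nbf.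
    have inE' t : t \in ends (b f) -> t \in ends (b e) by move=> tf; rewrite hc'; apply: contraNneq cf => <-.
    rewrite exy; apply/esym; apply: nonloop_two => //; apply: inE'; by rewrite exy !inE eqxx ?orbT.
  have := par_iff ne nf; rewrite E eqxx => /esym/eqP Ef.
  by have := np f nf fe; rewrite Ef hc eqxx.
(* Contract f, which joins a and c. If Q names x' like x, a loop or marking at x would be at c' by
   [T2] and at x' by Q. If Q names x' like the merged vertex, the same clash empties a; stability
   gives another edge at a, parallel to f, and this forces a' = x'. *)
have key f a x a' x' : ~~ is_loop f -> f != e -> a != c -> a' != c' ->
    ends f = [set a; c] -> x \notin ends f -> ends (b f) = [set a'; c'] -> x' \notin ends (b f) ->
    (forall q : item G, single q -> x \notin spot q) /\
    (forall q : item G, single q -> x' \notin spot (item_map s b q)).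
  move=> nf fe ac ac' ef xf ef' xf'.
  have [Q [_ fQ hQ]] := quotE nf.
  have ccf := contract_contr1 f; have pF := contr1_ps_down ccf pG nf.
  have vF : #|vert (contract f)| = 2%N by have := contr1_vcard ccf pG pF; rewrite v3 => -[].
  have xc : x != c by apply: contraNneq xf => ->; rewrite ef !inE eqxx orbT.
  have xc' : x' != c' by apply: contraNneq xf' => ->; rewrite ef' !inE eqxx orbT.
  have ax : cproj f a != cproj f x by rewrite (contr1_out _ ccf) //; apply: contraNneq xf => <-; rewrite ef !inE eqxx.
  have Qx y : Q y = Q x' -> y = x' by case/fQ=> // -[_]; rewrite (negPf xf').
  have [E|E] := vert2 (Q x') vF ax; last first.
    have b1 (q : item G) : single q -> x \notin spot q.
      move=> sq; apply/negP=> xq; have [y yq] := spot_ex (item_map s b q).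
      have : Q y \in Q @: spot (item_map s b q) by apply: imset_f.
      rewrite hQ ?single_ne // (spot_in1 xq sq) imset_set1 inE -E => /eqP /Qx yx.
      have := T2 q y sq _ yq; rewrite yx => /(_ _)/eqP; rewrite (negPf xc') => h.
      suff : false by []; apply: h; by rewrite (spot_in1 xq sq) inE eq_sym.
    split=> // q sq; apply/negP=> xq.
    have : Q x' \in Q @: spot (item_map s b q) by apply: imset_f.
    rewrite hQ ?single_ne // E => /imsetP[y yq /cproj_eq[h|[h _]]].
      by have := b1 q sq; rewrite h yq.
    by rewrite h in xf.
  exfalso.
  have ba (q : item G) : single q -> a \notin spot q.
    move=> sq; apply/negP=> aq; have [y yq] := spot_ex (item_map s b q).
    have : Q y \in Q @: spot (item_map s b q) by apply: imset_f.
    rewrite hQ ?single_ne // (spot_in1 aq sq) imset_set1 inE -E => /eqP /Qx yx.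
    have := T2 q y sq _ yq; rewrite yx => /(_ _)/eqP; rewrite (negPf xc') => h.
    suff : false by []; apply: h; by rewrite (spot_in1 aq sq) inE eq_sym.
  have [e3 [ae3 e3e e3f n3]] := val_three_single pG ba e f.
  have c3 := np e3 n3 e3e.
  have E3 : ends e3 = ends f by rewrite ef; apply: nonloop_two.
  have := par_iff nf n3; rewrite E3 eqxx => /eqP Eb.
  have : Q a' \in cproj f @: ends e3.
    by rewrite -(hQ (inl e3)) //= Eb imset_f // ef' !inE eqxx.
  rewrite E3 => /imsetP[y yf h].
  have : Q a' = Q x'.
    by rewrite h E; apply/cproj_eq; right; rewrite yf ef !inE eqxx.
  by move/Qx => ax'; rewrite -ax' ef' !inE eqxx in xf'.
have v2 : (1 < #|vert G|)%N by rewrite v3.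
have [f nf cf] := two_nonloop c (ps_connected pG) v2.
have fe : f != e by apply: contraTneq cf => ->; rewrite hc eqxx.
have [a ac ef] := nonloop_at nf cf; rewrite setUC in ef.
have nbf : ~~ is_loop (b f) by rewrite lp.
have [a' ac' ef'] := nonloop_at nbf (np' f nf fe); rewrite setUC in ef'.
have [x hx] := third G f v3 nf; have [x' hx'] := third G' (b f) v3' nbf.
have xf : x \notin ends f by rewrite hx eqxx.
have xf' : x' \notin ends (b f) by rewrite hx' eqxx.
have [bx bx'] := key f a x a' x' nf fe ac ac' ef xf ef' xf'.
have [h [xh he hf nh]] := val_three_single pG bx e f.
have ch := np h nh he; have ch' := np' h nh he.
have xc : x != c by apply: contraNneq xf => ->.
have eh := nonloop_two nh xh ch xc.
have nbh : ~~ is_loop (b h) by rewrite lp.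
have [y' yc' eh'] := nonloop_at nbh ch'; rewrite setUC in eh'.
have ax : a != x by apply: contraNneq xf => <-; rewrite ef !inE eqxx.
have ah : a \notin ends h by rewrite eh !inE negb_or ax.
have ya : a' != y'.
  apply/eqP=> E; have := par_iff nf nh; rewrite eh' ef' E eqxx => /esym/eqP E2.
  by rewrite -E2 xh in xf.
have ah' : a' \notin ends (b h) by rewrite eh' !inE negb_or ya.
have [ba ba'] := key h x a y' a' nh he xc yc' eh ah eh' ah'.
have [y yo] := spot_ex o.
(* The ends of b e are a' and x', so no place is left for o: [T1] excludes c, and [ba] and [bx]
   exclude a and x. *)
have [co|co] := boolP (c \in spot o).
  have [t to] := spot_ex (item_map s b o).
  have := T1 o t so co to; rewrite hc' => tc.
  have xc' : x' != c' by apply: contraNneq xf' => ->; rewrite ef' !inE eqxx orbT.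
  have ax' : a' != x' by apply: contraNneq xf' => <-; rewrite ef' !inE eqxx.
  have [E|E|E] := vert3 t v3' ax' ac' xc'.
  - by have := ba' o so; rewrite -E to.
  - by have := bx' o so; rewrite -E to.
  by rewrite E eqxx in tc.
have [E|E|E] := vert3 y v3 ax ac xc.
- by have := ba o so; rewrite -E yo.
- by have := bx o so; rewrite -E yo.
by rewrite -E yo in co.
Qed.

(** Some edge leaves {x, y}, and it contains only one of the two. *)
Lemma star_uniq (X : mgraph n) (x y : vert X) : ps X -> (3 <= #|vert X|)%N ->
  (forall h, ~~ is_loop h -> (x \in ends h) = (y \in ends h)) -> x = y.
Proof.
move=> pX vX hxy; apply/eqP/negPn/negP=> xy.
have [||e [p [q [pA qA ee]]]] := cut_edge (A := [set x; y]) (ps_connected pX).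
- by apply/set0Pn; exists x; rewrite !inE eqxx.
- by apply: contraTneq vX => E; rewrite -cardsT -E cards2 xy.
move: qA; rewrite !inE negb_or => /andP[qx qy].
have ne : ~~ is_loop e.
  apply/nonloopP; exists p, q; split=> //.
  by apply: contraTneq pA => ->; rewrite !inE negb_or qx.
have := hxy e ne; move: pA; rewrite ee !inE => /orP[] /eqP ->; rewrite eqxx /=.
  by rewrite eq_sym (negPf xy) eq_sym (negPf qy).
by rewrite (negPf xy) eq_sym (negPf qx).
Qed.

Hypothesis v3 : (3 <= #|vert G|)%N.

Lemma touch_iff e o : ~~ is_loop e -> o != inl e -> touch e o <-> touch' e o.
Proof.
move=> ne oe; have [h|h] := leqP 4 #|vert G|; first exact: touch4.
by apply: touch3 => //; apply/eqP; rewrite eqn_leq v3 -ltnS h.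
Qed.

Definition star_eq (v : vert G) (v' : vert G') :=
  forall h, ~~ is_loop h -> (v \in ends h) = (v' \in ends (b h)).

(** Non-parallel e and f meet only in v, and [star_mem] describes the edges through v by incidence
    with e and f, parallelism and images in the contraction of e. All of these agree for G and
    G'. *)
Lemma star_common e f v : ~~ is_loop e -> ~~ is_loop f -> ends e <> ends f ->
  v \in ends e -> v \in ends f ->
  exists v', [/\ star_eq v v', v' \in ends (b e) & v' \in ends (b f)].
Proof.
move=> ne nf ef ve vf.
have fe : inl f != inl e :> item G by apply/eqP=> -[E]; rewrite E in ef.
have [|v' ve' vf'] := (touch_iff ne fe).1; first by exists v.
exists v'; split=> // h nh; have [P hP] := quotE ne; have [_ fP hPo] := hP.
have card2 (X : mgraph n) (k : edge X) : ~~ is_loop k -> #|ends k| = 2%N by rewrite nonloopE => /eqP.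
have [->|he] := eqVneq h e; first by rewrite ve ve'.
have [->|hf] := eqVneq h f; first by rewrite vf vf'.
have ef' : ends (b e) <> ends (b f).
  by move=> E; apply: ef; apply/esym/eqP; rewrite -par_iff // E.
have nb k : ~~ is_loop k -> ~~ is_loop (b k) by rewrite lp.
have s1 := star_mem (card2 _ _ ne) (card2 _ _ nf) (card2 _ _ nh) ve vf ef (cproj_eq e).
have s2 := star_mem (card2 _ _ (nb _ ne)) (card2 _ _ (nb _ nf)) (card2 _ _ (nb _ nh)) ve' vf' ef' fP.
have tw k : ~~ is_loop k -> h != k -> meets (ends h) (ends k) <-> meets (ends (b h)) (ends (b k)).
  by move=> nk hk; apply: (touch_iff (o := inl k) nh); rewrite eq_sym.
have t1 := tw e ne he; have t2 := tw f nf hf.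
have t3 : ends f = ends h <-> ends (b f) = ends (b h).
  by split=> /eqP; [rewrite -par_iff //|rewrite par_iff //] => /eqP.
have t4 : cproj e @: ends f = cproj e @: ends h <-> P @: ends (b f) = P @: ends (b h).
  by rewrite -(hPo (inl f)) // -(hPo (inl h)).
apply/idP/idP.
  move/s1=> [a1 a2 a3]; apply/s2; split; [exact/t1|exact/t2|].
  by case: a3 => [a3|a3]; [left; apply/t3|right=> E; apply: a3; apply/t4].
move/s2=> [a1 a2 a3]; apply/s1; split; [exact/t1|exact/t2|].
by case: a3 => [a3|a3]; [left; apply/t3|right=> E; apply: a3; apply/t4].
Qed.

(** If all non-loops at v are parallel to e, [star_common] applies to the other end u of e, where
    some edge leaves e; the vertex sought is then the other end of b e. *)
Lemma star_ex v : exists v', star_eq v v'.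
Proof.
have hc := ps_connected pG.
have v2 : (1 < #|vert G|)%N by apply: leq_trans v3.
have [e ne ve] := two_nonloop v hc v2.
case: (pselect (exists f, [/\ ~~ is_loop f, v \in ends f & ends e <> ends f])) => [[f [nf vf ef]]|hno].
  by have [v' [h _ _]] := star_common ne nf ef ve vf; exists v'.
have vpar f : ~~ is_loop f -> v \in ends f -> ends f = ends e.
  by move=> nf vf; apply: contrapT => E; apply: hno; exists f; split=> // E2; apply: E.
have [u uv eu] := nonloop_at ne ve.
have [||f [x [y [xA yA ef]]]] := cut_edge (A := ends e) hc.
- by apply/set0Pn; exists v.
- by apply: contraTneq v3 => E; move: ne; rewrite nonloopE E cardsT => /eqP ->.
have nf : ~~ is_loop f.
  by apply/nonloopP; exists x, y; split=> //; apply: contraNneq yA => <-.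
have fe : ends e <> ends f by move=> E; rewrite E ef !inE eqxx orbT in yA.
have xu : x = u.
  move: xA; rewrite eu !inE => /orP[] /eqP // xv.
  by case: fe; rewrite -(vpar f nf) // ef xv !inE eqxx.
have ue : u \in ends e by rewrite eu !inE eqxx orbT.
have uf : u \in ends f by rewrite ef xu !inE eqxx.
have [u' [hu ue' uf']] := star_common ne nf fe ue uf.
have nbe : ~~ is_loop (b e) by rewrite lp.
have [v' vu' ev'] := nonloop_at nbe ue'.
have ve' : v' \in ends (b e) by rewrite ev' !inE eqxx orbT.
exists v' => h nh; have nbh : ~~ is_loop (b h) by rewrite lp.
apply/idP/idP=> [vh|vh].
  have := par_iff ne nh; rewrite (vpar h nh vh) eqxx => /eqP ->; exact: ve'.
have [->//|he] := eqVneq h e.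
have eh : inl e != inl h :> item G by apply: contra_neq he => -[].
have [|t th te] := (touch_iff nh eh).2; first by exists v'.
move: te; rewrite /= eu !inE => /orP[] /eqP tE; first by rewrite -tE.
have uh' : u' \in ends (b h) by rewrite -(hu h nh) -tE.
have E : ends (b h) = ends (b e) by rewrite ev'; apply: nonloop_two; rewrite // eq_sym.
by have := par_iff ne nh; rewrite E eqxx => /esym/eqP ->.
Qed.

(** Vertices go to vertices with the same star. A loop or marking touches exactly the non-loops
    through its vertex, so it follows that vertex. *)
Lemma rebuild : exists fV, siso s b fV.
Proof.
have v3' : (3 <= #|vert G'|)%N by rewrite vG'.
have [fV hfV] := choice star_ex.
have inj : injective fV.
  move=> x y E; apply: (star_uniq pG v3) => h nh.
  by rewrite (hfV x h nh) (hfV y h nh) E.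
have uniq v v' : star_eq v v' -> v' = fV v.
  move=> hv; have [b' K1 K2] := bb; apply: (star_uniq pG' v3') => h nh.
  have nh' : ~~ is_loop (b' h) by rewrite -lp K2.
  by rewrite -(K2 h) -(hv _ nh') -(hfV v _ nh').
have sg o x : spot o = [set x] -> spot (item_map s b o) = [set fV x].
  move=> ox; have so : single o by rewrite /single ox cards1.
  have /cards1P[y oy] : single (item_map s b o) by rewrite item_map_single.
  rewrite oy; congr [set _]; apply: uniq => h nh.
  have oh : o != inl h.
    by apply: contraTneq so => ->; rewrite /single /= -/(is_loop h) (negPf nh).
  have := touch_iff nh oh; rewrite /touch /touch' ox oy => t.
  apply/idP/idP=> hx.
    by have [|z zh] := t.1; [exists x; rewrite // inE|rewrite inE => /eqP <-].
  by have [|z zh] := t.2; [exists y; rewrite // inE|rewrite inE => /eqP <-].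
exists fV; split.
- by apply: inj_card_bij; rewrite ?vG'.
- move=> e; have [le|ne] := boolP (is_loop e).
    by have /loopP[x ex] := le; rewrite ex imset_set1; apply: (sg (inl e)).
  have [x [y [xy ex]]] := nonloopP _ ne.
  rewrite ex imsetU1 imset_set1; apply: nonloop_two; rewrite ?lp ?(inj_eq inj) //.
    by rewrite -hfV // ex !inE eqxx.
  by rewrite -hfV // ex !inE eqxx orbT.
by move=> i; apply: set1_inj; apply: (sg (inr i)).
Qed.

End Quot.

Hypothesis hw : forall i, 0 < w i <= 1.
Hypotheses (hg : (1 <= g)%N) (hgn : (3 <= 2 * g - 2 + n)%N).

(** Induction on the number of vertices. The inverse of the vertex map obtained for G / e, composed
    with the contraction of G', is the [quot] that [rebuild] needs. *)
Theorem pure_siso R (s : {perm 'I_n}) G G' b : bicorr g w R -> mark_perm g w R s ->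
  R G G' b -> ps G -> exists fV, siso s b fV.
Proof.
move=> hB hs; have [m] := ubnP #|vert G|; elim: m => // m IH in G G' b *.
rewrite ltnS => hm hG pG.
have pG' := bi_ps hw hg hgn hB hG pG.
have vG' := bi_vcard hw hg hgn hB hG pG.
have lp e : is_loop (b e) = is_loop e by exact: (bi_loop hw hg hgn hB _ hG pG).
have [v3|] := leqP 3 #|vert G|.
  apply: (rebuild pG pG' vG' (r_bij hB.1 hG) lp _ v3) => e ne.
  have hc := contract_contr1 e; have pH := contr1_ps_down hc pG ne.
  have [H' [c hH]] := tot_ps hg hB.1 pH.
  have vH := contr1_vcard hc pG pH.
  have [|fV [[fV' K1 K2] fVe fVm]] := IH _ _ _ _ hH pH; first by rewrite -ltnS -vH.
  have [pi' [ep' [hc' q']]] := r_contr1 hB.1 hG hH hc.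
  exists (fV' \o pi'); split.
  - move=> y; have [x hx] := contr1_surj hc' (fV y); exists x; by rewrite /= hx K1.
  - move=> x y; rewrite /= -(contr1_eq hc'); split=> [/(can_inj K2)//|-> //].
  have canS (A : {set vert (contract e)}) : fV' @: (fV @: A) = A.
    by rewrite -imset_comp (eq_imset (g := id)) ?imset_id // => z /=; rewrite K1.
  case=> [f|i] oe.
    have fe : f != e := oe.
    rewrite imset_comp /= -(q' (exist _ f fe)) -(contr1_ends hc') fVe canS.
    by rewrite (contr1_ends hc).
  rewrite imset_comp /= imset_set1 -(contr1_mark hc') fVm -imset_set1 canS.
  by rewrite (contr1_mark hc) imset_set1.
rewrite ltnS leq_eqVlt => /orP[/eqP v2|v1]; first exact: (two_vertex_siso hw hg hgn hB hs hG pG v2).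
have v1' : #|vert G| = 1%N.
  by apply/eqP; rewrite eqn_leq -ltnS v1; case/andP: (ps_connected pG).
have [|fV hV] := @card_bij (vert G) (vert G'); first by rewrite vG'.
have uniq (x y : vert G') : x = y.
  by move: vG'; rewrite v1' => /eqP/fintype1P[z hz]; rewrite (hz x) (hz y).
exists fV; split=> // e.
have /loopP[x ex] : is_loop e by apply: one_loop.
have /loopP[y ey] : is_loop (b e) by rewrite lp; apply: one_loop.
by rewrite ex ey imset_set1 (uniq y (fV x)).
Qed.
End Many.

(** * Vertices of positive genus *)

Section AddLoop.
Variables (n : nat) (G : mgraph n) (v : vert G).

Definition add_loop_ends (e : option (edge G)) : {set vert G} :=
  if e is Some f then ends f else [set v].

Lemma add_loop_ends_card e : (0 < #|add_loop_ends e| <= 2)%N.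
Proof. by case: e => [e|] /=; rewrite ?cards1 // ends_card. Qed.

(** One unit of genus at v is traded for a loop; when v has positive genus, contracting the loop
    undoes this ([add_loop_contr]). *)
Definition add_loop : mgraph n :=
  @MGraph n (vert G) (option (edge G)) add_loop_ends add_loop_ends_card
    (fun x => (hgen x - (x == v))%N) (fun i => mark G i).

Lemma contr1_loop_h (X H : mgraph n) (e : edge X) pi ep a x : @contr1 n X H e pi ep ->
  ends e = [set a] -> hgen (pi x) = (hgen x + (x == a))%N.
Proof.
move=> hc ea.
have inj : injective pi.
  by move=> y z /(contr1_eq hc)[//|[]]; rewrite ea !inE => /eqP -> /eqP ->.
have := c_h hc.1 (pi x).
have fib (F : vert X -> nat) : (\sum_(y | pi y == pi x) F y = F x)%N.
  by rewrite (eq_bigl (pred1 x)) ?big_pred1_eq // => y; rewrite (inj_eq inj).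
rewrite !fib (eq_bigl (fun f => (f == e) && (a == x))); last first.
  move=> f; rewrite hc.2 negbK; case: eqP => //= ->.
  by rewrite ea imset_set1 (inj_eq set1_inj) (inj_eq inj).
by rewrite big_mkcondr /= big_pred1_eq eq_sym; case: eqP => _; lia.
Qed.

Hypothesis hv : (0 < hgen v)%N.

Lemma add_loop_contr : @contr1 n add_loop G None id Some.
Proof.
have cod f : (f \in codom (Some : edge G -> option (edge G))) = (f != None).
  by case: f => [f|]; [apply: codom_f|apply/codomP=> -[]].
split=> //; split=> //.
- exact: Some_inj.
- by move=> y; exists y.
- by move=> e; rewrite imset_id.
- move=> x y; split=> [-> //|/connectP[q]].
  elim: q x => [|a q IH] x /=; first by move=> _ ->.
  case/andP=> /existsP[f /and3P[]]; rewrite cod negbK => /eqP ->.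
  by rewrite /= !inE => /eqP -> /eqP -> ; apply: IH.
move=> y; have fib (F : vert G -> nat) : (\sum_(x | x == y) F x = F y)%N by rewrite big_pred1_eq.
rewrite !fib (eq_bigl (fun f => (f == None) && (v == y))); last first.
  by move=> f; rewrite cod negbK; case: eqP => //= ->; rewrite imset_id (inj_eq set1_inj).
rewrite big_mkcondr /= big_pred1_eq [v == y]eq_sym.
by have [->|_] := eqVneq y v; move: hv; lia.
Qed.

Lemma add_loop_stable g w : stable g w G -> stable g w add_loop.
Proof.
move=> hs; have hc := add_loop_contr; split.
- exact: contr1_connected hc (stable_connected hs).
- by rewrite -(contr_genus hc.1) (stable_genus hs).
move=> x; have := stable_vert hs x.
have -> : [set i | mark add_loop i == x] = [set i | mark G i == x] by [].
have -> : @valence n add_loop x = (@valence n G x + 2 * (x == v))%N.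
  rewrite /valence [LHS]big_mkcond [X in _ = (X + _)%N]big_mkcond.
  rewrite (sum_edges _ hc.1) addnC; congr (_ + _)%N.
  rewrite (eq_bigl (pred1 None)) ?big_pred1_eq => [|e]; last by rewrite hc.2 negbK.
  by rewrite /= inE /is_loop /= cards1; case: eqP.
have : (2 * @hgen n G x + @valence n G x = 2 * @hgen n add_loop x + (@valence n G x + 2 * (x == v)))%N.
  by rewrite /=; have [->|_] := eqVneq x v; move: hv; lia.
move/(congr1 (fun k : nat => k%:R : rat)); rewrite [LHS]natrD [RHS]natrD !natrM.
move: (weight _ _) => W; lra.
Qed.

End AddLoop.

Section All.
Variables (g n : nat) (w : 'I_n -> rat).
Hypothesis hw : forall i, 0 < w i <= 1.
Hypotheses (hg : (1 <= g)%N) (hgn : (3 <= 2 * g - 2 + n)%N).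
Implicit Types G H : mgraph n.

(** Induction on the total vertex genus, which [add_loop] lowers. The image of the new loop sits at
    fV v, so contracting it on both sides restores the genus at matching vertices. *)
Theorem stable_siso R (s : {perm 'I_n}) G G' b : bicorr g w R -> mark_perm g w R s ->
  R G G' b -> exists2 fV, siso s b fV & forall v, hgen (fV v) = hgen v.
Proof.
move=> hB hs; have [m] := ubnP (\sum_(v : vert G) hgen v).
elim: m => // m IH in G G' b *; rewrite ltnS => hm hG.
have sG := r_st1 hB.1 hG.
case: (pickP (fun v : vert G => 0 < hgen v)%N) => [v hv|h0]; last first.
  have pG : ps g w G by split=> // v; have := h0 v; case: (hgen v).
  have [fV hf] := pure_siso hw hg hgn hB hs hG pG; exists fV => // v.
  by rewrite pG.2 (bi_ps hw hg hgn hB hG pG).2.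
have sX := add_loop_stable hv sG; have hc := add_loop_contr hv.
have [|X' [c hX]] := r_tot hB.1 sX; first by rewrite card_option.
have [|fV [bV eV mV] hV] := IH _ _ _ _ hX.
  apply: leq_trans hm; rewrite (bigD1 v) //= [ltnRHS](bigD1 v) //= eqxx.
  have : (\sum_(i | i != v) (hgen i - (i == v)) <= \sum_(i | i != v) hgen i)%N.
    by apply: leq_sum => i _; apply: leq_subr.
  move: hv; lia.
have [pi [ep [hc' q]]] := r_contr1 hB.1 hX hG hc.
have eN : ends (c None) = [set fV v] by rewrite eV imset_set1.
have inj : injective pi.
  by move=> y z /(contr1_eq hc')[//|[]]; rewrite eN !inE => /eqP -> /eqP ->.
have hpi y := contr1_loop_h y hc' eN.
exists (pi \o fV); last first.
  by move=> x; rewrite /= hpi hV (inj_eq (bij_inj bV)) /=; have [->|_] := eqVneq x v; move: hv; lia.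
split.
- apply: bij_comp bV; have [r hr] := choice (contr1_surj hc').
  by exists r => // y; apply: inj; rewrite hr.
- by move=> e; rewrite (contr1_ends hc') q eV -imset_comp.
by move=> i; rewrite (contr1_mark hc') mV.
Qed.

End All.

(** * Automorphisms of the complex *)

Section Final.
Variables (g n : nat) (w : 'I_n -> rat).
Implicit Types G H : mgraph n.
Notation D := (Delta g w).

Definition mk_egraph p G (t : edge G -> 'I_p.+1) (hs : stable g w G) (ht : bijective t) :
  egraph g w p := @EGraph g n w p (@LGraph n _ G t) hs ht.

(** The labels are quantified away; what is kept is the bijection b that matches edges of equal
    label. *)
Definition rel_of (F : sdhom D D) : edge_rel n := fun G G' b =>
  exists p (t : edge G -> 'I_p.+1) (t' : edge G' -> 'I_p.+1) hs hs' ht ht',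
    F p (iso_class (mk_egraph (t := t) hs ht)) = iso_class (mk_egraph (t := t') hs' ht')
    /\ forall e, t' (b e) = t e.

Lemma rel_of_corr F : corr g w (rel_of F).
Proof.
split.
- by move=> G G' b [p [t [t' [hs _]]]].
- by move=> G G' b [p [t [t' [hs [hs' _]]]]].
- move=> G G' b [p [t [t' [_ [_ [[u K1 K2] [[u' K1' K2'] [_ h]]]]]]]].
  exists (u \o t') => e /=; first by rewrite h K1.
  by apply: (can_inj K1'); rewrite h K2.
- move=> G hs hE; have [|t ht] := @card_bij (edge G) 'I_(#|edge G|.-1).+1.
    by rewrite card_ord prednK.
  have [x' hx'] := class_surj (F _ (iso_class (mk_egraph hs ht))).
  case: x' hx' => [[G' t'] /= hs' ht'] hx'.
  have [u' K1 K2] := ht'; exists G', (u' \o t).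
  exists _, t, t', hs, hs', ht, ht'; split; first exact: hx'.
  by move=> e; rewrite /= K2.
move=> G G' b H H' c pi ep [p [t [t' [hs [hs' [ht [ht' [hF hb]]]]]]]].
move=> [q [r [r' [ks [ks' [kr [kr' [kF kc]]]]]]]] hpi.
have [ri K1 K2] := kr.
(* The contraction from G to H is the face along the injection taking a label of H to the label of
   the same edge in G; naturality of F is applied to it. *)
have ij : injective (fun k => t (ep (ri k))).
  by move=> k l /(bij_inj ht)/(c_inj hpi)/(can_inj K2).
pose i : Ihom q p := IHom ij.
have pl : pulls i (mk_egraph hs ht) (mk_egraph ks kr).
  by exists pi, ep; split=> // e /=; rewrite K1.
have pE : pull_cell i (iso_class (mk_egraph hs ht)) = iso_class (mk_egraph ks kr).
  rewrite pull_class; apply/class_eq.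
  by apply: (pulls_unique (i := i) (x := mk_egraph hs ht)) (pull_egraph_pulls i _) pl; apply: egr_bij.
have := sdmap_nat F i (iso_class (mk_egraph hs ht)).
rewrite [pull i _]pE kF hF [RHS]pull_class => /class_eq l1.
have pl' := pulls_trans (pull_egraph_pulls i (mk_egraph hs' ht')) (liso_pulls (liso_sym l1)).
have [pi' [ep' [h1 h2]]] := pl'.
exists pi', ep'; split=> // f; apply: (bij_inj ht').
have := h2 (c f); rewrite /= => ->.
by rewrite hb kc K1.
Qed.

Lemma rel_of_inv (F F' : sdhom D D) : (forall p (c : cells D p), F' p (F p c) = c) ->
  (forall p (c : cells D p), F p (F' p c) = c) -> inv_rel (rel_of F) = rel_of F'.
Proof.
move=> h1 h2.
apply: functional_extensionality_dep => G'; apply: functional_extensionality_dep => G.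
apply: funext => c; apply: propext; split.
  case=> b [[p [t [t' [hs [hs' [ht [ht' [hF hb]]]]]]]] K1 K2].
  exists p, t', t, hs', hs, ht', ht; split; first by rewrite -hF h1.
  by move=> e; rewrite -hb K2.
move=> hR; have [b K1 K2] := r_bij (rel_of_corr F') hR.
exists b; split=> //; case: hR => [p [t' [t [hs' [hs [ht' [ht [hF hc]]]]]]]].
exists p, t, t', hs, hs', ht, ht'; split; first by rewrite -hF h2.
by move=> e; rewrite -hc K2.
Qed.

Lemma sdaut_bicorr (F : sdaut D) : bicorr g w (rel_of F).
Proof.
split; first exact: rel_of_corr.
have [F' [h1 h2]] := aut_inv F.
rewrite (@rel_of_inv F F'); first exact: rel_of_corr.
  by move=> p c; rewrite -[LHS]/(sdcomp F' F p c) h2.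
by move=> p c; rewrite -[LHS]/(sdcomp F F' p c) h1.
Qed.

Hypothesis hw : forall i, 0 < w i <= 1.

Section Action.
Variable s : [subg Aut_Kw w].

Lemma perm_egraph_liso p (x y : egraph g w p) : liso x y ->
  liso (perm_egraph hw s x) (perm_egraph hw s y).
Proof. exact: liso_perm. Qed.

Lemma act_subproof p (c : cell g w p) : exists y : egraph g w p,
  (fun z : egraph g w p => exists2 x, c x & liso (perm_egraph hw s x) z) = fun z => liso y z.
Proof.
have [x ->] := class_surj c; exists (perm_egraph hw s x).
apply: funext => z; apply: propext; split=> [[x' hx' h]|h].
  exact: liso_trans (perm_egraph_liso hx') h.
by exists x => //; apply: liso_refl.
Qed.

Definition act_cell p (c : cell g w p) : cell g w p := Cell (act_subproof c).

Lemma act_class p (x : egraph g w p) :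
  act_cell (iso_class x) = iso_class (perm_egraph hw s x).
Proof.
apply: cell_inj => z; split=> [[x' hx' h]|h].
  exact: liso_trans (perm_egraph_liso hx') h.
by exists x => //; apply: liso_refl.
Qed.

Lemma act_nat p q (i : Ihom p q) (c : cells D q) :
  act_cell (pull i c) = @pull D p q i (act_cell c).
Proof.
have [x ->] := class_surj c.
rewrite [pull i _]pull_class !act_class [RHS]pull_class; apply/class_eq.
have [pi [ep [h1 h2]]] := pull_egraph_pulls i x.
apply: (pulls_unique (i := i) (x := perm_egraph hw s x)); try exact: egr_bij.
  exists pi, ep; split=> //; case: h1 => a1 a2 a3 a4 a5 a6; split=> //.
  by move=> k; apply: a4.
exact: pull_egraph_pulls.
Qed.

Definition act_hom : sdhom D D := @SdHom D D act_cell act_nat.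

End Action.

Lemma act_mul s t p (c : cell g w p) :
  act_cell (t * s)%g c = act_cell s (act_cell t c).
Proof.
have [x ->] := class_surj c; rewrite !act_class; apply/class_eq.
exists id, id; split=> //; split=> //; try by exists id.
  by move=> e; rewrite imset_id.
by move=> i /=; rewrite invMg permM.
Qed.

Lemma act_one p (c : cell g w p) : act_cell 1%g c = c.
Proof.
have [x ->] := class_surj c; rewrite !act_class; apply/class_eq.
exists id, id; split=> //; split=> //; try by exists id.
  by move=> e; rewrite imset_id.
by move=> i /=; rewrite invg1 perm1.
Qed.

Lemma act_inv s : sdinvertible (act_hom s).
Proof.
exists (act_hom s^-1%g); split; apply: sdhom_eq => p c /=; rewrite -act_mul ?mulVg ?mulgV;
  exact: act_one.
Qed.

Definition act (s : [subg Aut_Kw w]) : sdaut D := SdAut (act_inv s).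

(** * Surjectivity and injectivity of the action *)

Hypotheses (hg : (1 <= g)%N) (hgn : (3 <= 2 * g - 2 + n)%N).

(** A pendant vertex with marking set S is attached to the rose, which is stable since w(S) > 1. In
    the image the corresponding leaf carries s(S), and [leaf_heavy] applies. *)
Lemma heavy_image R (s : {perm 'I_n}) (S : {set 'I_n}) : bicorr g w R -> mark_perm g w R s ->
  1 < weight w S -> 1 < weight w (s @: S).
Proof.
move=> hB hs hS.
pose X := @expand n (rose g n) tt (fun=> Keep) (mem S).
have hN : ends (None : edge X) = [set None; Some tt] by [].
have eS e : ends (Some e : edge X) = [set Some tt] by rewrite expand_keep ?imset_set1.
have pR := rose_ps hw hg hgn.
have hp : pure X by apply: expand_pure pR.
have mN i : (mark X i == None) = (i \in S).
  by rewrite /=; case: (i \in S).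
have pX : ps g w X.
  apply: expand_ps => //.
    apply: (@vstable_heavy _ _ X None hp None); first by rewrite hN !inE.
    by rewrite (_ : [set i | _] = S) //; apply/setP=> i; rewrite inE mN.
  apply: (@vstable_loop _ _ hw X (Some tt) hp (Some (Ordinal hg : edge (rose g n))) None) => //.
  - by rewrite /is_loop eS cards1.
  - by rewrite eS inE.
  - by rewrite hN !inE.
have [X' [c hX]] := tot_ps hg hB.1 pX.
have [fV [[fV' K1 K2] fe fm]] := pure_siso hw hg hgn hB hs hX pX.
have [c' Kc1 Kc2] := r_bij hB.1 hX.
have inj := can_inj K1.
have := leaf_heavy (v := fV None) (e := c None) (bi_ps hw hg hgn hB hX pX).
rewrite (_ : [set i | _] = s @: S); last first.
  apply/setP=> i; rewrite inE -{1}(permKV s i) fm (inj_eq inj) mN.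
  by rewrite -{2}(permKV s i) mem_imset //; apply: perm_inj.
apply.
  by rewrite nonloopE fe hN card_imset // cards2.
move=> f; rewrite -(Kc2 f) fe mem_imset //.
by case: (c' f) => [e|//]; rewrite eS inE.
Qed.

Lemma mark_perm_Aut R (s : {perm 'I_n}) : bicorr g w R -> mark_perm g w R s -> s \in Aut_Kw w.
Proof.
move=> hB hs; rewrite inE; apply/forallP=> S; rewrite !inE !leNgt; apply/eqP; congr (~~ _).
apply/idP/idP=> h; first exact: heavy_image hB hs h.
have := heavy_image (bicorr_inv hB) (mark_perm_inv hw hg hgn hB hs) h.
by rewrite -imset_comp (eq_imset (g := id)) ?imset_id // => i /=; rewrite permK.
Qed.

Lemma act_surj (F : sdaut D) : exists s, act s = F.
Proof.
have hB := sdaut_bicorr F; have [s hs] := mark_perm_ex hw hg hgn hB.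
have sA := mark_perm_Aut hB hs.
exists (subg (Aut_Kw w) s); apply: aut_eq => p c.
have [x ->] := class_surj c; rewrite [LHS]act_class.
have [x' hx'] := class_surj (F p (iso_class x)); rewrite hx'; apply/class_eq.
case: x hx' => [[G t] hs1 ht]; case: x' => [[G' t'] hs1' ht'] hF.
have [u' K1 K2] := ht'.
have hR : rel_of F (u' \o t : edge G -> edge G').
  by exists p, t, t', hs1, hs1', ht, ht'; split=> // e; exact: (K2 (t e)).
have [fV [bV eV mV] hV] := stable_siso hw hg hgn hB hs hR.
exists fV, (u' \o t); split; last by move=> e; exact: (K2 (t e)).
split=> //; first exact: r_bij hB.1 _ _ _ hR.
by move=> i /=; rewrite subgK // -mV permKV.
Qed.

(** The digon with i alone on its bare vertex goes to those with s i and t i there; if these are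
    isomorphic, [ctype_inj] gives s i = t i. *)
Lemma act_inj : injective act.
Proof.
move=> s t E; apply: val_inj; apply/permP=> i.
have [||H tH] := @ctype_ex g n w hw hg hgn (pred1 i); first by exists i => /=.
  have [g2|g1] := leqP 2 g; [by left|right].
  have n3 : (3 <= n)%N by move: hg hgn g1; lia.
  by have [k [ki _]] := third_mark n3 i i; exists k.
have [pH vH [e1 [e2 [ne nl]]] [c bc mc]] := tH.
have [|r hr] := @card_bij (edge H) 'I_(#|edge H|.-1).+1.
  by rewrite card_ord prednK //; apply: ps_edge pH.
pose x := mk_egraph pH.1 hr.
have tx (u : [subg Aut_Kw w]) : ctype g w (perm_egraph hw u x) (pred1 (sgval u i)).
  split=> //; first by split; [exact: egr_stable (perm_egraph hw u x)|exact: pH.2].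
    by exists e1, e2.
  exists c => // j /=; rewrite mc /=; apply/eqP/eqP=> [<-|->]; by rewrite ?permKV ?permK.
have : iso_class (perm_egraph hw s x) = iso_class (perm_egraph hw t x).
  by rewrite -!act_class -[LHS]/(act s _ _) E.
move/class_eq=> [fV [fE [[bV bE eV hV mV] _]]].
have [pt vt nt _] := tx t.
apply: (ctype_inj hg hgn (i := sgval s i) _ (tx t)).
split=> //.
have [_ _ _ [d bd md]] := tx s.
exists (fV d).
  move=> e; have [fE' K1 K2] := bE; rewrite -(K2 e) eV mem_imset; last exact: bij_inj.
  move=> le; apply: bd; move: le; rewrite /is_loop eV card_imset //; exact: bij_inj.
by move=> j; rewrite mV (inj_eq (bij_inj bV)).
Qed.

End Final.

Unset Implicit Arguments.

(* The product of 'S_n is (t * s) i = s (t i), so (t * s)%g is "s after t".    *)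
Theorem theorem1p1 (g n : nat) (w : 'I_n -> rat)
    (hg : (1 <= g)%N) (hw : forall i, 0 < w i <= 1)
    (hgn : (3 <= 2 * g - 2 + n)%N) :
  exists phi : [subg Aut_Kw w] -> sdaut (Delta g w),
    [/\ forall (s : [subg Aut_Kw w]) (p : nat) (x : egraph g w p),
          phi s p (iso_class x) = iso_class (perm_egraph hw s x),
        forall s t : [subg Aut_Kw w], phi (t * s)%g = aut_comp (phi s) (phi t)
      & bijective phi].
Proof.
exists (act g hw); split.
- by move=> s p x; apply: act_class.
- by move=> s t; apply: aut_eq => p c; apply: act_mul.
have [f hf] := choice (act_surj hw hg hgn).
exists f => // s; apply: (act_inj hg hgn); exact: hf.
Qed.
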